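(* Let $W$ be a simply laced finite Weyl group with nonempty set of simple reflections $\{s_i; i\in I\}$, and let $\nu$ be the maximal value of the length function on $W$. Let $K$ be a subgroup $\neq\{0\}$ of the additive group $\mathbf{R}$, regarded as a semifield in which the semifield sum of $a,b$ is $\min(a,b)$ and the semifield product of $a,b$ is the usual sum $a+b$. Let $\mathcal{B}_K$ be the flag manifold over $K$ attached to $W$, viewed as a graph in which two points $B\neq B'$ of $\mathcal{B}_K$ are joined by an edge if and only if there exist $i\in I$ and a half $i$-circle of $\mathcal{B}_K$ containing both $B$ and $B'$. (i) If $B,B'$ are in $\mathcal{B}_K$ then $B,B'$ are at distance $\le 2\nu-1$. (ii) In particular, the graph $\mathcal{B}_K$ is connected.
   Context: **Semifields.** A semifield is a set $K$ with two operations $+,\times$ such that $(K,\times)$ is an abelian group, $(K,+)$ is a commutative semigroup and $\times$ distributes over $+$. In the definitions below $+$, products and inverses are those of the semifield $K$. (For $K\subset\mathbf{R}$ with the min-plus structure, the semifield sum is $\min$, the semifield product is usual addition, the semifield unit is the real number $0$, and the semifield inverse of $a$ is $-a$.) **Weyl group data.** For $i,j\in I$ put $i.j=-1$ if $i\ne j$ and $s_is_js_i=s_js_is_j$; $i.j=0$ if $i\neq j$ and $s_is_j=s_js_i$; $i.j=2$ if $i=j$. Let $|\cdot|$ be the length function on $W$, $w_0$ the unique element of $W$ of maximal length $\nu$, and $\mathcal{I}$ the set of all sequences $\mathbf{i}=(i_1,\dots,i_\nu)$ in $I$ with $s_{i_1}s_{i_2}\cdots s_{i_\nu}=w_0$.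 For $i\in I$ define $i^!\in I$ by $s_iw_0=w_0s_{i^!}$. **The monoid $\mathfrak{U}(K)$ and the set $\mathcal{U}(K)$.** For a semifield $K$, $\mathfrak{U}(K)$ is the monoid with generators $\{i^a; i\in I,a\in K\}$ and relations: - $i^aj^b=j^bi^a$ if $i.j=0$, $a,b\in K$; - $i^aj^bi^c=j^{a'}i^{b'}j^{c'}$ if $i.j=-1$ and $a,b,c,a',b',c'\in K$ satisfy $ab=b'c'$, $a'b'=bc$, $b'=a+c$ (equivalently $b=a'+c'$); - $i^ai^b=i^{a+b}$ for $i\in I$, $a,b\in K$. For any $\mathbf{i}=(i_1,\dots,i_\nu)\in\mathcal{I}$ the map $f_{\mathbf{i}}:K^\nu\to\mathfrak{U}(K)$, $(a_1,\dots,a_\nu)\mapsto i_1^{a_1}i_2^{a_2}\cdots i_\nu^{a_\nu}$ is injective and its image, denoted $\mathcal{U}(K)$, does not depend on $\mathbf{i}$. **The maps $T_i(a)$.** For $i\in I$, $a\in K$ there is a well defined map $T_i(a):\mathcal{U}(K)\to\mathcal{U}(K)$ such that for every $\mathbf{i}=(i_1,\dots,i_\nu)\in\mathcal{I}$ with $i_1=i$ and every $(a_1,\dots,a_\nu)\in K^\nu$ one has $T_i(a)(f_{\mathbf{i}}(a_1,a_2,\dots,a_\nu))=f_{\mathbf{i}}(a_1a,a_2,\dots,a_\nu)$ (semifield product $a_1a$). **The involution $\phi_K$.** For $K=\mathbf{R}_{>0}$: let $G$ be the split simply connected semisimple group over $\mathbf{R}$ with Weyl group $W$, with a pinning given by opposite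 Borel subgroups $B^+,B^-$ and one-parameter root subgroups $x_i,y_i$ $(i\in I)$ in their unipotent radicals. Identify $\mathcal{U}(\mathbf{R}_{>0})$ with a subset of the unipotent radical of $B^+$ by $i_1^{a_1}\cdots i_\nu^{a_\nu}\mapsto u=x_{i_1}(a_1)\cdots x_{i_\nu}(a_\nu)$, and with a subset of the unipotent radical of $B^-$ by $i_1^{a_1}\cdots i_\nu^{a_\nu}\mapsto u'=y_{i_1}(a_1)\cdots y_{i_\nu}(a_\nu)$. Then $\phi_{\mathbf{R}_{>0}}:\mathcal{U}(\mathbf{R}_{>0})\to\mathcal{U}(\mathbf{R}_{>0})$ sends the element corresponding to $u$ to the element corresponding to the unique $u'$ of this form such that $u^{-1}B^-u=u'^{-1}B^+u'$. In the coordinates $f_{\mathbf{i}}$ the map $\phi_{\mathbf{R}_{>0}}$ is given by subtraction-free rational functions; evaluating these in an arbitrary semifield $K$ gives a well defined involution $\phi_K:\mathcal{U}(K)\to\mathcal{U}(K)$, independent of $\mathbf{i}$. It satisfies $T_i(a)\phi_K=\phi_KT_{i^!}(a^{-1})$ for all $i\in I$, $a\in K$. **Flag manifold and half circles.** $\mathcal{B}_K=\{[H,H']\in\mathcal{U}(K)\times\mathcal{U}(K);\ \phi_K(H)=H'\}$. For $i\in I$ the multiplicative group of $K$ acts freely on $\mathcal{B}_K$ by $a:[H,H']\mapsto[T_i(a)H,T_{i^!}(a^{-1})H']$. The orbits of this action are called the half $i$-circles of $\mathcal{B}_K$. (The map $H\mapsto[H,\phi_K(H)]$ is a bijection $\mathcal{U}(K)\to\mathcal{B}_K$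 under which the half $i$-circles correspond to the orbits of $a\mapsto T_i(a)$ on $\mathcal{U}(K)$.) **Distance.** For $k\in\mathbf{N}$ and $B,B'\in\mathcal{B}_K$, one says that $B,B'$ are at distance $\le k$ if there is a sequence $B=B_1,B_2,\dots,B_{k+1}=B'$ in $\mathcal{B}_K$ such that for each $j\in\{1,\dots,k\}$ either $B_j=B_{j+1}$ or $B_j,B_{j+1}$ are joined by an edge. *)

(* Defs.v *)
From HB Require Import structures.
From mathcomp Require Import all_boot all_order all_algebra all_fingroup.
From mathcomp Require Import boolp classical_sets reals.

Set Implicit Arguments.
Unset Strict Implicit.
Unset Printing Implicit Defensive.

Import Order.TTheory GRing.Theory Num.Theory.

Inductive word_cong (A : Type) (r : seq A -> seq A -> Prop) :
    seq A -> seq A -> Prop :=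
| WordRel u v : r u v -> word_cong r u v
| WordRefl u : word_cong r u u
| WordSym u v : word_cong r u v -> word_cong r v u
| WordTrans u v w : word_cong r u v -> word_cong r v w -> word_cong r u w
| WordCat u u' v v' : word_cong r u u' -> word_cong r v v' ->
    word_cong r (u ++ v) (u' ++ v').

Section PresentedMonoid.
Local Open Scope quotient_scope.
Variables (A : choiceType) (r : seq A -> seq A -> Prop).

Definition word_congb : rel (seq A) := fun u v => `[< word_cong r u v >].

Lemma word_congb_refl : reflexive word_congb.
Proof. by move=> u; apply/asboolP; apply: WordRefl. Qed.

Lemma word_congb_sym : symmetric word_congb.
Proof. by move=> u v; apply/asboolP/asboolP; apply: WordSym. Qed.

Lemma word_congb_trans : transitive word_congb.
Proof. by move=> v u w /asboolP uv /asboolP vw; apply/asboolP/(WordTrans uv vw). Qed.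

Canonical word_congb_equiv :=
  EquivRel word_congb word_congb_refl word_congb_sym word_congb_trans.

Definition pres_monoid : Type := {eq_quot word_congb_equiv}.

HB.instance Definition _ := Choice.on pres_monoid.

Definition pres_word (u : seq A) : pres_monoid := \pi_pres_monoid u.
Definition pres_gen (x : A) : pres_monoid := pres_word [:: x].
Definition pres_one : pres_monoid := pres_word [::].
Definition pres_mul (p q : pres_monoid) : pres_monoid :=
  pres_word (generic_quotient.repr p ++ generic_quotient.repr q).

Lemma pres_wordP u v : pres_word u = pres_word v <-> word_cong r u v.
Proof.
by split=> [/eqquotP/asboolP //|uv]; apply/eqquotP/asboolP.
Qed.

Lemma repr_pres_word u : word_cong r (generic_quotient.repr (pres_word u)) u.
Proof. by apply/pres_wordP; rewrite /pres_word reprK. Qed.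

Lemma pres_mulE u v : pres_mul (pres_word u) (pres_word v) = pres_word (u ++ v).
Proof. by apply/pres_wordP/WordCat; apply: repr_pres_word. Qed.

Lemma pres_wordK p : pres_word (generic_quotient.repr p) = p.
Proof. exact: reprK. Qed.

Lemma pres_mulA : associative pres_mul.
Proof.
move=> p q s; rewrite -[p]pres_wordK -[q]pres_wordK -[s]pres_wordK.
by rewrite !pres_mulE catA.
Qed.

Lemma pres_mul1l : left_id pres_one pres_mul.
Proof. by move=> p; rewrite -[p]pres_wordK pres_mulE. Qed.

Lemma pres_mul1r : right_id pres_one pres_mul.
Proof. by move=> p; rewrite -[p]pres_wordK pres_mulE cats0. Qed.

HB.instance Definition _ :=
  isMonoid.Build pres_monoid pres_mulA pres_mul1l pres_mul1r.

End PresentedMonoid.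

Local Open Scope ring_scope.

Section Dot.
Variables (I : finType) (gT : finGroupType) (s : I -> gT).
Local Open Scope group_scope.

(* For i != j this is 0 when [s i] and [s j] commute, the only alternative to
   the braid relation under [slw_laced] below. *)
Definition sdot (i j : I) : int :=
  if i == j then 2%Z
  else if s i * s j * s i == s j * s i * s j then (-1)%Z else 0%Z.

Inductive coxeter_rel : seq I -> seq I -> Prop :=
| CoxInv i : coxeter_rel [:: i; i] [::]
| CoxComm i j : sdot i j = 0%Z -> coxeter_rel [:: i; j] [:: j; i]
| CoxBraid i j : sdot i j = (-1)%Z -> coxeter_rel [:: i; j; i] [:: j; i; j].

Definition word_prod (c : seq I) : gT := \prod_(i <- c) s i.

End Dot.

(* A finite Coxeter system with all m_ij in {2, 3} (i != j); such a group is
   automatically crystallographic.  [slw_inv] and [slw_laced] are the Coxeter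
   relations; [slw_gen] and [slw_complete] say that they present the group (as
   a monoid, the generators being involutions). *)
Record simply_laced_weyl := SimplyLacedWeyl {
  slw_index : finType;
  slw_group :> finGroupType;
  slw_refl : slw_index -> slw_group;
  slw_gen : forall w : slw_group, exists c, word_prod slw_refl c = w;
  slw_laced : forall i j : slw_index, i != j ->
    commute (slw_refl i) (slw_refl j) \/
    (slw_refl i * slw_refl j * slw_refl i =
      slw_refl j * slw_refl i * slw_refl j)%g;
  slw_inv : forall i, (slw_refl i * slw_refl i = 1)%g;
  slw_complete : forall c d,
    word_prod slw_refl c = word_prod slw_refl d ->
    word_cong (coxeter_rel slw_refl) c d
}.

Section Weyl.
Variable W : simply_laced_weyl.
Local Notation I := (slw_index W).
Local Notation s := (@slw_refl W).

Definition dot (i j : I) : int := sdot s i j.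

Lemma length_exists (w : W) :
  exists n, [exists c : n.-tuple I, word_prod s c == w].
Proof.
have [c cw] := slw_gen w; exists (size c).
by apply/existsP; exists (in_tuple c); rewrite cw.
Qed.

Definition wlength (w : W) : nat := ex_minn (length_exists w).

Definition nu : nat := \max_(w : W) wlength w.

Definition w0 : W := [arg max_(w > 1%g) wlength w].

(* the set of reduced expressions of [w0] *)
Definition w0_word (c : nu.-tuple I) : Prop := word_prod s c = w0.

(* The default value is irrelevant: conjugation by [w0] permutes the simple
   reflections. *)
Definition bang (i : I) : I := odflt i [pick j | s i * w0 == w0 * s j]%g.

End Weyl.

Record semifield := Semifield {
  sf_car :> choiceType;
  sf_add : sf_car -> sf_car -> sf_car;
  sf_mul : sf_car -> sf_car -> sf_car;
  sf_one : sf_car;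
  sf_inv : sf_car -> sf_car;
  sf_addA : associative sf_add;
  sf_addC : commutative sf_add;
  sf_mulA : associative sf_mul;
  sf_mulC : commutative sf_mul;
  sf_mul1 : left_id sf_one sf_mul;
  sf_mulV : left_inverse sf_one sf_inv sf_mul;
  sf_mulD : left_distributive sf_mul sf_add
}.

Section PositiveReals.
Variable R : realType.

Definition posreal : choiceType := {x : R | 0 < x}.

Definition pos_add (x y : posreal) : posreal :=
  exist _ (sval x + sval y) (addr_gt0 (svalP x) (svalP y)).
Definition pos_mul (x y : posreal) : posreal :=
  exist _ (sval x * sval y) (mulr_gt0 (svalP x) (svalP y)).
Definition pos_one : posreal := exist _ 1 ltr01.

Lemma pos_inv_subproof (x : posreal) : 0 < (sval x)^-1.
Proof. by rewrite invr_gt0 (svalP x). Qed.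
Definition pos_inv (x : posreal) : posreal :=
  exist _ (sval x)^-1 (pos_inv_subproof x).

Lemma pos_addA : associative pos_add.
Proof. by move=> x y z; apply: val_inj; rewrite /= addrA. Qed.
Lemma pos_addC : commutative pos_add.
Proof. by move=> x y; apply: val_inj; rewrite /= addrC. Qed.
Lemma pos_mulA : associative pos_mul.
Proof. by move=> x y z; apply: val_inj; rewrite /= mulrA. Qed.
Lemma pos_mulC : commutative pos_mul.
Proof. by move=> x y; apply: val_inj; rewrite /= mulrC. Qed.
Lemma pos_mul1 : left_id pos_one pos_mul.
Proof. by move=> x; apply: val_inj; rewrite /= mul1r. Qed.
Lemma pos_mulV : left_inverse pos_one pos_inv pos_mul.
Proof.
by move=> x; apply: val_inj; rewrite /= mulVf // gt_eqF // (svalP x).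
Qed.
Lemma pos_mulD : left_distributive pos_mul pos_add.
Proof. by move=> x y z; apply: val_inj; rewrite /= mulrDl. Qed.

Definition pos_semifield : semifield :=
  Semifield pos_addA pos_addC pos_mulA pos_mulC pos_mul1 pos_mulV pos_mulD.

End PositiveReals.

Section MinPlus.
Variables (R : realType) (K : zmodClosed R).

Definition minplus_car : choiceType := {x : R | x \in K}.

Lemma minplus_add_subproof (x y : minplus_car) :
  Num.min (sval x) (sval y) \in K.
Proof. by rewrite minEle; case: ifP => _; [exact: (svalP x) | exact: (svalP y)]. Qed.

Definition minplus_add (x y : minplus_car) : minplus_car :=
  exist _ (Num.min (sval x) (sval y)) (minplus_add_subproof x y).
Definition minplus_mul (x y : minplus_car) : minplus_car :=
  exist _ (sval x + sval y) (rpredD (svalP x) (svalP y)).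
Definition minplus_one : minplus_car := exist _ 0 (rpred0 K).

Lemma minplus_inv_subproof (x : minplus_car) : - sval x \in K.
Proof. by rewrite rpredN (svalP x). Qed.
Definition minplus_inv (x : minplus_car) : minplus_car :=
  exist _ (- sval x) (minplus_inv_subproof x).

Lemma minplus_addA : associative minplus_add.
Proof. by move=> x y z; apply: val_inj; rewrite /= minA. Qed.
Lemma minplus_addC : commutative minplus_add.
Proof. by move=> x y; apply: val_inj; rewrite /= minC. Qed.
Lemma minplus_mulA : associative minplus_mul.
Proof. by move=> x y z; apply: val_inj; rewrite /= addrA. Qed.
Lemma minplus_mulC : commutative minplus_mul.
Proof. by move=> x y; apply: val_inj; rewrite /= addrC. Qed.
Lemma minplus_mul1 : left_id minplus_one minplus_mul.
Proof. by move=> x; apply: val_inj; rewrite /= add0r. Qed.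
Lemma minplus_mulV : left_inverse minplus_one minplus_inv minplus_mul.
Proof. by move=> x; apply: val_inj; rewrite /= addNr. Qed.
Lemma minplus_mulD : left_distributive minplus_mul minplus_add.
Proof. by move=> x y z; apply: val_inj; rewrite /= addr_minl. Qed.

Definition minplus : semifield :=
  Semifield minplus_addA minplus_addC minplus_mulA minplus_mulC minplus_mul1
            minplus_mulV minplus_mulD.

End MinPlus.

(* Formal subtraction-free rational functions in [n] variables *)
Inductive sfexpr (n : nat) : Type :=
| SFVar of 'I_n
| SFOne
| SFAdd of sfexpr n & sfexpr n
| SFMul of sfexpr n & sfexpr n
| SFInv of sfexpr n.

Fixpoint sf_eval (K : semifield) n (a : 'I_n -> K) (e : sfexpr n) : K :=
  match e with
  | SFVar k => a k
  | SFOne => sf_one K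
  | SFAdd e1 e2 => sf_add (sf_eval a e1) (sf_eval a e2)
  | SFMul e1 e2 => sf_mul (sf_eval a e1) (sf_eval a e2)
  | SFInv e1 => sf_inv (sf_eval a e1)
  end.

Section MonoidU.
Variables (W : simply_laced_weyl) (K : semifield).
Local Notation I := (slw_index W).
Local Notation nu := (nu W).
Local Notation "a +_ b" := (@sf_add K a b) (at level 50, left associativity).
Local Notation "a *_ b" := (@sf_mul K a b) (at level 40, left associativity).

(* the letter (i, a) stands for the generator i^a *)
Inductive frakU_rel : seq (I * K) -> seq (I * K) -> Prop :=
| FrakUComm i j a b : dot i j = 0 ->
    frakU_rel [:: (i, a); (j, b)] [:: (j, b); (i, a)]
| FrakUBraid i j a b c a' b' c' : dot i j = -1 ->
    a *_ b = b' *_ c' -> a' *_ b' = b *_ c -> b' = a +_ c ->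
    frakU_rel [:: (i, a); (j, b); (i, c)] [:: (j, a'); (i, b'); (j, c')]
| FrakUAdd i a b : frakU_rel [:: (i, a); (i, b)] [:: (i, a +_ b)].

Definition frakU : monoidType := pres_monoid frakU_rel.

Definition upow (i : I) (a : K) : frakU := pres_gen frakU_rel (i, a).

Definition fcoord (c : nu.-tuple I) (a : 'I_nu -> K) : frakU :=
  (\prod_(k < nu) upow (tnth c k) (a k))%g.

(* The graph of T_i(a): the pairs (H, T_i(a) H) with H in the image of the
   maps [fcoord c], c a reduced expression of [w0]. *)
Definition Tmap (i : I) (a : K) (H H' : frakU) : Prop :=
  exists (c : nu.-tuple I) (b : 'I_nu -> K),
    [/\ w0_word c, ohead c = Some i, H = fcoord c b &
        H' = fcoord c (fun k => if val k == 0%N then b k *_ a else b k)].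

End MonoidU.

(* The split simply connected semisimple group with Weyl group W, realised as
   a Chevalley group: a finite-dimensional representation over R of the split
   semisimple Lie algebra with Cartan matrix [dot] (Chevalley generators and
   Serre relations), whose weights generate the whole weight lattice (the
   weight lambda being identified with the family of its values on the
   coroots).  Matrices act on column vectors.  Any two such representations
   give isomorphic pinned groups. *)

Definition lie (A : pzRingType) (x y : A) : A := x * y - y * x.

Definition is_weight (R : realType) (I : finType) (n : nat)
    (h : I -> 'M[R]_n) (lam : {ffun I -> int}) : Prop :=
  exists2 v : 'cV[R]_n, v != 0 & forall i, h i *m v = (lam i)%:~R *: v.

Record pinned_group (R : realType) (W : simply_laced_weyl) := PinnedGroup {
  pg_dim : nat;
  pg_e : slw_index W -> 'M[R]_pg_dim.+1;
  pg_f : slw_index W -> 'M[R]_pg_dim.+1;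
  pg_h : slw_index W -> 'M[R]_pg_dim.+1;
  pg_hh : forall i j, lie (pg_h i) (pg_h j) = 0;
  pg_he : forall i j, lie (pg_h i) (pg_e j) = pg_e j *~ dot i j;
  pg_hf : forall i j, lie (pg_h i) (pg_f j) = - (pg_f j *~ dot i j);
  pg_ef : forall i j,
    lie (pg_e i) (pg_f j) = if i == j then pg_h i else 0;
  pg_serre_e : forall i j, i != j ->
    iter `|1 - dot i j|%N (lie (pg_e i)) (pg_e j) = 0;
  pg_serre_f : forall i j, i != j ->
    iter `|1 - dot i j|%N (lie (pg_f i)) (pg_f j) = 0;
  pg_simply_connected : forall mu : {ffun slw_index W -> int},
    exists m (lam : 'I_m -> {ffun slw_index W -> int}) (z : 'I_m -> int),
      (forall k, is_weight pg_h (lam k)) /\ mu = \sum_(k < m) lam k *~ z k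
}.

(* The exponential series, truncated after degree n: this is exp N for a
   nilpotent matrix N of size n + 1. *)
Definition mxexp_nilp (R : realType) n (N : 'M[R]_n.+1) : 'M[R]_n.+1 :=
  \sum_(k < n.+1) (k`!%:R)^-1 *: N ^+ k.

Inductive generated_group (A : unitRingType) (S : set A) : set A :=
| GenIn x : S x -> generated_group S x
| GenOne : generated_group S 1
| GenMul x y : generated_group S x -> generated_group S y ->
    generated_group S (x * y)
| GenInv x : generated_group S x -> generated_group S x^-1.

Section Group.
Variables (R : realType) (W : simply_laced_weyl) (G : pinned_group R W).
Local Notation I := (slw_index W).
Local Notation nu := (nu W).
Local Notation mx := 'M[R]_((pg_dim G).+1).
Local Notation Rpos := (pos_semifield R).
Local Open Scope classical_set_scope.

Definition xroot (i : I) (t : R) : mx := mxexp_nilp (t *: pg_e G i).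
Definition yroot (i : I) (t : R) : mx := mxexp_nilp (t *: pg_f G i).

Definition nroot (i : I) (t : R) : mx := xroot i t * yroot i (- t^-1) * xroot i t.

(* the simple coroot, as a one-parameter subgroup of the maximal torus *)
Definition coroot (i : I) (t : R) : mx := nroot i t * nroot i (-1).

(* The coroots generate the (split) maximal torus, G being simply connected. *)
Definition torus_gens : set mx :=
  [set g | exists i t, t != 0 /\ g = coroot i t].

Definition Bplus : set mx := generated_group
  (torus_gens `|` [set g | exists i t, g = xroot i t]).
Definition Bminus : set mx := generated_group
  (torus_gens `|` [set g | exists i t, g = yroot i t]).

Definition conj_set (u : mx) (B : set mx) : set mx :=
  [set u^-1 * b * u | b in B].

Definition xprod (c : nu.-tuple I) (a : 'I_nu -> Rpos) : mx :=
  \prod_(k < nu) xroot (tnth c k) (sval (a k)).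
Definition yprod (c : nu.-tuple I) (a : 'I_nu -> Rpos) : mx :=
  \prod_(k < nu) yroot (tnth c k) (sval (a k)).

(* The graph of the involution over the positive reals, totally positive
   elements being identified with matrices through [xprod] and [yprod]. *)
Definition phi_pos (H H' : frakU W Rpos) : Prop :=
  exists (c c' : nu.-tuple I) (a a' : 'I_nu -> Rpos),
    [/\ w0_word c, w0_word c', H = fcoord c a, H' = fcoord c' a' &
        conj_set (xprod c a) Bminus = conj_set (yprod c' a') Bplus].

(* The graph of the involution over K, obtained by evaluating in K
   subtraction-free expressions of [phi_pos] in the coordinates [fcoord c]; the
   result depends neither on [c] nor on the choice of [e]. *)
Definition phi (K : semifield) (H H' : frakU W K) : Prop :=
  exists (c : nu.-tuple I) (e : 'I_nu -> sfexpr nu),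
    [/\ w0_word c,
        forall a : 'I_nu -> Rpos,
          phi_pos (fcoord c a) (fcoord c (fun k => sf_eval a (e k))) &
        exists a : 'I_nu -> K,
          H = fcoord c a /\ H' = fcoord c (fun k => sf_eval a (e k))].

Variable K : semifield.

Definition flag : set (frakU W K * frakU W K) := [set B | phi B.1 B.2].

(* The orbit of [B] under a : [H, H'] |-> [T_i(a) H, T_{i^!}(a^-1) H']. *)
Definition circle_orbit (i : I) (B : frakU W K * frakU W K) :
    set (frakU W K * frakU W K) :=
  [set B' | exists a : K,
     Tmap i a B.1 B'.1 /\ Tmap (bang i) (sf_inv a) B.2 B'.2].

Definition half_circle (i : I) (C : set (frakU W K * frakU W K)) : Prop :=
  exists2 B, flag B & C = circle_orbit i B.

Definition edge (B B' : frakU W K * frakU W K) : Prop :=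
  [/\ flag B, flag B', B <> B' &
      exists i C, [/\ half_circle i C, C B & C B']].

Definition distance_le (k : nat) (B B' : frakU W K * frakU W K) : Prop :=
  exists p : nat -> frakU W K * frakU W K,
    [/\ p 0%N = B, p k = B', forall j, (j <= k)%N -> flag (p j) &
        forall j, (j < k)%N -> p j = p j.+1 \/ edge (p j) (p j.+1)].

Definition flag_connected : Prop := forall B B', flag B -> flag B' ->
  exists (k : nat) (p : nat -> frakU W K * frakU W K),
    [/\ p 0%N = B, p k = B' & forall j, (j < k)%N -> edge (p j) (p j.+1)].

End Group.

Arguments flag {R W} G K.
Arguments flag_connected {R W} G K.

(* Main.v *)
(**
  Multiplying H on the left by i^a moves H within its half i-circle, replacing
  the first coordinate b of H (in a chart starting with i) by min(a, b).  Let k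
  be a lower bound of all the coordinates of H, and let F be the element all of
  whose coordinates are k; since (k, k, k) is fixed by the braid
  transformation, F has these coordinates in every chart.  Multiplying F on the
  right by a letter of H leaves it unchanged, so F H = F, and multiplying H
  successively by the nu letters of F leads from H to F.  Doing the same for H'
  and noting that the two last steps lie on one half-circle gives a path of
  length 2 nu - 1.

  The steps act on pairs [H, phi(H)], so one also needs that phi is well defined
  and satisfies T_i(a) phi = phi T_{i^!}(a^-1).  These are proved over the
  positive reals, by computing in Bruhat cells of the pinned group, and are
  carried over to the min-plus semifield by taking logarithmic limits of
  subtraction-free expressions.
*)
Require Import Defs.
From mathcomp Require Import all_boot all_order all_algebra all_fingroup.
From mathcomp Require Import boolp classical_sets reals.
From mathcomp Require Import sequences exp.
From mathcomp Require Import ring lra zify.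

Set Implicit Arguments.
Unset Strict Implicit.
Unset Printing Implicit Defensive.

Import Order.TTheory GRing.Theory Num.Theory.
Local Open Scope ring_scope.

(** * Lengths and roots in the Weyl group *)

(** The pinned group is known only through matrices satisfying the Serre relations, so its structure
    theory is derived from these. The decisive fact is that the open Bruhat cell is disjoint from
    the cells one step below it. It comes from grading matrices by rho^vee: [Bplus] lies in degrees
    >= 0 and [Bminus] in degrees <= 0. This separation yields the injectivity of coordinates over
    the positive reals. It also forces the scalars in T_i(a) phi = phi T_{i^!}(a^-1), which are
    never computed directly.

    The passage to K rests on one property of a subtraction-free expression: applied to positive
    numbers of size exp(- N v), it returns a number of size exp(- N v'), where v' is its value at v
    in K. Hence expressions that define the same function on the positive reals take the same values
    on K. For this reason changes of chart, multiplication by a letter, T_i and phi are all kept as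
    subtraction-free expressions in a fixed chart, and identities between coordinates over K are
    checked on positive lifts. *)

Section WordLength.
Variable W : simply_laced_weyl.
Local Notation I := (slw_index W).
Local Notation s := (@slw_refl W).
Local Notation len := (@wlength W).
Local Notation wp := (word_prod s).

Lemma word_prod_nil : wp [::] = 1%g. Proof. by rewrite /word_prod big_nil. Qed.
Lemma word_prod_cons i c : wp (i :: c) = (s i * wp c)%g.
Proof. by rewrite /word_prod big_cons. Qed.
Lemma word_prod_cat c d : wp (c ++ d) = (wp c * wp d)%g.
Proof. by rewrite /word_prod big_cat. Qed.
Lemma word_prod_seq1 i : wp [:: i] = s i.
Proof. by rewrite word_prod_cons word_prod_nil mulg1. Qed.
Lemma word_prod_rcons c i : wp (rcons c i) = (wp c * s i)%g.
Proof. by rewrite -cats1 word_prod_cat word_prod_seq1. Qed.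

Lemma slw_reflK i : (s i * s i = 1)%g. Proof. exact: slw_inv. Qed.
Lemma mul_slw_reflK (w : W) i : (w * s i * s i)%g = w.
Proof. by rewrite -mulgA slw_reflK mulg1. Qed.
Lemma slw_reflV i : (s i)^-1%g = s i.
Proof. by apply/eqP; rewrite eq_invg_mul slw_reflK. Qed.

Lemma word_prod_rev c : wp (rev c) = (wp c)^-1%g.
Proof.
elim: c => [|i c IH]; first by rewrite word_prod_nil invg1.
by rewrite rev_cons word_prod_rcons IH word_prod_cons invMg slw_reflV.
Qed.

Lemma dot_cases (i j : I) : [\/ i = j /\ dot i j = 2, i <> j /\ dot i j = 0
  | i <> j /\ dot i j = -1].
Proof.
rewrite /dot /sdot; case: eqP => [->|ne]; first by constructor 1.
by case: ifP => _; [constructor 3|constructor 2].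
Qed.

Lemma dotii (i : I) : dot i i = 2. Proof. by rewrite /dot /sdot eqxx. Qed.

Lemma dotC (i j : I) : dot i j = dot j i.
Proof. by rewrite /dot /sdot eq_sym; case: eqP => // _; rewrite eq_sym. Qed.

Lemma dot0_comm (i j : I) : dot i j = 0 -> (s i * s j = s j * s i)%g.
Proof.
rewrite /dot /sdot; case: eqP => // /eqP ne.
case: ifP => // /negP h _; case: (slw_laced ne) => // e.
by case: h; apply/eqP.
Qed.

Lemma dotN1_braid (i j : I) : dot i j = -1 ->
  (s i * s j * s i = s j * s i * s j)%g.
Proof. by rewrite /dot /sdot; case: eqP => // ne; case: ifP => [/eqP|//]. Qed.

Lemma len_min c : (len (wp c) <= size c)%N.
Proof.
rewrite /wlength; case: ex_minnP => m _; apply.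
by apply/existsP; exists (in_tuple c).
Qed.

Lemma len_word (w : W) : exists2 c, wp c = w & size c = len w.
Proof.
rewrite /wlength; case: ex_minnP => m /existsP [c /eqP cw] _.
by exists c => //; rewrite size_tuple.
Qed.

Lemma parity_cong c d : word_cong (coxeter_rel s) c d -> odd (size c) = odd (size d).
Proof.
elim=> {c d} [c d []//|//|//|c d e _ -> _ ->//|c c' d d' _ h1 _ h2].
by rewrite !size_cat !oddD h1 h2.
Qed.

Lemma parity_wp c d : wp c = wp d -> odd (size c) = odd (size d).
Proof. by move=> /slw_complete /parity_cong. Qed.

Lemma len1 : len 1%g = 0%N.
Proof. by apply/eqP; rewrite -leqn0 -word_prod_nil len_min. Qed.

Lemma lenV (w : W) : len w^-1%g = len w.
Proof.
suff h (v : W) : (len v^-1%g <= len v)%N.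
  by apply/eqP; rewrite eqn_leq h -{1}[w]invgK h.
by have [c <- <-] := len_word v; rewrite -word_prod_rev -(size_rev c) len_min.
Qed.

Lemma len_mul_le (w v : W) : (len (w * v)%g <= len w + len v)%N.
Proof.
have [c <- <-] := len_word w; have [d <- <-] := len_word v.
by rewrite -word_prod_cat -size_cat len_min.
Qed.

Lemma len_s_le (w : W) j : (len (w * s j)%g <= (len w).+1)%N.
Proof.
apply: leq_trans (len_mul_le _ _) _; rewrite -addn1 leq_add2l.
by rewrite -word_prod_seq1; apply: len_min.
Qed.

(** Completeness of the Coxeter relations makes the parity of word length an invariant of the group
    element, so multiplication by a generator never preserves the length. *)
Lemma len_s (w : W) j : len (w * s j)%g = (len w).+1 \/ len w = (len (w * s j)%g).+1.
Proof.
have h1 := len_s_le w j; have h2 := len_s_le (w * s j)%g j.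
rewrite mul_slw_reflK in h2.
have : odd (len (w * s j)%g) != odd (len w).
  have [c cw cl] := len_word w; have [d dw dl] := len_word (w * s j)%g.
  have := @parity_wp d (rcons c j); rewrite word_prod_rcons dw cw size_rcons /= dl cl.
  by move=> -> //; case: odd.
move=> h; have {h} : len (w * s j)%g <> len w by move=> e; rewrite e eqxx in h.
by move: h1 h2; move: (len _) (len _) => a b; lia.
Qed.

Lemma len_sl (w : W) j : len (s j * w)%g = (len w).+1 \/ len w = (len (s j * w)%g).+1.
Proof. by rewrite -(lenV (s j * w)%g) invMg slw_reflV -(lenV w); apply: len_s. Qed.

Lemma desc_ex (w : W) : w <> 1%g -> exists k, len w = (len (w * s k)%g).+1.
Proof.
have [c cw cl] := len_word w; case/lastP: c cw cl => [|c k] cw cl.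
  by rewrite -cw word_prod_nil.
move=> _; exists k; case: (len_s w k) => // h.
have := len_min c; have -> : wp c = (w * s k)%g by rewrite -cw word_prod_rcons mul_slw_reflK.
by rewrite size_rcons in cl; lia.
Qed.

(* Every [w] with [l(w s_j) > l(w)] is reached by steps inside the rank-two
   parabolic cosets. *)
Lemma rank2_ind (P : W -> I -> Prop) :
  (forall j, P 1%g j) ->
  (forall (w : W) j k, dot k j = 0 -> P w j -> P (w * s k)%g j) ->
  (forall (w : W) j k, dot k j = -1 -> P w j -> P w k -> P (w * s k)%g j) ->
  (forall (w : W) j k, dot k j = -1 -> P w k -> P (w * s j * s k)%g j) ->
  forall (w : W) j, (len w < len (w * s j)%g)%N -> P w j.
Proof.
move=> P1 P0 PB PC w j; have [n] := ubnP (len w); elim: n w j => // n IH w j.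
rewrite ltnS => lwn asc; case: (eqVneq w 1%g) => [-> //|/eqP w1].
have [k] := desc_ex w1; set w' := (w * s k)%g => coord_word.
have ew : w = (w' * s k)%g by rewrite mul_slw_reflK.
case: (dot_cases k j) => [[kj _]|[_ d]|[_ d]].
- by move: asc; rewrite -kj ltnNge coord_word leqnSn.
- rewrite ew; apply: P0 => //; apply: IH; first lia.
  have e : (w * s j = w' * s j * s k)%g by rewrite ew -!mulgA dot0_comm.
  by have := len_s_le (w' * s j)%g k; rewrite -e; lia.
- have ascwk : (len w' < len (w' * s k)%g)%N by rewrite -ew coord_word.
  case: (len_s w' j) => lj.
    by rewrite ew; apply: PB => //; apply: IH => //; lia.
  set w'' := (w' * s j)%g in lj.
  have ew' : w' = (w'' * s j)%g by rewrite mul_slw_reflK.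
  rewrite ew ew'; apply: PC => //; apply: IH; first lia.
  have e : (w * s j = w'' * s k * s j * s k)%g.
    by rewrite ew ew' -!(mulgA w'') -(dotN1_braid d) !mulgA ?mul_slw_reflK.
  have := len_s_le (w'' * s k * s j)%g k; have := len_s_le (w'' * s k)%g j.
  by rewrite -e; lia.
Qed.

End WordLength.

(** * The geometric representation and the signs of roots *)

Section Roots.
Variables (R : realFieldType) (W : simply_laced_weyl).
Local Notation I := (slw_index W).
Local Notation s := (@slw_refl W).
Local Notation len := (@wlength W).
Local Notation wp := (word_prod s).
Local Notation V := {ffun I -> R^o}.

(** Vectors are written in the basis of simple roots, and [pairing x i] is the value on [x] of the
    i-th simple coroot. The values lie in [R^o] so that functions form a vector space. *)
Definition alpha (i : I) : V := [ffun j => (i == j)%:R].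
Definition pairing (x : V) (i : I) : R := \sum_j x j * (dot j i)%:~R.
Definition rho_refl (i : I) (x : V) : V := [ffun j => x j - pairing x i * (i == j)%:R].
Definition wact (c : seq I) (x : V) : V := foldr rho_refl x c.
Definition bform (x y : V) : R := \sum_i pairing x i * y i.

Lemma scE a (x : V) j : (a *: x) j = a * x j. Proof. by rewrite ffunE. Qed.
Definition vE := (scE, ffunE).

Lemma pairing_alpha i j : pairing (alpha i) j = (dot i j)%:~R.
Proof.
rewrite /pairing (bigD1 i) //= vE eqxx mul1r big1 ?addr0 // => k ki.
by rewrite vE eq_sym (negPf ki) mul0r.
Qed.

Lemma pairing_lin a (x y : V) i : pairing (a *: x + y) i = a * pairing x i + pairing y i.
Proof.
rewrite /pairing mulr_sumr -big_split; apply: eq_bigr => j _.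
by rewrite !vE mulrDl mulrA.
Qed.

Lemma reflE i x : rho_refl i x = - pairing x i *: alpha i + x.
Proof. by apply/ffunP=> j; rewrite !vE mulNr addrC. Qed.

Lemma pairing_refl i x j : pairing (rho_refl i x) j = pairing x j - pairing x i * (dot i j)%:~R.
Proof. by rewrite reflE pairing_lin pairing_alpha mulNr addrC. Qed.

Lemma reflK i x : rho_refl i (rho_refl i x) = x.
Proof.
apply/ffunP=> j; rewrite !vE pairing_refl dotii; move: (pairing _ _) => p.
by rewrite (_ : 2%:~R = 2%:R) //; ring.
Qed.

Lemma refl_comm i j x : dot i j = 0 -> rho_refl i (rho_refl j x) = rho_refl j (rho_refl i x).
Proof.
move=> d; apply/ffunP=> k; rewrite !vE !pairing_refl d dotC d.
by rewrite (_ : 0%:~R = 0) //; ring.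
Qed.

Lemma refl_braid i j x : dot i j = -1 ->
  rho_refl i (rho_refl j (rho_refl i x)) = rho_refl j (rho_refl i (rho_refl j x)).
Proof.
move=> d; apply/ffunP=> k; rewrite !vE !pairing_refl !dotii d dotC d.
by rewrite (_ : (-1)%:~R = -1) // (_ : 2%:~R = 2%:R) //; ring.
Qed.

Lemma wact_cat c d x : wact (c ++ d) x = wact c (wact d x).
Proof. by rewrite /wact foldr_cat. Qed.
Lemma wact_rcons c j x : wact (rcons c j) x = wact c (rho_refl j x).
Proof. by rewrite -cats1 wact_cat. Qed.

(** The simple reflections satisfy the Coxeter relations; as these present the group, the action of
    a word depends only on its product. *)
Lemma wact_cong c d : word_cong (coxeter_rel s) c d -> wact c =1 wact d.
Proof.
elim=> {c d} [c0 d0 []|//|c d _ h x|c d e _ h1 _ h2 x|c c' d d' _ h1 _ h2 x].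
- by move=> i x /=; rewrite reflK.
- by move=> i j d x; rewrite /= refl_comm.
- by move=> i j d x; rewrite /= refl_braid.
- by rewrite h.
- by rewrite h1.
- by rewrite !wact_cat h2 h1.
Qed.

Lemma wact_wp c d : wp c = wp d -> wact c =1 wact d.
Proof. by move/slw_complete/wact_cong. Qed.

Lemma refl_lin i a x y : rho_refl i (a *: x + y) = a *: rho_refl i x + rho_refl i y.
Proof. by apply/ffunP=> k; rewrite !vE pairing_lin; ring. Qed.

Lemma wact_lin c a x y : wact c (a *: x + y) = a *: wact c x + wact c y.
Proof. by elim: c => //= i c ->; rewrite refl_lin. Qed.

Lemma wact0 c : wact c 0 = 0.
Proof.
have := wact_lin c (-1) 0 0; rewrite scaler0 addr0 scaleN1r => ->.
by rewrite addNr.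
Qed.
Lemma wactZ c a x : wact c (a *: x) = a *: wact c x.
Proof. by rewrite -[_ *: x]addr0 wact_lin wact0 addr0. Qed.
Lemma wactD c x y : wact c (x + y) = wact c x + wact c y.
Proof. by rewrite -[x in LHS]scale1r wact_lin scale1r. Qed.
Lemma wactN c x : wact c (- x) = - wact c x.
Proof. by rewrite -scaleN1r wactZ scaleN1r. Qed.
Lemma wact_sum c (T : Type) (r : seq T) (F : T -> V) :
  wact c (\sum_(t <- r) F t) = \sum_(t <- r) wact c (F t).
Proof. by apply: (big_morph _ (wactD c) (wact0 c)). Qed.

Lemma wactK c x : wact (rev c) (wact c x) = x.
Proof.
by elim: c x => //= i c IH x; rewrite rev_cons wact_rcons reflK IH.
Qed.

Lemma sum_alpha (x : V) : x = \sum_i x i *: alpha i.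
Proof.
apply/ffunP=> k; rewrite sum_ffunE (bigD1 k) //= !vE eqxx mulr1 big1 ?addr0 //.
by move=> i ik; rewrite !vE (negPf ik) mulr0.
Qed.

Lemma bformE x y : bform x y = \sum_i \sum_j x j * y i * (dot j i)%:~R.
Proof.
by apply: eq_bigr => i _; rewrite mulr_suml; apply: eq_bigr => j _; rewrite mulrAC.
Qed.
Lemma bformC x y : bform x y = bform y x.
Proof.
rewrite !bformE exchange_big; apply: eq_bigr => i _; apply: eq_bigr => j _.
by rewrite dotC [x i * _]mulrC.
Qed.
Lemma bform_alpha x i : bform x (alpha i) = pairing x i.
Proof.
rewrite /bform (bigD1 i) //= vE eqxx mulr1 big1 ?addr0 // => k ki.
by rewrite vE eq_sym (negPf ki) mulr0.
Qed.
Lemma bform_lin a x y z : bform (a *: x + y) z = a * bform x z + bform y z.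
Proof.
rewrite /bform mulr_sumr -big_split; apply: eq_bigr => j _.
by rewrite pairing_lin mulrDl mulrA.
Qed.
Lemma bform_linr a x y z : bform z (a *: x + y) = a * bform z x + bform z y.
Proof. by rewrite bformC bform_lin ![bform _ z]bformC. Qed.
Lemma bform_refl i x y : bform (rho_refl i x) (rho_refl i y) = bform x y.
Proof.
rewrite !reflE bform_lin !bform_linr !bform_alpha pairing_alpha dotii.
rewrite [bform (alpha i) y]bformC bform_alpha.
by rewrite (_ : 2%:~R = 2%:R) //; ring.
Qed.
Lemma bform_wact c x y : bform (wact c x) (wact c y) = bform x y.
Proof. by elim: c => //= i c IH; rewrite bform_refl. Qed.

Definition nonneg (x : V) := forall k, 0 <= x k.

Lemma refl_alpha i j : rho_refl i (alpha j) = alpha j - (dot j i)%:~R *: alpha i.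
Proof. by rewrite reflE pairing_alpha addrC scaleNr. Qed.

Lemma refl_alphaN1 k j : dot k j = -1 -> rho_refl k (alpha j) = alpha j + alpha k.
Proof. by move=> d; rewrite refl_alpha dotC d scaleN1r opprK. Qed.

Lemma refl_alpha0 k j : dot k j = 0 -> rho_refl k (alpha j) = alpha j.
Proof. by move=> d; rewrite refl_alpha dotC d scale0r subr0. Qed.

Lemma refl_alphaii j : rho_refl j (alpha j) = - alpha j.
Proof.
rewrite refl_alpha dotii (_ : 2%:~R = 1 + 1) // scalerDl scale1r opprD addrA.
by rewrite subrr sub0r.
Qed.

Lemma refl_alphaN1N1 k j : dot k j = -1 -> rho_refl j (rho_refl k (alpha j)) = alpha k.
Proof.
move=> d; rewrite refl_alphaN1 // -[alpha j]scale1r refl_lin scale1r refl_alphaii.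
by rewrite refl_alphaN1 1?dotC // addrCA addNr addr0.
Qed.

(** The roots follow the cases of [rank2_ind]: [s_k] fixes alpha_j when the two reflections commute;
    otherwise [s_k alpha_j = alpha_j + alpha_k] and [s_j s_k alpha_j = alpha_k]. *)
Lemma asc_nonneg (w : W) j : (len w < len (w * s j)%g)%N ->
  forall c, wp c = w -> nonneg (wact c (alpha j)).
Proof.
have nnD x y : nonneg x -> nonneg y -> nonneg (x + y).
  by move=> hx hy k; rewrite vE addr_ge0.
move: w j; apply: rank2_ind.
- move=> j c c1 k; rewrite (wact_wp (d := [::])) ?word_prod_nil //= vE.
  by case: eqP.
- move=> w j k d IH c cw; have [c0 c0w] := slw_gen w.
  rewrite (wact_wp (d := rcons c0 k)) ?word_prod_rcons ?c0w // wact_rcons refl_alpha0 //.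
  exact: IH.
- move=> w j k d IH1 IH2 c cw; have [c0 c0w] := slw_gen w.
  rewrite (wact_wp (d := rcons c0 k)) ?word_prod_rcons ?c0w // wact_rcons refl_alphaN1 //.
  by rewrite wactD; apply: nnD; [exact: IH1|exact: IH2].
- move=> w j k d IH c cw; have [c0 c0w] := slw_gen w.
  rewrite (wact_wp (d := rcons (rcons c0 j) k)) ?word_prod_rcons ?c0w //.
  by rewrite !wact_rcons refl_alphaN1N1 //; apply: IH.
Qed.

Lemma desc_nonpos (w : W) j : (len (w * s j)%g < len w)%N ->
  forall c, wp c = w -> nonneg (- wact c (alpha j)).
Proof.
move=> desc c cw; have [c0 c0w] := slw_gen (w * s j)%g.
rewrite (wact_wp (d := rcons c0 j)) ?word_prod_rcons ?c0w ?mul_slw_reflK // wact_rcons refl_alphaii.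
by rewrite wactN opprK; apply: asc_nonneg c0w; rewrite mul_slw_reflK.
Qed.

Lemma wact_alpha_neq0 c j : wact c (alpha j) <> 0.
Proof.
move=> h; have := wactK c (alpha j); rewrite h wact0 => /ffunP/(_ j).
by rewrite !vE eqxx => /esym/eqP; rewrite oner_eq0.
Qed.

End Roots.

Arguments alpha {R W}.

(** * Descents and the longest element *)

Section Longest.
Variable (W : simply_laced_weyl).
Local Notation I := (slw_index W).
Local Notation s := (@slw_refl W).
Local Notation len := (@wlength W).
Local Notation wp := (word_prod s).
Local Notation wact := (@wact rat W).
Local Notation alpha := (@alpha rat W).

Lemma nonnegD (x y : {ffun I -> rat^o}) : nonneg x -> nonneg y -> nonneg (x + y).
Proof. by move=> hx hy k; rewrite ffunE addr_ge0. Qed.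

Lemma nonneg_anti c j : nonneg (wact c (alpha j)) -> ~ nonneg (- wact c (alpha j)).
Proof.
move=> h h'; case: (@wact_alpha_neq0 rat W c j); apply/ffunP=> k; apply/eqP.
by rewrite ffunE eq_le h andbT; have := h' k; rewrite ffunE oppr_ge0.
Qed.

(** Since [s_i] fixes alpha_j, the elements [w] and [w s_i] send alpha_j to the same negative root,
    so [j] remains a descent after [i] is removed. *)
Lemma two_desc_comm (w : W) i j : dot i j = 0 ->
  len w = (len (w * s i)%g).+1 -> len w = (len (w * s j)%g).+1 ->
  exists2 v : W, w = (v * s i * s j)%g & len w = (len v).+2.
Proof.
move=> d hi hj; exists (w * s j * s i)%g; first by rewrite !mul_slw_reflK.
have [c cw] := slw_gen (w * s i)%g.
have ewj : wp (rcons c i) = w by rewrite word_prod_rcons cw mul_slw_reflK.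
have n1 : nonneg (- wact (rcons c i) (alpha j)).
  by apply: (@desc_nonpos rat W w) => //; rewrite hj.
case: (len_s (w * s j)%g i) => h; last by rewrite hj h.
move: n1; rewrite wact_rcons refl_alpha0 // => n1.
case: (len_s (w * s i)%g j) => h2.
  exfalso; apply: nonneg_anti n1; apply: asc_nonneg cw; rewrite h2; exact: ltnSn.
have e : (w * s j * s i = w * s i * s j)%g by rewrite -!mulgA (dot0_comm d).
by rewrite e in h; lia.
Qed.

(** With [w1 = w s_i] and [w2 = w1 s_j], the negative root [w alpha_j] equals
    [w1 alpha_j + w1 alpha_i] and also [w2 alpha_i]. As [w1 alpha_i] is positive, [w1 alpha_j] is
    negative; thus [j] is a descent of [w1], and then [i] is one of [w2]. *)
Lemma two_desc_braid (w : W) i j : dot i j = -1 ->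
  len w = (len (w * s i)%g).+1 -> len w = (len (w * s j)%g).+1 ->
  exists2 v : W, w = (v * s i * s j * s i)%g & len w = (len v).+3.
Proof.
move=> d hi hj; set w1 := (w * s i)%g in hi *; set w2 := (w1 * s j)%g.
exists (w2 * s i)%g; first by rewrite !mul_slw_reflK.
have [c cw] := slw_gen w1.
have n1 : nonneg (wact c (alpha i)).
  by apply: (@asc_nonneg rat W w1) => //; rewrite mul_slw_reflK hi.
have n2 : nonneg (- wact (rcons c i) (alpha j)).
  by apply: (@desc_nonpos rat W w); rewrite ?word_prod_rcons ?cw ?mul_slw_reflK ?hj.
move: n2; rewrite wact_rcons refl_alphaN1 // => n2.
have n3 : nonneg (- wact c (alpha j)).
  have -> : - wact c (alpha j) = - wact c (alpha j + alpha i) + wact c (alpha i).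
    by rewrite wactD opprD subrK.
  exact: nonnegD.
case: (len_s w1 j) => h1.
  exfalso; apply: nonneg_anti n3; apply: (@asc_nonneg rat W w1) => //.
  by rewrite h1 ltnSn.
have [b bw] := slw_gen w2.
move: n2; rewrite (wact_wp (d := rcons b j)) ?word_prod_rcons ?bw ?mul_slw_reflK //.
rewrite wact_rcons -refl_alphaN1 // refl_alphaN1N1 // => n2.
case: (len_s w2 i) => h2; last by rewrite hi h1 h2.
exfalso; apply: nonneg_anti n2; apply: asc_nonneg bw.
by rewrite h2 ltnSn.
Qed.

Lemma len_w0 : len (w0 W) = nu W.
Proof.
rewrite /w0; case: arg_maxnP => //= w _ h.
apply/eqP; rewrite eqn_leq /nu leq_bigmax //=.
by apply/bigmax_leqP => v _; apply: h.
Qed.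

Lemma len_max (w : W) : (len w <= nu W)%N.
Proof. exact: leq_bigmax. Qed.

(** Both elements make every simple root negative, so the product keeps every simple root positive;
    it has no descent and is 1. Applied to [w0] twice, or to [w0] and another such element, this
    gives [w0K] and [w0_uniq]. *)
Lemma desc_all1 (w v : W) :
  (forall j, len w = (len (w * s j)%g).+1) ->
  (forall j, len v = (len (v * s j)%g).+1) -> (w * v = 1)%g.
Proof.
move=> hw hv; apply: contrapT => /desc_ex [k hk].
have [c cw] := slw_gen w; have [d dv] := slw_gen v.
have := @desc_nonpos rat W (w * v)%g k; rewrite hk ltnSn => /(_ isT (c ++ d)).
rewrite word_prod_cat cw dv => /(_ erefl) n1; apply: nonneg_anti n1.
have nv : nonneg (- wact d (alpha k)).
  by apply: (@desc_nonpos rat W v) => //; rewrite [X in (_ < X)%N](hv k) ltnSn.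
rewrite wact_cat -[wact d _]opprK wactN (sum_alpha (- wact d _)) wact_sum -sumrN.
apply: (big_ind (fun x => nonneg x)) => [k'|x y hx hy|i _]; first by rewrite ffunE.
  exact: (nonnegD hx hy).
rewrite wactZ => k'; rewrite !vE -mulrN mulr_ge0 //.
  by have := nv i; rewrite ffunE.
have := @desc_nonpos rat W w i; rewrite [X in (_ < X)%N](hw i) ltnSn => /(_ isT c cw k').
by rewrite ffunE.
Qed.

Lemma w0_desc j : len (w0 W) = (len (w0 W * s j)%g).+1.
Proof.
by case: (len_s (w0 W) j) => // h; have := len_max (w0 W * s j)%g; rewrite h len_w0 ltnn.
Qed.

Lemma w0K : (w0 W * w0 W = 1)%g.
Proof. by apply: desc_all1; apply: w0_desc. Qed.

Lemma w0V : ((w0 W)^-1 = w0 W)%g.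
Proof. by apply/eqP; rewrite eq_invg_mul w0K. Qed.

Lemma w0_uniq (w : W) : (forall j, len w = (len (w * s j)%g).+1) -> w = w0 W.
Proof.
move=> h; have e := desc_all1 h w0_desc.
by rewrite -[w]mulg1 -w0K mulgA e mul1g.
Qed.

(** Letters that lengthen [w] are appended as long as there are any; by [w0_uniq] this can stop only
    at [w0]. *)
Lemma w0_complete (w : W) : exists2 d, (w * wp d)%g = w0 W & (len w + size d = nu W)%N.
Proof.
have [n] := ubnP (nu W - len w)%N; elim: n w => // n IH w lwn.
case: (pselect (forall j, len w = (len (w * s j)%g).+1)) => [/w0_uniq -> |].
  by exists [::]; rewrite ?word_prod_nil ?mulg1 // addn0 len_w0.
move=> /existsNP [j hj]; have e : len (w * s j)%g = (len w).+1.
  by case: (len_s w j).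
have [|d dw ld] := IH (w * s j)%g.
  by have := len_max (w * s j)%g; rewrite e; lia.
exists (j :: d); first by rewrite word_prod_cons mulgA.
by rewrite -ld e /= addnS.
Qed.

Lemma w0_word_starting i : exists2 d, wp (i :: d) = w0 W & size (i :: d) = nu W.
Proof.
have [d dw ld] := w0_complete (s i); exists d; first by rewrite word_prod_cons.
have e1 : len (s i) = 1%N by case: (len_s 1%g i); rewrite mul1g len1 => // ->.
by rewrite -ld e1.
Qed.

(** The element [s_i w0] has length nu - 1, so by [w0_complete] a single letter leads from it to
    [w0]. That letter satisfies the test in [bang], whose default therefore never occurs. *)
Lemma bangE i : (s i * w0 W = w0 W * s (bang i))%g.
Proof.
rewrite /bang; case: pickP => [j /eqP //|none] /=.
have [d dw ld] := w0_complete (s i * w0 W)%g.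
have h : len (s i * w0 W)%g = (nu W).-1.
  by rewrite -(lenV (s i * w0 W)%g) invMg slw_reflV w0V -len_w0 (w0_desc i).
have nu_gt0 : (0 < nu W)%N by rewrite -len_w0 (w0_desc i).
case: d dw ld => [|j []] /=; rewrite h ?addn0 ?addn1 ?addnS; try lia.
rewrite word_prod_seq1 => e _; have := none j.
have -> : (w0 W * s j = s i * w0 W)%g by rewrite -{1}e mul_slw_reflK.
by rewrite eqxx.
Qed.

End Longest.

(** * Nondegeneracy of the Cartan matrix *)

Section Nondegenerate.
Variables (R : realFieldType) (W : simply_laced_weyl).
Local Notation I := (slw_index W).
Local Notation s := (@slw_refl W).
Local Notation wp := (word_prod s).
Local Notation V := {ffun I -> R^o}.

Definition word_of (w : W) : seq I := sval (cid (slw_gen w)).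
Lemma word_ofK w : wp (word_of w) = w. Proof. exact: (svalP (cid (slw_gen w))). Qed.

(** Finiteness of W is what counts: a vector killed by all coroots is fixed by W, whereas the sum
    over W of the images of alpha_i vanishes because [w] and [w s_i] contribute opposite terms. *)
Lemma pairing_nondeg (x : V) : (forall i, pairing x i = 0) -> x = 0.
Proof.
move=> h.
have fix_x c : wact c x = x.
  by elim: c => //= i c ->; rewrite reflE h oppr0 scale0r add0r.
have S0 i : \sum_(w : W) wact (word_of w) (alpha i) = 0 :> V.
  set S := (LHS); suff e : S = - S.
    apply/ffunP=> k; have := congr1 (fun f : V => f k) e; rewrite !ffunE /=.
    by move: (S k : R) => y ey; lra.
  rewrite /S [LHS](reindex_inj (mulIg (s i))) -sumrN; apply: eq_bigr => w _.
  rewrite (wact_wp (d := rcons (word_of w) i)) ?word_prod_rcons ?word_ofK //.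
  by rewrite wact_rcons refl_alphaii wactN.
have e : \sum_(w : W) wact (word_of w) x = 0.
  have e1 (w : W) : wact (word_of w) x = \sum_i x i *: wact (word_of w) (alpha i).
    by rewrite {1}(sum_alpha x) wact_sum; apply: eq_bigr => i _; rewrite wactZ.
  rewrite (eq_bigr _ (fun w _ => e1 w)) exchange_big big1 // => i _.
  by rewrite -scaler_sumr S0 scaler0.
move: e; rewrite (eq_bigr _ (fun w _ => fix_x _)).
rewrite sumr_const => /eqP; rewrite -scaler_nat scaler_eq0 pnatr_eq0 => /orP [/eqP c0|/eqP //].
by have := cardD1 (1%g : W) W; rewrite inE c0.
Qed.

(** With all [t i] equal to 1 this provides the coefficients of rho^vee. *)
Lemma pairing_surj (t : I -> R) : exists x : V, forall i, pairing x i = t i.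
Proof.
pose M : 'M[R]_#|I| := \matrix_(i, j) (dot (enum_val i) (enum_val j))%:~R.
pose vec (v : 'rV[R]_#|I|) : V := [ffun i => v 0 (enum_rank i)].
have vecM v i : pairing (vec v) i = (v *m M) 0 (enum_rank i).
  rewrite /pairing mxE (reindex (@enum_val I I)); last first.
    by exists enum_rank => k _; rewrite ?enum_valK ?enum_rankK.
  by apply: eq_bigr => k _; rewrite mxE ffunE enum_valK enum_rankK.
have uM : M \in unitmx.
  rewrite -row_free_unit -kermx_eq0; apply/eqP/row_matrixP => i; rewrite row0.
  have h : row i (kermx M) *m M = 0 by rewrite -row_mul mulmx_ker row0.
  move: (row i _) h => v h; apply/rowP => k.
  have /ffunP/(_ (enum_val k)) : vec v = 0.
    by apply: pairing_nondeg => j; rewrite vecM h mxE.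
  by rewrite !ffunE enum_valK !mxE.
exists (vec ((\row_k t (enum_val k)) *m invmx M)) => i.
by rewrite vecM mulmxKV // mxE enum_rankK.
Qed.

End Nondegenerate.

(** * Matsumoto's theorem for words with coordinates *)

Section Matsumoto.
Variable (W : simply_laced_weyl).
Local Notation I := (slw_index W).
Local Notation s := (@slw_refl W).
Local Notation len := (@wlength W).
Local Notation wp := (word_prod s).

Definition reduced (c : seq I) := len (wp c) = size c.

Lemma reduced_cons i c : reduced (i :: c) -> reduced c.
Proof.
rewrite /reduced /= word_prod_cons => h; apply/eqP; rewrite eqn_leq len_min /=.
case: (len_sl (wp c) i); lia.
Qed.

Lemma reduced_cat c d : reduced (c ++ d) -> reduced c /\ reduced d.
Proof.
move=> h; split; last by elim: c h => //= i c IH /reduced_cons.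
move: h; rewrite /reduced word_prod_cat size_cat => h.
have := len_mul_le (wp c) (wp d); have := len_min c; have := len_min d; lia.
Qed.

Lemma two_ldesc (w : W) i j : i <> j ->
  len w = (len (s i * w)%g).+1 -> len w = (len (s j * w)%g).+1 ->
  [\/ dot i j = 0 /\ exists2 v : W, w = (s i * s j * v)%g & len w = (len v).+2 |
      dot i j = -1 /\ exists2 v : W, w = (s i * s j * s i * v)%g & len w = (len v).+3].
Proof.
have V k : len w = (len (s k * w)%g).+1 -> len w^-1%g = (len (w^-1 * s k)%g).+1.
  by move=> h; rewrite lenV h -(lenV (s k * w)%g) invMg slw_reflV.
move=> ne /V hi /V hj; case: (dot_cases i j) => [[/ne //]|[_ d]|[_ d]].
  constructor 1; split=> //; have [v e l] := two_desc_comm d hi hj.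
  exists v^-1%g; last by rewrite -(lenV w) l lenV.
  by rewrite (dot0_comm d) -[w]invgK e !invMg !slw_reflV mulgA.
constructor 2; split=> //; have [v e l] := two_desc_braid d hi hj.
exists v^-1%g; last by rewrite -(lenV w) l lenV.
by rewrite -[w]invgK e !invMg !slw_reflV !mulgA.
Qed.

Section Transition.
Variable n : nat.
Local Notation E := (sfexpr n).

Definition eval_word (K : semifield) (a : 'I_n -> K) (u : seq (I * E)) : seq (I * K) :=
  [seq (p.1, sf_eval a p.2) | p <- u].

(* Besides the relations of the monoid, [trans_ok] keeps track of constant
   coordinates in an idempotent semifield, which braid moves preserve. *)
Definition trans_ok (u v : seq (I * E)) := forall (K : semifield) (a : 'I_n -> K),
  word_cong (@frakU_rel W K) (eval_word a u) (eval_word a v) /\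
  forall k : K, sf_add k k = k -> all (fun p => p.2 == k) (eval_word a u) ->
     all (fun p => p.2 == k) (eval_word a v).

Lemma trans_refl u : trans_ok u u.
Proof. by move=> K a; split=> //; apply: WordRefl. Qed.
Lemma trans_trans u v w : trans_ok u v -> trans_ok v w -> trans_ok u w.
Proof.
move=> h1 h2 K a; have [a1 b1] := h1 K a; have [a2 b2] := h2 K a; split.
  exact: WordTrans a1 a2.
by move=> k kk /b1 => /(_ kk)/b2; apply.
Qed.
Lemma trans_cat u v w : trans_ok u v -> trans_ok (u ++ w) (v ++ w).
Proof.
move=> h K a; have [a1 b1] := h K a; rewrite /eval_word !map_cat; split.
  by apply: WordCat => //; apply: WordRefl.
by move=> k kk; rewrite !all_cat => /andP [/b1 -> // ->].
Qed.
Lemma trans_cons p u v : trans_ok u v -> trans_ok (p :: u) (p :: v).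
Proof.
move=> h K a; have [a1 b1] := h K a; split.
  by apply: (@WordCat _ _ [:: _] [:: _]) => //; apply: WordRefl.
by move=> k kk /= /andP [-> /b1 ->].
Qed.

Lemma trans_comm i j x y : dot i j = 0 -> trans_ok [:: (i, x); (j, y)] [:: (j, y); (i, x)].
Proof.
move=> d K a; split; first exact/WordRel/FrakUComm.
by move=> k _ /= /and3P [-> ->].
Qed.

(** These are the solutions a' = bc/(a+c), b' = a+c, c' = ab/(a+c) of the equations in the braid
    relation. *)
Definition braid1 (x y z : E) := SFMul (SFMul y z) (SFInv (SFAdd x z)).
Definition braid2 (x z : E) := SFAdd x z.
Definition braid3 (x y z : E) := SFMul (SFMul x y) (SFInv (SFAdd x z)).

Lemma trans_braid i j x y z : dot i j = -1 ->
  trans_ok [:: (i, x); (j, y); (i, z)]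
    [:: (j, braid1 x y z); (i, braid2 x z); (j, braid3 x y z)].
Proof.
move=> d K a; split.
  apply/WordRel/FrakUBraid => //=.
    rewrite [RHS]sf_mulC -sf_mulA sf_mulV [RHS]sf_mulC sf_mul1 //.
  by rewrite -sf_mulA sf_mulV sf_mulC sf_mul1.
move=> k kk /= /and4P [/eqP -> /eqP -> /eqP -> _].
rewrite kk -!sf_mulA [sf_mul k (sf_inv k)]sf_mulC sf_mulV.
by rewrite sf_mulC sf_mul1 eqxx.
Qed.

(** If the first letters [i] and [j] differ, both are left descents, so the product is [s_i s_j v]
    or [s_i s_j s_i v] with lengths adding. Induction brings the tail of [u] to begin with [j] or
    [j i], one commutation or braid move brings [j] to the front, and induction applies again to
    what follows it. *)
Lemma matsumoto u (d : seq I) : reduced (map fst u) -> reduced d ->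
  wp (map fst u) = wp d -> exists2 v, map fst v = d & trans_ok u v.
Proof.
have [m] := ubnP (size u); elim: m u d => // m IH [|[i x] u] d lm ru rd e.
  exists [::]; last exact: trans_refl.
  by case: d rd e => // j d; rewrite /reduced => + h; rewrite -h word_prod_nil len1.
case: d rd e => [|j d] rd /= e.
  by move: ru; rewrite /reduced /= e word_prod_nil len1.
rewrite /= in lm; have ru' := reduced_cons ru; have rd' := reduced_cons rd.
case: (eqVneq i j) => [eij|/eqP ne].
  case: (IH u d) => //; first by move: e; rewrite eij !word_prod_cons => /mulgI.
  by move=> v vd h; exists ((i, x) :: v); [rewrite /= vd eij|apply: trans_cons].
have sz : size u = size d.
  by move: ru rd; rewrite /reduced /= e => -> [] //; rewrite size_map.
set w := wp (i :: map fst u) in e.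
have siw : (s i * w)%g = wp (map fst u) by rewrite /w word_prod_cons mulgA slw_reflK mul1g.
have sjw : (s j * w)%g = wp d by rewrite e word_prod_cons mulgA slw_reflK mul1g.
have coord_word : len w = (size u).+1 by rewrite ru /= size_map.
have hi : len w = (len (s i * w)%g).+1 by rewrite siw ru' coord_word size_map.
have hj : len w = (len (s j * w)%g).+1 by rewrite sjw rd' coord_word sz.
have step u1 (c : seq I) : (size u1 < m)%N -> reduced (map fst u1) ->
    wp (map fst u1) = wp c -> size u1 = size c ->
    exists2 v, map fst v = c & trans_ok u1 v.
  move=> l1 r1 e1 s1; apply: IH => //.
  by move: r1; rewrite /reduced e1 size_map s1.
case: (two_ldesc ne hi hj) => [[dij [v ev lv]]|[dij [v ev lv]]].
- have [c cv lc] := len_word v.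
  have [||||u1 u1c t1] := step u (j :: c) => //.
    by rewrite -siw ev word_prod_cons cv !mulgA slw_reflK mul1g.
    by move: coord_word; rewrite lv /= lc => -[].
  case: u1 u1c t1 => [//|[j' y] u1] /= [-> u1c] t1.
  have [||||u2 u2d t2] := step ((i, x) :: u1) d.
  - by have := congr1 size u1c; rewrite size_map lc; move: lm coord_word; rewrite lv /=;
      move: (size u) (size u1) (len v) => *; lia.
  - rewrite /reduced /= u1c word_prod_cons cv.
    have -> : (s i * v = s j * w)%g by rewrite ev (dot0_comm dij) !mulgA slw_reflK mul1g.
    by move: hj; rewrite lv lc => -[<-].
  - rewrite /= u1c -sjw ev (dot0_comm dij) word_prod_cons cv !mulgA slw_reflK mul1g //.
  - by rewrite -sz /=; have := congr1 size u1c; rewrite size_map lc;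
      move: coord_word; rewrite lv => -[<-] ->.
  exists ((j, y) :: u2); first by rewrite /= u2d.
  apply: trans_trans (trans_cons (i, x) t1) _.
  apply: trans_trans (trans_cat u1 (trans_comm x y dij)) _.
  exact: trans_cons.
- have [c cv lc] := len_word v.
  have [||||u1 u1c t1] := step u (j :: i :: c) => //.
    by rewrite -siw ev !word_prod_cons cv !mulgA slw_reflK mul1g.
    by move: coord_word; rewrite lv /= lc => -[].
  case: u1 u1c t1 => [//|[j' y] [//|[i' z] u1]] /= [-> -> u1c] t1.
  have [||||u2 u2d t2] := step ((i, braid2 x z) :: (j, braid3 x y z) :: u1) d.
  - by have := congr1 size u1c; rewrite size_map lc; move: lm coord_word; rewrite lv /=;
      move: (size u) (size u1) (len v) => *; lia.
  - rewrite /reduced /= u1c !word_prod_cons cv.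
    have -> : (s i * (s j * v) = s j * w)%g.
      by rewrite ev (dotN1_braid dij) !mulgA slw_reflK mul1g.
    by move: hj; rewrite lv lc => -[<-].
  - rewrite /= u1c -sjw ev (dotN1_braid dij) !word_prod_cons cv !mulgA slw_reflK mul1g //.
  - by rewrite -sz /=; have := congr1 size u1c; rewrite size_map lc;
      move: coord_word; rewrite lv => -[<-] ->.
  exists ((j, braid1 x y z) :: u2); first by rewrite /= u2d.
  apply: trans_trans (trans_cons (i, x) t1) _.
  apply: trans_trans (trans_cat u1 (trans_braid x y z dij)) _.
  exact: trans_cons.
Qed.

End Transition.
End Matsumoto.

(** * Exponentials of nilpotent matrices *)

Section NilpotentExp.
Variables (R : realType) (n : nat).
Local Notation M := 'M[R]_n.+1.
Implicit Types (g N X Y Z : M) (a b c t : R).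

Definition nilpmx N := N ^+ n.+1 = 0.

(** The minimal polynomial divides a power of X, hence is itself a power of X, of degree at most n +
    1. This makes the truncation in [mxexp_nilp] harmless for every nilpotent matrix. *)
Lemma nilp_exp N m : N ^+ m = 0 -> nilpmx N.
Proof.
move=> Nm; have : mxminpoly N %| ('X - 0%:P) ^+ m.
  by apply: mxminpoly_min; rewrite subr0 rmorphXn /= horner_mx_X.
case/dvdp_exp_XsubCP => k _; rewrite subr0 => eqk.
have kn : (k <= n.+1)%N.
  have := eqp_size eqk; rewrite size_polyXn size_mxminpoly => -[<-].
  have := dvdp_leq (monic_neq0 (char_poly_monic N)) (mxminpoly_dvd_char N).
  by rewrite size_char_poly size_mxminpoly ltnS.
have Nk : N ^+ k = 0.
  have : mxminpoly N %| 'X^k by rewrite (eqp_dvdl _ eqk).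
  by move/mxminpoly_minP; rewrite rmorphXn /= horner_mx_X.
have : N ^+ (n.+1 - k + k) = 0 by rewrite exprD Nk mulr0.
by rewrite subnK.
Qed.

Lemma nilp_ge N k : nilpmx N -> (n < k)%N -> N ^+ k = 0.
Proof.
move=> Nn nk; have : N ^+ (k - n.+1 + n.+1) = 0 by rewrite exprD Nn mulr0.
by rewrite subnK.
Qed.

Lemma nilpZ a N : nilpmx N -> nilpmx (a *: N).
Proof. by move=> h; rewrite /nilpmx exprZn h scaler0. Qed.

Lemma mxexp_wide N L : nilpmx N -> (n < L)%N ->
  mxexp_nilp N = \sum_(k < L) (k`!%:R)^-1 *: N ^+ k.
Proof.
move=> Nn nL; rewrite /mxexp_nilp -!(big_mkord xpredT (fun k => (k`!%:R)^-1 *: N ^+ k)).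
rewrite [RHS](@big_cat_nat _ _ _ n.+1) //= [X in _ = _ + X]big_nat_cond [X in _ = _ + X]big1 ?addr0 //.
by move=> k /andP [/andP [nk _] _]; rewrite nilp_ge // scaler0.
Qed.

(** The exponential is the value at 1 of this polynomial, so that [mxexpD] becomes a comparison of
    the coefficients of a product with the binomial formula. *)
Definition exp_coef N : {poly M} := \poly_(k < n.+1) ((k`!%:R)^-1 *: N ^+ k).

Lemma exp_coefE N k : nilpmx N -> (exp_coef N)`_k = (k`!%:R)^-1 *: N ^+ k.
Proof.
move=> Nn; rewrite coef_poly; case: ltnP => // nk.
by rewrite nilp_ge // scaler0.
Qed.

Lemma horner_exp_coef N : (exp_coef N).[1] = mxexp_nilp N.
Proof. by rewrite horner_poly; apply: eq_bigr => k _; rewrite expr1n mulr1. Qed.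

Lemma nilpD N X : GRing.comm N X -> nilpmx N -> nilpmx X -> nilpmx (N + X).
Proof.
move=> cNX hN hX; apply: (@nilp_exp _ (n.+1 + n.+1)).
rewrite exprDn_comm // big1 // => i _.
case: (ltnP n i) => ni; first by rewrite (nilp_ge hX ni) mulr0 mul0rn.
rewrite (nilp_ge hN) ?mul0r ?mul0rn //; lia.
Qed.

Lemma mxexpD N X : GRing.comm N X -> nilpmx N -> nilpmx X ->
  mxexp_nilp (N + X) = mxexp_nilp N * mxexp_nilp X.
Proof.
move=> cNX hN hX; rewrite -!horner_exp_coef -hornerM_comm; last first.
  by rewrite /comm_poly mulr1 mul1r.
have sz : (size (exp_coef N * exp_coef X)%R <= n.+1 + n.+1)%N.
  apply: leq_trans (size_polyMleq _ _) _; apply: leq_trans (leq_pred _) _.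
  by apply: leq_add; apply: size_poly.
rewrite [RHS](horner_coef_wide _ sz) horner_exp_coef.
rewrite (mxexp_wide (nilpD cNX hN hX) (L := n.+1 + n.+1)) ?addnS ?ltnS ?leq_addr //.
  apply: eq_bigr => k _; rewrite expr1n mulr1 coefM addrC.
  rewrite exprDn_comm; last by rewrite /GRing.comm cNX.
  rewrite scaler_sumr; apply: eq_bigr => i _; rewrite !exp_coefE //.
  have ik : (i <= k)%N by rewrite -ltnS.
  rewrite -scalerAl -scalerAr scalerA -scaler_nat scalerA.
  have -> : X ^+ (k - i) * N ^+ i = N ^+ i * X ^+ (k - i).
    by apply: commrX; apply: commr_sym; apply: commrX.
  congr (_ *: _); rewrite -(bin_fact ik) !natrM.
  have f0 m : m`!%:R != 0 :> R by rewrite pnatr_eq0 -lt0n fact_gt0.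
  have b0 : 'C(k, i)%:R != 0 :> R by rewrite pnatr_eq0 -lt0n bin_gt0.
  by field; rewrite b0 !f0.
by apply: leq_trans (leq_addr _ _).
Qed.

Lemma mxexp0 : mxexp_nilp (0 : M) = 1.
Proof.
rewrite /mxexp_nilp big_ord_recl /= big1 ?addr0 => [|k _].
  by rewrite fact0 invr1 expr0 scale1r.
by rewrite exprS mul0r scaler0.
Qed.

Lemma mxexpZD a b N : nilpmx N ->
  mxexp_nilp ((a + b) *: N) = mxexp_nilp (a *: N) * mxexp_nilp (b *: N).
Proof.
move=> hN; rewrite scalerDl mxexpD //; try exact: nilpZ.
by rewrite /GRing.comm -!scalerAl -!scalerAr !scalerA mulrC.
Qed.

Lemma mxexpNl N : nilpmx N -> mxexp_nilp (- N) * mxexp_nilp N = 1.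
Proof.
move=> hN; rewrite -[N in X in _ * X]scale1r -scaleN1r -mxexpZD //.
by rewrite addNr scale0r mxexp0.
Qed.

Lemma mxexp_unit N : nilpmx N -> mxexp_nilp N \is a GRing.unit.
Proof.
move=> hN; apply/unitrP; exists (mxexp_nilp (- N)); split; first exact: mxexpNl.
by rewrite -[N in X in X * _]opprK mxexpNl // -scaleN1r; apply: nilpZ.
Qed.

Definition Ad g X := g * X * g^-1.

Lemma AdD g X Y : Ad g (X + Y) = Ad g X + Ad g Y.
Proof. by rewrite /Ad mulrDr mulrDl. Qed.
Lemma AdN g X : Ad g (- X) = - Ad g X.
Proof. by rewrite /Ad mulrN mulNr. Qed.
Lemma AdB g X Y : Ad g (X - Y) = Ad g X - Ad g Y.
Proof. by rewrite AdD AdN. Qed.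
Lemma AdZ g a X : Ad g (a *: X) = a *: Ad g X.
Proof. by rewrite /Ad -scalerAr -scalerAl. Qed.
Lemma Ad0 g : Ad g 0 = 0. Proof. by rewrite /Ad mulr0 mul0r. Qed.
Lemma Ad_sum g (T : finType) (F : T -> M) : Ad g (\sum_k F k) = \sum_k Ad g (F k).
Proof. by rewrite /Ad mulr_sumr mulr_suml. Qed.
Lemma AdM g X Y : g \is a GRing.unit -> Ad g (X * Y) = Ad g X * Ad g Y.
Proof. by move=> ug; rewrite /Ad !mulrA mulrVK. Qed.
Lemma Ad1 g : g \is a GRing.unit -> Ad g 1 = 1.
Proof. by move=> ug; rewrite /Ad mulr1 mulrV. Qed.
Lemma AdX g X k : g \is a GRing.unit -> Ad g (X ^+ k) = Ad g X ^+ k.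
Proof. by move=> ug; elim: k => [|k IH]; rewrite ?Ad1 // !exprS AdM // IH. Qed.
Lemma Ad_comp g h X : g \is a GRing.unit -> h \is a GRing.unit ->
  Ad (g * h) X = Ad g (Ad h X).
Proof. by move=> ug uh; rewrite /Ad invrM // !mulrA. Qed.
Lemma Ad_comp3 g h k X : g \is a GRing.unit -> h \is a GRing.unit ->
  k \is a GRing.unit -> Ad (g * h * k) X = Ad g (Ad h (Ad k X)).
Proof. by move=> ug uh uk; rewrite !Ad_comp // unitrMr. Qed.
Lemma Ad_id X : Ad 1 X = X. Proof. by rewrite /Ad mul1r invr1 mulr1. Qed.
Lemma AdK g X : g \is a GRing.unit -> Ad g (Ad g^-1 X) = X.
Proof. by move=> ug; rewrite -Ad_comp ?unitrV // mulrV // Ad_id. Qed.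
Lemma AdVK g X : g \is a GRing.unit -> Ad g^-1 (Ad g X) = X.
Proof. by move=> ug; rewrite -Ad_comp ?unitrV // mulVr // Ad_id. Qed.
Lemma Ad_unit g X : g \is a GRing.unit -> X \is a GRing.unit -> Ad g X \is a GRing.unit.
Proof. by move=> ug uX; rewrite /Ad unitrMr ?unitrV // unitrMr. Qed.

Lemma Ad_mul g X : g \is a GRing.unit -> g * X = Ad g X * g.
Proof. by move=> ug; rewrite /Ad mulrVK. Qed.

Lemma Ad_exp g N : g \is a GRing.unit -> Ad g (mxexp_nilp N) = mxexp_nilp (Ad g N).
Proof.
move=> ug; rewrite /mxexp_nilp Ad_sum; apply: eq_bigr => k _.
by rewrite AdZ AdX.
Qed.

Lemma lie_eq X Y : X * Y = Y * X + lie X Y.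
Proof. by rewrite /lie addrC subrK. Qed.

Lemma exp_mul_pow N X Y Z k : lie N X = Y -> lie N Y = Z -> lie N Z = 0 ->
  N ^+ k * X = X * N ^+ k + (Y * N ^+ k.-1) *+ k + (Z * N ^+ k.-2) *+ 'C(k, 2).
Proof.
move=> hX hY hZ; elim: k => [|k IH].
  by rewrite expr0 mul1r mulr1 !mulr0n !addr0.
rewrite exprS -mulrA IH !mulrDr -!mulrnAr !mulrA (lie_eq N X) (lie_eq N Y) (lie_eq N Z).
rewrite hX hY hZ addr0 !mulrDl -!mulrA -!exprS.
have e1 : N * (N ^+ k.-1 *+ k) = N ^+ k *+ k.
  by case: k {IH} => [|k]; rewrite ?mulr0n ?mulr0 // mulrnAr -exprS.
have e2 : N * (N ^+ k.-2 *+ 'C(k, 2)) = N ^+ k.-1 *+ 'C(k, 2).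
  by case: k {IH e1} => [|[|k]]; rewrite ?mulr0n ?mulr0 // mulrnAr -exprS.
rewrite e1 e2 /= binS bin1 mulrnDr mulrS !mulrDr !addrA.
by rewrite [in RHS]addrAC.
Qed.

(** This is Ad(exp N) = exp(ad N) for [X] killed by the third power of ad N, proved by expanding
    [N ^+ k * X] with [exp_mul_pow]. In the simply laced case the longest string among the Chevalley
    generators, [f_i] to [h_i] to [e_i], needs no more than this. *)
Lemma Ad_exp_lie N X Y Z : nilpmx N -> lie N X = Y -> lie N Y = Z -> lie N Z = 0 ->
  Ad (mxexp_nilp N) X = X + Y + 2^-1 *: Z.
Proof.
move=> hN hX hY hZ; rewrite /Ad; apply: (mulIr (mxexp_unit hN)).
rewrite mulrVK ?mxexp_unit // !mulrDl.
rewrite {1}(mxexp_wide hN (L := n.+3)); last by rewrite !ltnS ltnW // ltnW.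
rewrite mulr_suml; under eq_bigr => k _.
  rewrite -scalerAl (exp_mul_pow _ hX hY hZ) !scalerDr; over.
rewrite !big_split /=; congr (_ + _ + _).
- rewrite (mxexp_wide hN (L := n.+3)); last by rewrite !ltnS ltnW // ltnW.
  by rewrite mulr_sumr; apply: eq_bigr => k _; rewrite scalerAr.
- rewrite big_ord_recl /= mulr0n scaler0 add0r.
  rewrite (mxexp_wide hN (L := n.+2)); last by rewrite ltnW.
  rewrite mulr_sumr; apply: eq_bigr => k _; rewrite /bump /= add1n.
  rewrite -scaler_nat scalerA -scalerAr; congr (_ *: _).
  rewrite factS natrM invfM mulrAC mulVf ?mul1r //.
  by rewrite pnatr_eq0.
- rewrite 2!big_ord_recl /= !mulr0n !scaler0 !add0r.
  rewrite /mxexp_nilp -scalerAl mulr_sumr scaler_sumr; apply: eq_bigr => k _.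
  rewrite /bump /= !add1n -scaler_nat scalerA -scalerAr scalerA; congr (_ *: _).
  have f0 m : m`!%:R != 0 :> R by rewrite pnatr_eq0 -lt0n fact_gt0.
  have := bin_fact (isT : (2 <= k.+2)%N) ; rewrite subSS subSS subn0 => <-.
  have f2 : factorial 2 = 2%N by []. rewrite f2 !natrM.
  have b0 : 'C(k.+2, 2)%:R != 0 :> R by rewrite pnatr_eq0 -lt0n bin_gt0.
  by field; rewrite b0 f0.
Qed.

(** The nonzero powers [N ^+ k] are eigenvectors of ad h with eigenvalues c k. If no power vanished,
    the matrix [D] of ad h on vectorised matrices would have more eigenvalues than its
    characteristic polynomial has roots. *)
Lemma adh_nilp h N c : c != 0 -> lie h N = c *: N -> nilpmx N.
Proof.
move=> c0 hN; have hk k : lie h (N ^+ k) = (c * k%:R) *: N ^+ k.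
  elim: k => [|k IH]; first by rewrite expr0 /lie mulr1 mul1r subrr mulr0 scale0r.
  have -> : lie h (N ^+ k.+1) = lie h N * N ^+ k + N * lie h (N ^+ k).
    by rewrite /lie exprS mulrBl mulrBr !mulrA subrKA.
  rewrite hN IH -scalerAl -scalerAr -exprS -scalerDl -natr1 mulrDr mulr1 addrC.
  by rewrite addrC.
pose D := lin_mulmx h - lin_mulmxr h.
have DE (X : M) : mxvec X *m D = mxvec (lie h X).
  by rewrite /D mulmxBr !mul_vec_lin /= /mulmxr -linearB.
have [[k Nk]|none] := pselect (exists k, N ^+ k = 0); first exact: nilp_exp Nk.
exfalso; pose rs := [seq c * k%:R | k <- iota 0 (size (char_poly D))].
have := @max_poly_roots _ (char_poly D) rs (monic_neq0 (char_poly_monic D)).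
rewrite size_map size_iota ltnn => h'; suff : false by [].
apply: h'.
  apply/allP => a /mapP [k _ ->]; rewrite -eigenvalue_root_char.
  apply/eigenvalueP; exists (mxvec (N ^+ k)); first by rewrite DE hk linearZ.
  by rewrite mxvec_eq0; apply/eqP => e; apply: none; exists k.
rewrite map_inj_uniq ?iota_uniq // => k l /(mulfI c0)/eqP.
by rewrite eqr_nat => /eqP.
Qed.

End NilpotentExp.

(** * Root subgroups of the pinned group *)

Section LieBracket.
Variables (R : realType) (n : nat).
Local Notation M := 'M[R]_n.+1.
Implicit Types (X Y Z : M) (a : R).

Lemma lieC X Y : lie X Y = - lie Y X. Proof. by rewrite /lie opprB. Qed.
Lemma liexx X : lie X X = 0. Proof. by rewrite /lie subrr. Qed.
Lemma lie0r X : lie X 0 = 0. Proof. by rewrite /lie mulr0 mul0r subrr. Qed.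
Lemma lieZl a X Y : lie (a *: X) Y = a *: lie X Y.
Proof. by rewrite /lie -scalerAl -scalerAr scalerBr. Qed.
Lemma lieZr a X Y : lie X (a *: Y) = a *: lie X Y.
Proof. by rewrite /lie -scalerAl -scalerAr scalerBr. Qed.
Lemma lieNr X Y : lie X (- Y) = - lie X Y.
Proof. by rewrite /lie mulrN mulNr opprD. Qed.
Lemma lieNl X Y : lie (- X) Y = - lie X Y.
Proof. by rewrite /lie mulrN mulNr opprD. Qed.
Lemma lieDr X Y Z : lie X (Y + Z) = lie X Y + lie X Z.
Proof. by rewrite /lie mulrDl mulrDr opprD addrACA. Qed.
Lemma lie_jacobi X Y Z : lie X (lie Y Z) = lie (lie X Y) Z + lie Y (lie X Z).
Proof.
rewrite /lie !(mulrBl, mulrBr) !mulrA.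
move: (X * Y * Z) (X * Z * Y) (Y * Z * X) (Z * Y * X) (Y * X * Z) (Z * X * Y).
by move=> A B C D E F; apply/matrixP=> i j; rewrite !mxE; ring.
Qed.

End LieBracket.

Section Opposite.
Variables (R : realType) (W : simply_laced_weyl) (G : pinned_group R W).
Local Notation I := (slw_index W).

Lemma op_hh i j : lie (- pg_h G i) (- pg_h G j) = 0.
Proof. by rewrite lieNl lieNr pg_hh !oppr0. Qed.
Lemma op_he i j : lie (- pg_h G i) (pg_f G j) = pg_f G j *~ dot i j.
Proof. by rewrite lieNl pg_hf opprK. Qed.
Lemma op_hf i j : lie (- pg_h G i) (pg_e G j) = - (pg_e G j *~ dot i j).
Proof. by rewrite lieNl pg_he. Qed.
Lemma op_ef i j : lie (pg_f G i) (pg_e G j) = if i == j then - pg_h G i else 0.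
Proof.
by rewrite lieC pg_ef eq_sym; case: eqP => [->|]; rewrite ?oppr0.
Qed.
Lemma op_sc (mu : {ffun I -> int}) :
  exists m (lam : 'I_m -> {ffun I -> int}) (z : 'I_m -> int),
    (forall k, is_weight (fun i => - pg_h G i) (lam k)) /\ mu = \sum_(k < m) lam k *~ z k.
Proof.
have [m [lam [z [wl e]]]] := pg_simply_connected G mu.
exists m, (fun k => - lam k), (fun k => - z k); split.
  move=> k; have [v v0 hv] := wl k; exists v => // i.
  by rewrite mulNmx hv ffunE rmorphN scaleNr.
by rewrite e; apply: eq_bigr => k _; rewrite mulrNz mulNrz opprK.
Qed.

(* The Chevalley involution: exchanging [e] and [f] turns every statement about
   the [x_i] into one about the [y_i]. *)
Definition op : pinned_group R W :=
  PinnedGroup op_hh op_he op_hf op_ef (@pg_serre_f R W G) (@pg_serre_e R W G) op_sc.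

End Opposite.

Section RootSubgroups.
Variables (R : realType) (W : simply_laced_weyl) (G : pinned_group R W).
Local Notation I := (slw_index W).
Local Notation M := 'M[R]_((pg_dim G).+1).
Local Notation e := (pg_e G).
Local Notation f := (pg_f G).
Local Notation h := (pg_h G).
Local Notation x := (xroot G).
Implicit Types (i j : I) (t u : R) (X Y Z : M).

Lemma e_nilp i : nilpmx (e i).
Proof.
apply: (@adh_nilp _ _ (h i) _ 2%:R); first by rewrite pnatr_eq0.
by rewrite pg_he dotii scaler_nat.
Qed.

Lemma xrootD i t u : x i (t + u) = x i t * x i u.
Proof. by apply: mxexpZD; apply: e_nilp. Qed.
Lemma xroot0 i : x i 0 = 1. Proof. by rewrite /xroot scale0r mxexp0. Qed.
Lemma x_unit i t : x i t \is a GRing.unit.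
Proof. by apply: mxexp_unit; apply/nilpZ/e_nilp. Qed.
Lemma xrootNK i t : x i (- t) * x i t = 1. Proof. by rewrite -xrootD addNr xroot0. Qed.
Lemma xrootKN i t : x i t * x i (- t) = 1. Proof. by rewrite -xrootD addrN xroot0. Qed.
Lemma xrootV i t : (x i t)^-1 = x i (- t).
Proof. by apply: (mulIr (x_unit i t)); rewrite mulVr ?x_unit // xrootNK. Qed.

Lemma Adx i t X Y Z : lie (e i) X = Y -> lie (e i) Y = Z -> lie (e i) Z = 0 ->
  Ad (x i t) X = X + t *: Y + (t ^+ 2 / 2) *: Z.
Proof.
move=> hX hY hZ; rewrite /xroot.
rewrite (@Ad_exp_lie _ _ (t *: e i) X (t *: Y) (t ^+ 2 *: Z)).
- by rewrite scalerA mulrC.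
- by apply/nilpZ/e_nilp.
- by rewrite lieZl hX.
- by rewrite lieZl lieZr hY scalerA -expr2.
- by rewrite lieZl lieZr hZ !scaler0.
Qed.

Lemma Adx1 i t X Y : lie (e i) X = Y -> lie (e i) Y = 0 -> Ad (x i t) X = X + t *: Y.
Proof. by move=> hX hY; rewrite (Adx t hX hY (lie0r _)) scaler0 addr0. Qed.

Lemma Adx0 i t X : lie (e i) X = 0 -> Ad (x i t) X = X.
Proof. by move=> hX; rewrite (Adx1 t hX (lie0r _)) scaler0 addr0. Qed.

Lemma lie_eh i j : lie (e i) (h j) = - ((dot j i)%:~R *: e i).
Proof. by rewrite lieC pg_he scaler_int. Qed.

Lemma lie_ei_ej i j : dot i j = 0 -> lie (e i) (e j) = 0.
Proof.
move=> d; have ne : i != j by apply/eqP => ij; move: d; rewrite ij dotii.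
by have := @pg_serre_e R W G _ _ ne; rewrite d.
Qed.

Lemma lie_ei_eij i j : dot i j = -1 -> lie (e i) (lie (e i) (e j)) = 0.
Proof.
move=> d; have ne : i != j by apply/eqP => ij; move: d; rewrite ij dotii.
by have := @pg_serre_e R W G _ _ ne; rewrite d.
Qed.

Lemma lie_ei_fij i j : dot i j = -1 -> lie (e i) (lie (f i) (f j)) = f j.
Proof.
move=> d; have ne : i == j = false by apply/eqP => ij; move: d; rewrite ij dotii.
by rewrite lie_jacobi !pg_ef eqxx ne lie0r addr0 pg_hf d mulrN1z opprK.
Qed.

Lemma lie_ei_fj i j : i <> j -> lie (e i) (f j) = 0.
Proof. by move=> /eqP/negPf ne; rewrite pg_ef ne. Qed.

Lemma Adx_e i t : Ad (x i t) (e i) = e i.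
Proof. by apply: Adx0; apply: liexx. Qed.

Lemma Adx_h i j t : Ad (x i t) (h j) = h j - (t * (dot j i)%:~R) *: e i.
Proof.
rewrite (Adx1 t (lie_eh i j)); first by rewrite scalerN scalerA.
by rewrite lieNr lieZr liexx scaler0 oppr0.
Qed.

Lemma Adx_f i t : Ad (x i t) (f i) = f i + t *: h i - t ^+ 2 *: e i.
Proof.
have ef : lie (e i) (f i) = h i by rewrite pg_ef eqxx.
rewrite (Adx t ef (lie_eh i i)).
  rewrite dotii scalerN scalerA; congr (_ - _ *: _).
  by rewrite -mulrA (_ : 2^-1 * 2%:~R = 1 :> R) ?mulr1 // mulVf // pnatr_eq0.
by rewrite lieNr lieZr liexx scaler0 oppr0.
Qed.

Lemma Adx_fj i j t : i <> j -> Ad (x i t) (f j) = f j.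
Proof. by move=> ne; apply: Adx0; apply: lie_ei_fj. Qed.

Lemma Adx_e0 i j t : dot i j = 0 -> Ad (x i t) (e j) = e j.
Proof. by move=> d; apply: Adx0; apply: lie_ei_ej. Qed.

Lemma Adx_eN1 i j t : dot i j = -1 -> Ad (x i t) (e j) = e j + t *: lie (e i) (e j).
Proof. by move=> d; apply: Adx1 => //; apply: lie_ei_eij. Qed.

Lemma Adx_eij i j t : dot i j = -1 -> Ad (x i t) (lie (e i) (e j)) = lie (e i) (e j).
Proof. by move=> d; apply: Adx0; apply: lie_ei_eij. Qed.

Lemma Adx_fij i j t : dot i j = -1 -> Ad (x i t) (lie (f i) (f j)) = lie (f i) (f j) + t *: f j.
Proof.
move=> d; apply: Adx1; first exact: lie_ei_fij.
by apply: lie_ei_fj => ij; move: d; rewrite ij dotii.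
Qed.

Lemma Ad_xroot i t g : g \is a GRing.unit -> Ad g (x i t) = mxexp_nilp (t *: Ad g (e i)).
Proof. by move=> ug; rewrite /xroot Ad_exp // AdZ. Qed.

Lemma x_comm i j a b : dot i j = 0 -> x i a * x j b = x j b * x i a.
Proof.
move=> d; apply: (mulIr (x_unit i (- a))); rewrite -[RHS]mulrA xrootKN mulr1 -xrootV.
by rewrite -/(Ad (x i a) (x j b)) Ad_xroot ?x_unit // Adx_e0.
Qed.

End RootSubgroups.

(** * Rank one: the elements n_i(t) and their adjoint action *)

Section RankOne.
Variables (R : realType) (W : simply_laced_weyl) (G : pinned_group R W).
Local Notation I := (slw_index W).
Local Notation M := 'M[R]_((pg_dim G).+1).
Local Notation e := (pg_e G).
Local Notation f := (pg_f G).
Local Notation h := (pg_h G).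
Local Notation x := (xroot G).
Local Notation y := (yroot G).
Local Notation nn := (nroot G).
Implicit Types (i j : I) (t u : R) (X Y Z : M).

Lemma yrootD i t u : y i (t + u) = y i t * y i u. Proof. exact: (xrootD (op G)). Qed.
Lemma yroot0 i : y i 0 = 1. Proof. exact: (xroot0 (op G)). Qed.
Lemma y_unit i t : y i t \is a GRing.unit. Proof. exact: (x_unit (op G)). Qed.
Lemma yrootNK i t : y i (- t) * y i t = 1. Proof. exact: (xrootNK (op G)). Qed.
Lemma yrootKN i t : y i t * y i (- t) = 1. Proof. exact: (xrootKN (op G)). Qed.
Lemma yrootV i t : (y i t)^-1 = y i (- t). Proof. exact: (xrootV (op G)). Qed.
Lemma Ad_yroot i t g : g \is a GRing.unit -> Ad g (y i t) = mxexp_nilp (t *: Ad g (f i)).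
Proof. exact: (@Ad_xroot _ _ (op G)). Qed.

Lemma Ady_f i t : Ad (y i t) (f i) = f i. Proof. exact: (Adx_e (op G)). Qed.
Lemma Ady_h i j t : Ad (y i t) (h j) = h j + (t * (dot j i)%:~R) *: f i.
Proof.
have := Adx_h (op G) i j t; rewrite /= AdN => /(congr1 -%R).
by rewrite opprK opprB addrC => ->; rewrite opprK.
Qed.
Lemma Ady_e i t : Ad (y i t) (e i) = e i - t *: h i - t ^+ 2 *: f i.
Proof. by rewrite -scalerN; exact: (Adx_f (op G)). Qed.
Lemma Ady_ej i j t : i <> j -> Ad (y i t) (e j) = e j.
Proof. exact: (@Adx_fj _ _ (op G)). Qed.
Lemma Ady_f0 i j t : dot i j = 0 -> Ad (y i t) (f j) = f j.
Proof. exact: (@Adx_e0 _ _ (op G)). Qed.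
Lemma Ady_fN1 i j t : dot i j = -1 -> Ad (y i t) (f j) = f j + t *: lie (f i) (f j).
Proof. exact: (@Adx_eN1 _ _ (op G)). Qed.
Lemma Ady_fij i j t : dot i j = -1 -> Ad (y i t) (lie (f i) (f j)) = lie (f i) (f j).
Proof. exact: (@Adx_eij _ _ (op G)). Qed.
Lemma Ady_eij i j t : dot i j = -1 -> Ad (y i t) (lie (e i) (e j)) = lie (e i) (e j) + t *: e j.
Proof. exact: (@Adx_fij _ _ (op G)). Qed.

Lemma n_unit i t : nn i t \is a GRing.unit.
Proof. by rewrite /nroot unitrMr ?x_unit // unitrMr ?x_unit ?y_unit. Qed.

Lemma Adn_split i t X : Ad (nn i t) X = Ad (x i t) (Ad (y i (- t^-1)) (Ad (x i t) X)).
Proof. by rewrite /nroot !Ad_comp ?x_unit ?y_unit // unitrMr ?x_unit ?y_unit. Qed.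

Definition AdE := (AdD, AdN, AdZ).

Lemma Adn_e i t : t != 0 -> Ad (nn i t) (e i) = - (t ^- 2 *: f i).
Proof.
move=> t0; rewrite Adn_split Adx_e Ady_e !AdE Adx_e Adx_h Adx_f dotii.
(* An identity between linear combinations of fixed matrices is checked on each entry, where it is
   an identity of rational functions of [t]. *)
by apply/matrixP=> k l; rewrite !mxE; field.
Qed.

Lemma Adn_f i t : t != 0 -> Ad (nn i t) (f i) = - (t ^+ 2 *: e i).
Proof.
move=> t0; rewrite Adn_split Adx_f !AdE Ady_e Ady_h Ady_f !AdE Adx_e Adx_h Adx_f dotii.
by apply/matrixP=> k l; rewrite !mxE; field.
Qed.

Lemma Adn_h i j t : t != 0 -> Ad (nn i t) (h j) = h j - (dot j i)%:~R *: h i.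
Proof.
move=> t0; rewrite Adn_split Adx_h !AdE Ady_e Ady_h !AdE Adx_e !Adx_h Adx_f dotii.
by apply/matrixP=> k l; rewrite !mxE; field.
Qed.

Lemma dot0_neq i j : dot i j = 0 -> i <> j.
Proof. by move=> d ij; move: d; rewrite ij dotii. Qed.
Lemma dotN1_neq i j : dot i j = -1 -> i <> j.
Proof. by move=> d ij; move: d; rewrite ij dotii. Qed.

Lemma Adn_e0 i j t : dot i j = 0 -> Ad (nn i t) (e j) = e j.
Proof. by move=> d; rewrite Adn_split Adx_e0 // Ady_ej ?Adx_e0 //; exact: dot0_neq. Qed.
Lemma Adn_f0 i j t : dot i j = 0 -> Ad (nn i t) (f j) = f j.
Proof. by move=> d; have ne := dot0_neq d; rewrite Adn_split Adx_fj // Ady_f0 // Adx_fj. Qed.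

Lemma Adn_eN1 i j t : t != 0 -> dot i j = -1 -> Ad (nn i t) (e j) = t *: lie (e i) (e j).
Proof.
move=> t0 d; have ne := dotN1_neq d; rewrite Adn_split.
move: (Adx_eN1 G t d) (Ady_eij (- t^-1) d) (Adx_eij G t d) (Ady_ej (- t^-1) ne).
move: (lie _ _) => E h1 h2 h3 h4; rewrite h1 !AdE h2 h4 !AdE h1 h3.
by apply/matrixP=> k l; rewrite !mxE; field.
Qed.
Lemma Adn_eij i j t : t != 0 -> dot i j = -1 -> Ad (nn i t) (lie (e i) (e j)) = - (t^-1 *: e j).
Proof.
move=> t0 d; have ne := dotN1_neq d; rewrite Adn_split.
move: (Adx_eN1 G t d) (Ady_eij (- t^-1) d) (Adx_eij G t d) (Ady_ej (- t^-1) ne).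
move: (lie _ _) => E h1 h2 h3 h4; rewrite h3 h2 !AdE h1 h3.
by apply/matrixP=> k l; rewrite !mxE; field.
Qed.
Lemma Adn_fN1 i j t : t != 0 -> dot i j = -1 -> Ad (nn i t) (f j) = - (t^-1 *: lie (f i) (f j)).
Proof.
move=> t0 d; have ne := dotN1_neq d; rewrite Adn_split.
move: (Ady_fN1 (- t^-1) d) (Adx_fij G t d) (Ady_fij (- t^-1) d) (Adx_fj G t ne).
move: (lie _ _) => E h1 h2 h3 h4; rewrite h4 h1 !AdE h2 h4.
by apply/matrixP=> k l; rewrite !mxE; field.
Qed.
Lemma Adn_fij i j t : t != 0 -> dot i j = -1 -> Ad (nn i t) (lie (f i) (f j)) = t *: f j.
Proof.
move=> t0 d; have ne := dotN1_neq d; rewrite Adn_split.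
move: (Ady_fN1 (- t^-1) d) (Adx_fij G t d) (Ady_fij (- t^-1) d) (Adx_fj G t ne).
move: (lie _ _) => E h1 h2 h3 h4; rewrite h2 !AdE h3 h1 !AdE h2 h4.
by apply/matrixP=> k l; rewrite !mxE; field.
Qed.

Lemma n_x i t u : t != 0 -> Ad (nn i t) (x i u) = y i (- (u / t ^+ 2)).
Proof.
move=> t0; rewrite Ad_xroot ?n_unit // Adn_e // /yroot; congr mxexp_nilp.
by rewrite scalerN scalerA scaleNr.
Qed.
Lemma n_y i t u : t != 0 -> Ad (nn i t) (y i u) = x i (- (u * t ^+ 2)).
Proof.
move=> t0; rewrite Ad_yroot ?n_unit // Adn_f // /xroot; congr mxexp_nilp.
by rewrite scalerN scalerA scaleNr.
Qed.

Lemma nrootV i t : (nn i t)^-1 = nn i (- t).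
Proof.
rewrite /nroot !invrM ?unitrMr ?x_unit ?y_unit //.
by rewrite !xrootV yrootV invrN opprK mulrA.
Qed.

(** Conjugation by [n_i(t)] carries [x_i(t)] to [y_i(- t^-1)], which trades the form x y x of
    [n_i(t)] for the form y x y. The latter is the definition of n in the opposite pinned group. *)
Lemma n_alt i t : t != 0 -> nn i t = y i (- t^-1) * x i t * y i (- t^-1).
Proof.
move=> t0; have h2 : nn i t * x i t = y i (- t^-1) * nn i t.
  by rewrite (Ad_mul _ (n_unit i t)) n_x //; congr (y i _ * _); field.
apply: (mulIr (x_unit G i t)); rewrite h2 /nroot -!mulrA; congr (_ * _).
Qed.

End RankOne.

(* [fingroup] has a [generated_group] of its own. *)
Local Notation generated_group := Defs.generated_group.

Section GeneratedGroup.
Local Open Scope classical_set_scope.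
Variables (A : unitRingType).
Implicit Types (S T : set A).

Lemma gen_unit S : (forall x, S x -> x \is a GRing.unit) ->
  forall x, generated_group S x -> x \is a GRing.unit.
Proof.
move=> h x; elim=> {x} [x /h //||x y _ ux _ uy|x _ ux].
- exact: unitr1.
- by rewrite unitrMr.
- by rewrite unitrV.
Qed.

Lemma gen_sub S T : S `<=` generated_group T -> generated_group S `<=` generated_group T.
Proof.
move=> h x; elim=> {x} [x /h //||x y _ ux _ uy|x _ ux].
- exact: GenOne.
- exact: GenMul.
- exact: GenInv.
Qed.

End GeneratedGroup.

Section GeneratedConj.
Local Open Scope classical_set_scope.
Variables (R : realType) (n : nat).
Local Notation M := 'M[R]_n.+1.

Lemma gen_Ad (S T : set M) (g : M) : g \is a GRing.unit ->
  (forall x, S x -> x \is a GRing.unit) ->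
  (forall x, S x -> generated_group T (Ad g x)) ->
  forall x, generated_group S x -> generated_group T (Ad g x).
Proof.
move=> ug uS h x; elim=> {x} [x /h //||x y _ ux _ uy|x Sx ux].
- by rewrite Ad1 //; exact: GenOne.
- by rewrite AdM //; exact: GenMul.
- have u := gen_unit uS Sx.
  suff -> : Ad g x^-1 = (Ad g x)^-1 by apply: GenInv.
  apply: (mulIr (Ad_unit ug u)).
  by rewrite mulVr ?Ad_unit // -AdM // mulVr // Ad1.
Qed.

End GeneratedConj.

(** * The maximal torus and its weights *)

Section Torus.
Local Open Scope classical_set_scope.
Variables (R : realType) (W : simply_laced_weyl) (G : pinned_group R W).
Local Notation I := (slw_index W).
Local Notation M := 'M[R]_((pg_dim G).+1).
Local Notation e := (pg_e G).
Local Notation f := (pg_f G).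
Local Notation h := (pg_h G).
Local Notation x := (xroot G).
Local Notation y := (yroot G).
Local Notation nn := (nroot G).
Implicit Types (i j : I) (t u : R) (X Y Z : M).

Definition torus : set M := generated_group (@torus_gens R W G).
Definition Uplus : set M := generated_group [set g | exists i t, g = x i t].
Definition Uminus : set M := generated_group [set g | exists i t, g = y i t].
Definition SL2 i : set M := generated_group [set g | exists t, g = x i t \/ g = y i t].

Lemma coroot_unit i t : coroot G i t \is a GRing.unit.
Proof. by rewrite /coroot unitrMr ?n_unit. Qed.

Lemma torus_unit g : torus g -> g \is a GRing.unit.
Proof. by apply: gen_unit => _ [i [t [_ ->]]]; apply: coroot_unit. Qed.
Lemma Uminus_unit g : Uminus g -> g \is a GRing.unit.
Proof. by apply: gen_unit => _ [i [t ->]]; apply: y_unit. Qed.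
Lemma SL2_unit i g : SL2 i g -> g \is a GRing.unit.
Proof. by apply: gen_unit => _ [t [->|->]]; [apply: x_unit|apply: y_unit]. Qed.
Lemma Bplus_unit g : @Bplus R W G g -> g \is a GRing.unit.
Proof.
by apply: gen_unit => _ [[i [t [_ ->]]]|[i [t ->]]]; [apply: coroot_unit|apply: x_unit].
Qed.
Lemma Bminus_unit g : @Bminus R W G g -> g \is a GRing.unit.
Proof.
by apply: gen_unit => _ [[i [t [_ ->]]]|[i [t ->]]]; [apply: coroot_unit|apply: y_unit].
Qed.

Lemma torus_coroot i t : t != 0 -> torus (coroot G i t).
Proof. by move=> t0; apply: GenIn; exists i, t. Qed.
Lemma Uplus_x i t : Uplus (x i t). Proof. by apply: GenIn; exists i, t. Qed.
Lemma Uminus_y i t : Uminus (y i t). Proof. by apply: GenIn; exists i, t. Qed.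
Lemma SL2_x i t : SL2 i (x i t). Proof. by apply: GenIn; exists t; left. Qed.
Lemma SL2_y i t : SL2 i (y i t). Proof. by apply: GenIn; exists t; right. Qed.
Lemma SL2_n i t : SL2 i (nn i t).
Proof. by do 2?apply: GenMul; rewrite ?SL2_x ?SL2_y //; [apply: SL2_x|apply: SL2_y|apply: SL2_x]. Qed.
Lemma torus_Bplus g : torus g -> @Bplus R W G g.
Proof. by apply: gen_sub => z hz; apply: GenIn; left. Qed.
Lemma torus_Bminus g : torus g -> @Bminus R W G g.
Proof. by apply: gen_sub => z hz; apply: GenIn; left. Qed.
Lemma Uplus_Bplus g : Uplus g -> @Bplus R W G g.
Proof. by apply: gen_sub => z hz; apply: GenIn; right. Qed.
Lemma Uminus_Bminus g : Uminus g -> @Bminus R W G g.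
Proof. by apply: gen_sub => z hz; apply: GenIn; right. Qed.

Lemma nroot_mul_torus i t u : t != 0 -> u != 0 -> torus (nn i t * nn i u).
Proof.
move=> t0 u0; have -> : nn i t * nn i u = coroot G i t * (coroot G i (- u))^-1.
   by rewrite /coroot invrM ?n_unit // [(nn i (- u))^-1]nrootV opprK [RHS]mulrA mulrK ?n_unit.
by apply: GenMul; last apply: GenInv; apply: torus_coroot; rewrite ?oppr_eq0.
Qed.

(** Here [chi i] is the value at [g] of the i-th simple root. *)
Definition weight_of (g : M) (chi : I -> R) := forall i,
  [/\ chi i != 0, Ad g (e i) = chi i *: e i, Ad g (f i) = (chi i)^-1 *: f i &
      Ad g (h i) = h i].

Lemma coroot_weight i t : t != 0 -> weight_of (coroot G i t) (fun j => t ^ (dot i j)).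
Proof.
move=> t0 j; have n1 : (-1 : R) != 0 by rewrite oppr_eq0 oner_eq0.
rewrite /coroot !(@Ad_comp _ _ (nn i t)) ?n_unit //; split.
- by rewrite expfz_neq0.
- case: (dot_cases i j) => [[<- d]|[_ d]|[_ d]]; rewrite d.
  + rewrite Adn_e // AdN AdZ Adn_f // -exprnP; apply/matrixP=> k l; rewrite !mxE.
    by field.
  + by rewrite !Adn_e0 // expr0z scale1r.
  + rewrite Adn_eN1 // AdZ Adn_eij // scaleN1r opprK.
    by rewrite exprN1.
- case: (dot_cases i j) => [[<- d]|[_ d]|[_ d]]; rewrite d.
  + rewrite Adn_f // AdN AdZ Adn_e // -exprnP; apply/matrixP=> k l; rewrite !mxE.
    by field.
  + by rewrite !Adn_f0 // expr0z invr1 scale1r.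
  + rewrite Adn_fN1 // AdN AdZ Adn_fij // exprN1 invrK invrN1 scaleN1r opprK //.
- rewrite Adn_h // AdB AdZ !Adn_h // dotii; apply/matrixP=> k l; rewrite !mxE.
  by rewrite (_ : 2%:~R = 2%:R) //; ring.
Qed.

Lemma torus_weight g : torus g -> exists chi, weight_of g chi.
Proof.
elim=> {g} [g [i [t [t0 ->]]]||g g' hg [c wc] hg' [c' wc']|g hg [c wc]].
- by exists (fun j => t ^ (dot i j)); apply: coroot_weight.
- exists (fun _ => 1) => i; rewrite !Ad_id invr1 !scale1r; split=> //.
  exact: oner_neq0.
- have ug := torus_unit hg; have ug' := torus_unit hg'.
  exists (fun i => c i * c' i) => i; have [c0 ce cf ch] := wc i.
  have [c0' ce' cf' ch'] := wc' i; rewrite !Ad_comp // ce' cf' ch' !AdZ ce cf ch.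
  by rewrite !scalerA mulrC invfM mulf_neq0 //; split=> //; rewrite mulrC.
- have ug := torus_unit hg; exists (fun i => (c i)^-1) => i.
  have [c0 ce cf ch] := wc i; rewrite invr_eq0 c0 invrK; split=> //.
  + by rewrite -[in LHS](scale1r (e i)) -(mulVf c0) -scalerA -ce AdZ AdVK.
  + by rewrite -[in LHS](scale1r (f i)) -(mulfV c0) -scalerA -cf AdZ AdVK.
  + by rewrite -{1}ch AdVK.
Qed.

Lemma torus_x g chi i t : torus g -> weight_of g chi -> Ad g (x i t) = x i (chi i * t).
Proof.
move=> hg /(_ i) [_ ce _ _]; rewrite Ad_xroot ?torus_unit // ce scalerA mulrC //.
Qed.
Lemma torus_y g chi i t : torus g -> weight_of g chi -> Ad g (y i t) = y i (t / chi i).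
Proof.
by move=> hg /(_ i) [_ _ cf _]; rewrite Ad_yroot ?torus_unit // cf scalerA.
Qed.
Lemma torus_n g chi i t : torus g -> weight_of g chi -> t != 0 ->
  Ad g (nn i t) = nn i (chi i * t).
Proof.
move=> hg wg t0; have [c0 _ _ _] := wg i.
rewrite /nroot !AdM ?torus_unit // !(torus_x _ _ hg wg) (torus_y _ _ hg wg).
by congr (_ * y i _ * _); field; rewrite t0 c0.
Qed.

(** Commuting [g] past [n_i(-t)] only rescales the argument, so the conjugate is a product of two
    elements n_i( ) and of [g]; the product of the two lies in the torus. *)
Lemma torus_norm_n i t g : t != 0 -> torus g -> torus (Ad (nn i t) g).
Proof.
move=> t0 hg; have [chi wg] := torus_weight hg; have ug := torus_unit hg.
have [c0 _ _ _] := wg i.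
have -> : Ad (nn i t) g = nn i t * Ad g (nn i (- t)) * g.
  by rewrite /Ad nrootV !mulrA mulrVK.
apply: GenMul => //; rewrite (torus_n _ hg wg) ?oppr_eq0 //.
by apply: nroot_mul_torus => //; rewrite mulf_neq0 // oppr_eq0.
Qed.

(** Gauss factorisation in SL2. Writing [y_i(u)] as x n x lets its left factor merge with [x_i(t)]
    into [x_i(v)], where v = t + u^-1; writing [x_i(v)] as y n y then brings the two n together, and
    their product is the torus element. *)
Lemma xy_torus i t u : 1 + t * u != 0 -> exists2 g, torus g &
  x i t * y i u = y i (u / (1 + t * u)) * g * x i (t / (1 + t * u)).
Proof.
move=> d0; case: (eqVneq u 0) => [->|u0].
  exists 1; first exact: GenOne.
  by rewrite mul0r mulr0 addr0 divr1 !yroot0 !mul1r mulr1.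
set v := t + u^-1; have ev : 1 + t * u = v * u by rewrite /v; field.
have v0 : v != 0 by apply: contraNneq d0 => v0; rewrite ev v0 mul0r.
have ey : y i u = x i u^-1 * nn i (- u^-1) * x i u^-1.
  by rewrite /nroot invrN invrK opprK !mulrA xrootKN mul1r -mulrA xrootNK mulr1.
have ex : x i v = y i v^-1 * nn i v * y i v^-1.
  by rewrite n_alt // !mulrA yrootKN mul1r -mulrA yrootNK mulr1.
have un0 : - u^-1 != 0 by rewrite oppr_eq0 invr_eq0.
exists (nn i v * nn i (- u^-1)); first exact: nroot_mul_torus.
have yn : y i v^-1 * nn i (- u^-1) = nn i (- u^-1) * x i (- (v^-1 / u ^+ 2)).
  rewrite [RHS](Ad_mul _ (n_unit G i _)) n_x //; congr (y i _ * _).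
  by field; rewrite u0 v0.
have -> : u / (1 + t * u) = v^-1 by rewrite ev; field; rewrite u0 v0.
have -> : t / (1 + t * u) = - (v^-1 / u ^+ 2) + u^-1.
  have et : t = v - u^-1 by rewrite /v addrK.
  by rewrite ev [in LHS]et; field; rewrite u0 v0.
have -> : x i t * y i u = x i v * nn i (- u^-1) * x i u^-1 by rewrite ey /v xrootD !mulrA.
rewrite ex xrootD; move: (nn i v) (nn i (- u^-1)) yn => N N' yn.
by rewrite !mulrA; congr (_ * _); rewrite -[LHS]mulrA yn !mulrA.
Qed.

End Torus.

(** * Rank two: the root alpha_i + alpha_j and the braid relation *)

Section RankTwo.
Local Open Scope classical_set_scope.
Variables (R : realType) (W : simply_laced_weyl) (G : pinned_group R W).
Local Notation I := (slw_index W).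
Local Notation M := 'M[R]_((pg_dim G).+1).
Local Notation e := (pg_e G).
Local Notation h := (pg_h G).
Local Notation x := (xroot G).
Local Notation torus := (@torus R W G).
Local Notation Uplus := (@Uplus R W G).
Implicit Types (i j : I) (t : R).

Definition eij i j : M := lie (e i) (e j).
Definition xroot2 i j t : M := mxexp_nilp (t *: eij i j).

Lemma eij_nilp i j : dot i j = -1 -> nilpmx (eij i j).
Proof.
move=> d; apply: (@adh_nilp _ _ (h i) _ 1); first exact: oner_neq0.
rewrite /eij lie_jacobi !pg_he d dotii mulrN1z lieNr scale1r.
by rewrite -scaler_int lieZl (_ : 2%:~R = 1 + 1 :> R) // scalerDl scale1r addrK.
Qed.

Lemma comm_e_eij i j : dot i j = -1 -> GRing.comm (e j) (eij i j).
Proof.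
move=> d; have := @lie_ei_eij _ _ G j i; rewrite dotC => /(_ d) /eqP.
rewrite [lie (e j) (e i)]lieC lieNr oppr_eq0 /lie subr_eq0 => /eqP //.
Qed.

Lemma exp_span i j a b : dot i j = -1 ->
  mxexp_nilp (a *: e j + b *: eij i j) = x j a * xroot2 i j b.
Proof.
move=> d; rewrite mxexpD //; last by apply/nilpZ/eij_nilp.
  by rewrite /GRing.comm -!scalerAl -!scalerAr (comm_e_eij d) !scalerA mulrC.
by apply/nilpZ/e_nilp.
Qed.

Lemma x_swap i j a b : dot i j = -1 ->
  x i a * x j b = x j b * xroot2 i j (a * b) * x i a.
Proof.
move=> d; rewrite (Ad_mul _ (x_unit G i a)) Ad_xroot ?x_unit // Adx_eN1 //.
by rewrite scalerDr scalerA exp_span // [b * a]mulrC.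
Qed.

Lemma xroot2_gen i j t : dot i j = -1 ->
  xroot2 i j t = x j (- t) * x i 1 * x j t * x i (- 1).
Proof.
move=> d; apply: (mulrI (x_unit G j t)); apply: (mulIr (x_unit G i 1)).
rewrite !mulrA xrootKN mul1r -[RHS]mulrA xrootNK mulr1 x_swap // mul1r //.
Qed.

(** By [x_swap] both sides take the form x_j, root subgroup of alpha_i + alpha_j, x_i, with equal
    parameters. *)
Lemma x_braid i j a b c a' b' c' : dot i j = -1 -> b' != 0 ->
  a * b = b' * c' -> a' * b' = b * c -> b' = a + c ->
  x i a * x j b * x i c = x j a' * x i b' * x j c'.
Proof.
move=> d b0 h1 h2 h3; rewrite x_swap // -mulrA -xrootD -h3.
rewrite -[RHS]mulrA x_swap // !mulrA -xrootD -h1.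
suff -> : a' + c' = b by [].
by apply: (mulfI b0); rewrite mulrDr -h1 mulrC h2 h3; ring.
Qed.

Lemma Uplus_span i j a b : i <> j ->
  Uplus (mxexp_nilp (a *: e j + b *: eij i j)).
Proof.
case: (dot_cases i j) => [[]//|[_ d]|[_ d]] _.
  by rewrite /eij lie_ei_ej // scaler0 addr0; apply: Uplus_x.
rewrite exp_span // xroot2_gen //.
apply: GenMul; first exact: Uplus_x.
by do 3!(apply: GenMul; last exact: Uplus_x); apply: Uplus_x.
Qed.

Lemma torus_Uplus g u : torus g -> Uplus u -> Uplus (Ad g u).
Proof.
move=> hg; apply: gen_Ad => [|_ [i [t ->]]|_ [i [t ->]]]; first exact: torus_unit.
  exact: x_unit.
by have [chi wg] := torus_weight hg; rewrite (torus_x _ _ hg wg); apply: Uplus_x.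
Qed.

End RankTwo.

(** * Minimal parabolic subgroups and the factorisation of the Borel subgroup *)

Section Levi.
Local Open Scope classical_set_scope.
Variables (R : realType) (W : simply_laced_weyl) (G : pinned_group R W).
Local Notation I := (slw_index W).
Local Notation M := 'M[R]_((pg_dim G).+1).
Local Notation f := (pg_f G).
Local Notation x := (xroot G).
Local Notation y := (yroot G).
Local Notation Bminus := (@Bminus R W G).
Local Notation torus := (@torus R W G).
Local Notation Uminus := (@Uminus R W G).
Local Notation SL2 := (@SL2 R W G).
Implicit Types (i j : I) (t : R).

Lemma Uminus_span i j a b : i <> j ->
  Uminus (mxexp_nilp (a *: f j + b *: lie (f i) (f j))).
Proof. exact: (@Uplus_span _ _ (op G)). Qed.

Definition span_stable i j (k : M) := forall a b, exists a' b',
  Ad k (a *: f j + b *: lie (f i) (f j)) = a' *: f j + b' *: lie (f i) (f j).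

(** The span of [f_j] and [[f_i, f_j]] is the module generated by [f_j] under the i-th SL2.
    Stability under the inverse is carried through the induction because the generated group is
    closed under inverses. *)
Lemma SL2_span i j k : i <> j -> SL2 i k -> span_stable i j k.
Proof.
move=> ne; suff h : SL2 i k -> span_stable i j k /\ span_stable i j k^-1.
  by move=> /h [].
have hx t : span_stable i j (x i t).
  move=> a b; case: (dot_cases i j) => [[]//|[_ d]|[_ d]].
    have -> : lie (f i) (f j) = 0 by exact: (@lie_ei_ej _ _ (op G)).
    by exists a, 0; rewrite !scaler0 !addr0 AdZ Adx_fj.
  exists (a + b * t), b; rewrite AdD !AdZ Adx_fj // Adx_fij //.
  by rewrite scalerDr scalerA scalerDl addrA addrAC.
have hy t : span_stable i j (y i t).
  move=> a b; case: (dot_cases i j) => [[]//|[_ d]|[_ d]].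
    have -> : lie (f i) (f j) = 0 by exact: (@lie_ei_ej _ _ (op G)).
    by exists a, 0; rewrite !scaler0 !addr0 AdZ Ady_f0.
  exists a, (a * t + b); rewrite AdD !AdZ Ady_fN1 // Ady_fij //.
  by rewrite scalerDr scalerA [in RHS]scalerDl addrA.
elim=> {k} [_ [t [->|->]]||k k' hk [h1 h2] hk' [h1' h2']|k hk [h1 h2]].
- by rewrite xrootV.
- by rewrite yrootV.
- by rewrite invr1; split=> a b; exists a, b; rewrite Ad_id.
- have uk := SL2_unit hk; have uk' := SL2_unit hk'.
  rewrite invrM //; split=> a b.
    have [a1 [b1 e1]] := h1' a b; have [a2 [b2 e2]] := h1 a1 b1.
    by exists a2, b2; rewrite Ad_comp // e1 e2.
  have [a1 [b1 e1]] := h2 a b; have [a2 [b2 e2]] := h2' a1 b1.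
  by exists a2, b2; rewrite Ad_comp ?unitrV // e1 e2.
- by rewrite invrK.
Qed.

(* The unipotent radical of the i-th minimal parabolic subgroup of [Bminus]. *)
Definition Unip i : set M := [set z | Uminus z /\ forall k, SL2 i k -> Uminus (Ad k z)].

Lemma Unip_y i j t : i <> j -> Unip i (y j t).
Proof.
move=> ne; split; first exact: Uminus_y.
move=> k hk; rewrite Ad_yroot ?(SL2_unit hk) //.
have [a [b ab]] := SL2_span ne hk 1 0.
move: ab; rewrite scale0r addr0 scale1r => ->.
by rewrite scalerDr !scalerA; apply: Uminus_span.
Qed.

Lemma Unip1 i : Unip i 1.
Proof.
split=> [|k hk]; first exact: GenOne.
by rewrite Ad1 ?(SL2_unit hk) //; exact: GenOne.
Qed.

Lemma UnipM i z z' : Unip i z -> Unip i z' -> Unip i (z * z').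
Proof.
move=> [u h] [u' h']; split; first exact: GenMul.
by move=> k hk; rewrite AdM ?(SL2_unit hk) //; apply: GenMul; [apply: h|apply: h'].
Qed.

Lemma AdV (g z : M) : g \is a GRing.unit -> z \is a GRing.unit -> Ad g z^-1 = (Ad g z)^-1.
Proof.
move=> ug u; apply: (mulIr (Ad_unit ug u)).
by rewrite mulVr ?Ad_unit // -AdM // mulVr // Ad1.
Qed.

Lemma UnipV i z : Unip i z -> Unip i z^-1.
Proof.
move=> [u h]; split; first exact: GenInv.
move=> k hk; rewrite AdV ?(SL2_unit hk) ?(Uminus_unit u) //.
by apply: GenInv; apply: h.
Qed.

Lemma Unip_SL2 i k z : SL2 i k -> Unip i z -> Unip i (Ad k z).
Proof.
move=> hk [u h]; split; first exact: h.
move=> k' hk'; rewrite -Ad_comp ?(SL2_unit hk) ?(SL2_unit hk') //.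
by apply: h; apply: GenMul.
Qed.

Lemma torus_Uminus g u : torus g -> Uminus u -> Uminus (Ad g u).
Proof.
move=> hg; apply: gen_Ad => [|_ [i [t ->]]|_ [i [t ->]]]; first exact: torus_unit.
  exact: y_unit.
by have [chi wg] := torus_weight hg; rewrite (torus_y _ _ hg wg); apply: Uminus_y.
Qed.

Lemma torus_SL2 i g k : torus g -> SL2 i k -> SL2 i (Ad g k).
Proof.
move=> hg; apply: gen_Ad => [|_ [t [->|->]]|_ [t [->|->]]]; first exact: torus_unit.
- exact: x_unit.
- exact: y_unit.
- by have [chi wg] := torus_weight hg; rewrite (torus_x _ _ hg wg); apply: SL2_x.
- by have [chi wg] := torus_weight hg; rewrite (torus_y _ _ hg wg); apply: SL2_y.
Qed.

Lemma torus_Unip i g z : torus g -> Unip i z -> Unip i (Ad g z).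
Proof.
move=> hg [u h]; split; first exact: torus_Uminus.
move=> k hk; have ug := torus_unit hg; have uk := SL2_unit hk.
have -> : Ad k (Ad g z) = Ad g (Ad (Ad g^-1 k) z).
  rewrite -!Ad_comp ?Ad_unit ?unitrV //; congr (Ad _ z).
  by rewrite /Ad invrK !mulrA mulrV // mul1r.
apply: torus_Uminus => //; apply: h; apply: torus_SL2 => //; exact: GenInv.
Qed.

(** The products of this shape contain the generators and are closed under multiplication and
    inversion, since the torus and the i-th SL2 normalise [Unip i]. *)
Lemma Bminus_decomp i b : Bminus b ->
  exists g s z, [/\ torus g, Unip i z & b = g * y i s * z].
Proof.
pose P (b : M) := exists g s z, [/\ torus g, Unip i z & b = g * y i s * z].
have PT g : torus g -> P g.
  by move=> hg; exists g, 0, 1; rewrite yroot0 !mulr1; split=> //; exact: Unip1.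
have PY s : P (y i s).
  by exists 1, s, 1; rewrite mulr1 mul1r; split=> //; [exact: GenOne|exact: Unip1].
have PZ z : Unip i z -> P z.
  by move=> hz; exists 1, 0, z; rewrite yroot0 !mul1r; split=> //; exact: GenOne.
have PM b1 b2 : P b1 -> P b2 -> P (b1 * b2).
  move=> [g [s [z [hg hz ->]]]] [g' [s' [z' [hg' hz' ->]]]].
  have hV := GenInv hg'; have [chi wV] := torus_weight hV.
  have ug' := torus_unit hg'.
  exists (g * g'), (s / chi i + s'), (Ad (y i (- s')) (Ad g'^-1 z) * z'); split.
  - exact: GenMul.
  - by apply: UnipM => //; apply: Unip_SL2; [apply: SL2_y|apply: torus_Unip].
  rewrite yrootD -(torus_y _ _ hV wV) /Ad invrK -yrootV invrK.
  move: (y i s) (y i s') (y_unit G i s') => Y Y' uY'.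
  by rewrite !mulrA !mulrK.
have PI b1 : P b1 -> P b1^-1.
  move=> [g [s [z [hg hz ->]]]].
  have ug := torus_unit hg; have uz := Uminus_unit (proj1 hz).
  rewrite !invrM ?unitrMr ?y_unit // yrootV.
  apply: (PM); first exact/PZ/UnipV. by apply: (PM); [apply: PY|apply/PT/GenInv].
elim=> {b} [b [[j [t [t0 ->]]]|[j [t ->]]]||b1 b2 _ h1 _ h2|b1 _ h1].
- by apply: PT; apply: torus_coroot.
- by case: (eqVneq i j) => [<-|/eqP ne]; [apply: PY|apply/PZ/Unip_y].
- by apply: PT; exact: GenOne.
- exact: PM.
- exact: PI.
Qed.

Lemma Bminus_TU i b : Bminus b -> exists g u, [/\ torus g, Uminus u & b = g * u].
Proof.
move=> /(@Bminus_decomp i) [g [s [z [hg [hz _] ->]]]].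
exists g, (y i s * z); rewrite mulrA; split=> //.
by apply: GenMul => //; apply: Uminus_y.
Qed.

End Levi.

(** * Lifts of Weyl group elements to the normaliser of the torus *)

Section WeylLift.
Local Open Scope classical_set_scope.
Variables (R : realType) (W : simply_laced_weyl) (G : pinned_group R W).
Local Notation I := (slw_index W).
Local Notation s := (@slw_refl W).
Local Notation len := (@wlength W).
Local Notation wp := (word_prod s).
Local Notation M := 'M[R]_((pg_dim G).+1).
Local Notation e := (pg_e G).
Local Notation f := (pg_f G).
Local Notation y := (yroot G).
Local Notation nn := (nroot G).
Local Notation torus := (@torus R W G).
Local Notation Uminus := (@Uminus R W G).
Implicit Types (i j : I) (t : R).

Definition weyl_lift (c : seq I) : M := \prod_(i <- c) nn i 1.

Lemma weyl_lift_nil : weyl_lift [::] = 1. Proof. by rewrite /weyl_lift big_nil. Qed.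
Lemma weyl_lift_cons i c : weyl_lift (i :: c) = nn i 1 * weyl_lift c. Proof. by rewrite /weyl_lift big_cons. Qed.
Lemma weyl_lift_cat c d : weyl_lift (c ++ d) = weyl_lift c * weyl_lift d. Proof. by rewrite /weyl_lift big_cat. Qed.
Lemma weyl_lift_rcons c j : weyl_lift (rcons c j) = weyl_lift c * nn j 1.
Proof. by rewrite -cats1 weyl_lift_cat weyl_lift_cons weyl_lift_nil mulr1. Qed.

Lemma weyl_lift_unit c : weyl_lift c \is a GRing.unit.
Proof.
elim: c => [|i c IH]; first by rewrite weyl_lift_nil unitr1.
by rewrite weyl_lift_cons unitrMr ?n_unit.
Qed.

Lemma torus_weyl_lift c g : torus g -> torus (Ad (weyl_lift c) g).
Proof.
elim: c => [|i c IH] hg; first by rewrite weyl_lift_nil Ad_id.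
rewrite weyl_lift_cons (@Ad_comp _ _ (nn i 1)) ?n_unit ?weyl_lift_unit //.
by apply: torus_norm_n; [exact: oner_neq0|exact: IH].
Qed.

Lemma Ad_nn g i j t : g \is a GRing.unit -> Ad g (e i) = e j -> Ad g (f i) = f j ->
  Ad g (nn i t) = nn j t.
Proof.
by move=> ug he hf; rewrite /nroot !AdM // !Ad_xroot // Ad_yroot // he hf.
Qed.

(** The product [n_i n_j] carries [e_i, f_i] to [e_j, f_j], hence
    [(n_i n_j) n_i = n_j (n_i n_j)]. *)
Lemma n_braid i j : dot i j = -1 ->
  nn i 1 * nn j 1 * nn i 1 = nn j 1 * nn i 1 * nn j 1.
Proof.
move=> d; have d' := d; rewrite dotC in d'; have r1 := oner_neq0 R.
have u1 := n_unit G i 1; have u2 := n_unit G j 1.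
have u3 : nn i 1 * nn j 1 \is a GRing.unit by rewrite unitrMr.
have he : Ad (nn i 1 * nn j 1) (e i) = e j.
  rewrite (@Ad_comp _ _ (nn i 1)) // Adn_eN1 // scale1r lieC AdN Adn_eij //.
  by rewrite opprK invr1 scale1r.
have hf : Ad (nn i 1 * nn j 1) (f i) = f j.
  rewrite (@Ad_comp _ _ (nn i 1)) // Adn_fN1 // invr1 scale1r lieC opprK.
  by rewrite Adn_fij // scale1r.
by rewrite [LHS](Ad_mul _ u3) (Ad_nn 1 u3 he hf) [LHS]mulrA.
Qed.

Lemma n_comm i j : dot i j = 0 -> nn i 1 * nn j 1 = nn j 1 * nn i 1.
Proof.
move=> d; rewrite [LHS](Ad_mul _ (n_unit G i 1)) (@Ad_nn _ j j) ?n_unit //.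
  exact: Adn_e0.
exact: Adn_f0.
Qed.

(** The braid and commutation relations hold exactly for the lifts, but the square of n_i(1) is only
    known to lie in the torus. Lifts of words with the same product therefore agree up to the torus,
    which all lifts normalise. *)
Lemma weyl_lift_cong c d : word_cong (coxeter_rel s) c d -> torus (weyl_lift c * (weyl_lift d)^-1).
Proof.
elim=> {c d} [c0 d0 []|c|c d _ h1|c d b _ h1 _ h2|c c' d d' _ h1 _ h2].
- move=> i; rewrite weyl_lift_cons weyl_lift_cons weyl_lift_nil invr1 !mulr1.
  by apply: nroot_mul_torus; exact: oner_neq0.
- move=> i j d; rewrite !weyl_lift_cons weyl_lift_nil !mulr1 n_comm // mulrV; first exact: GenOne.
  by rewrite unitrMr ?n_unit.
- move=> i j d; rewrite !weyl_lift_cons weyl_lift_nil !mulr1 [nn i 1 * (_ * _)]mulrA.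
  rewrite [nn j 1 * (_ * _)]mulrA n_braid // mulrV; first exact: GenOne.
  by rewrite unitrMr ?n_unit // unitrMr ?n_unit.
- by rewrite mulrV ?weyl_lift_unit //; exact: GenOne.
- by have := GenInv h1; rewrite invrM ?unitrV ?weyl_lift_unit // invrK.
- by have := GenMul h1 h2; rewrite mulrA mulrVK ?weyl_lift_unit.
- rewrite !weyl_lift_cat invrM ?weyl_lift_unit //.
  have := GenMul (torus_weyl_lift c h2) h1; rewrite /Ad !mulrA.
  by rewrite -(mulrA _ (weyl_lift c)^-1) mulVr ?weyl_lift_unit // mulr1.
Qed.

Lemma weyl_lift_wp c d : wp c = wp d -> exists2 g, torus g & weyl_lift c = g * weyl_lift d.
Proof.
move=> /slw_complete /weyl_lift_cong hg; exists (weyl_lift c * (weyl_lift d)^-1) => //.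
by rewrite mulrVK // weyl_lift_unit.
Qed.

Lemma Ad_weyl_lift_rcons c j X : Ad (weyl_lift (rcons c j)) X = Ad (weyl_lift c) (Ad (nn j 1) X).
Proof. by rewrite weyl_lift_rcons Ad_comp ?weyl_lift_unit ?n_unit. Qed.

Lemma yexp j t : y j t = mxexp_nilp (t *: f j). Proof. by []. Qed.

(** Group version of [asc_nonneg], with the same cases: [n_k] fixes [f_j], or sends it to a bracket
    whose exponential is a product of elements y_j and y_k, or [n_j n_k] sends [f_j] to [f_k]. *)
Lemma weyl_lift_y_asc (w : W) j : (len w < len (w * s j)%g)%N ->
  forall c, wp c = w -> forall t, Uminus (Ad (weyl_lift c) (y j t)).
Proof.
have r1 := oner_neq0 R.
have red c c' t j' : wp c = wp c' ->
    Uminus (Ad (weyl_lift c') (y j' t)) -> Uminus (Ad (weyl_lift c) (y j' t)).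
  move=> /weyl_lift_wp [g hg ->] hu; rewrite Ad_comp ?weyl_lift_unit ?(torus_unit hg) //.
  exact: torus_Uminus.
move: w j; apply: rank2_ind.
- move=> j c c1 t; apply: (red _ [::]); first by rewrite c1 word_prod_nil.
  by rewrite weyl_lift_nil Ad_id; apply: Uminus_y.
- move=> w j k d IH c cw t; have [c0 c0w] := slw_gen w.
  apply: (red _ (rcons c0 k)); first by rewrite cw word_prod_rcons c0w.
  rewrite Ad_weyl_lift_rcons Ad_yroot ?n_unit // Adn_f0 // -yexp; exact: IH.
- move=> w j k d IH1 IH2 c cw t; have [c0 c0w] := slw_gen w.
  apply: (red _ (rcons c0 k)); first by rewrite cw word_prod_rcons c0w.
  rewrite Ad_weyl_lift_rcons Ad_yroot ?n_unit // Adn_fN1 // invr1 scale1r scalerN -scaleNr.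
  have := @xroot2_gen _ _ (op G) k j (- t) d; rewrite /xroot2 /eij /= => ->.
  rewrite !(@AdM _ _ (weyl_lift c0)) ?weyl_lift_unit //.
  apply: GenMul; last exact: (IH2 c0 c0w).
  apply: GenMul; last exact: (IH1 c0 c0w).
  apply: GenMul; last exact: (IH2 c0 c0w).
  exact: (IH1 c0 c0w).
- move=> w j k d IH c cw t; have [c0 c0w] := slw_gen w.
  apply: (red _ (rcons (rcons c0 j) k)); first by rewrite cw !word_prod_rcons c0w.
  rewrite !Ad_weyl_lift_rcons Ad_yroot ?n_unit // Adn_fN1 // invr1 scale1r lieC opprK.
  rewrite Ad_exp ?n_unit // AdZ Adn_fij ?[dot j k]dotC // scale1r -yexp.
  exact: IH.
Qed.

End WeylLift.

(** * Bruhat cells *)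

Section OppositeGroups.
Local Open Scope classical_set_scope.
Variables (R : realType) (W : simply_laced_weyl) (G : pinned_group R W).

Lemma n_op i t : t != 0 -> nroot (op G) i t = nroot G i (- t^-1).
Proof.
move=> t0; rewrite [RHS]n_alt ?oppr_eq0 ?invr_eq0 //.
by rewrite invrN invrK opprK.
Qed.

Lemma torus_op g : @torus R W (op G) g -> @torus R W G g.
Proof.
apply: gen_sub => _ [i [t [t0 ->]]]; rewrite /coroot !n_op ?oppr_eq0 ?oner_neq0 //.
by apply: (@nroot_mul_torus R W G); rewrite ?oppr_eq0 ?invr_eq0 ?oppr_eq0 ?oner_neq0.
Qed.

Lemma Bplus_op g : @Bplus R W (op G) g -> @Bminus R W G g.
Proof.
apply: gen_sub => z [hz|[i [t ->]]].
  by apply: (@torus_Bminus R W G); exact: (torus_op (GenIn hz)).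
by apply: (@Uminus_Bminus R W G); apply: Uminus_y.
Qed.

Lemma weyl_lift_op c : exists2 g, @torus R W G g & weyl_lift (op G) c = g * weyl_lift G c.
Proof.
have r1 := oner_neq0 R.
elim: c => [|i c [g hg IH]].
  by exists 1; rewrite ?weyl_lift_nil ?mulr1 //; exact: GenOne.
exists (nroot G i (-1) * nroot G i (-1) * Ad (nroot G i 1) g).
  by apply: GenMul; [apply: nroot_mul_torus; rewrite oppr_eq0|apply: torus_norm_n].
rewrite !weyl_lift_cons IH n_op // invr1 /Ad nrootV.
have u := n_unit G i (-1); rewrite -[nroot G i 1]invrK nrootV.
by move: (nroot G i (-1)) u => N u; rewrite !mulrA !mulrK.
Qed.

End OppositeGroups.

Section OppositeBorel.
Local Open Scope classical_set_scope.
Variables (R : realType) (W : simply_laced_weyl) (G : pinned_group R W).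
(** [op (op G)] differs from [G] only in carrying - - h for h, which does not enter [Bplus]; the
    statement is thus convertible to an instance of [Bplus_op]. *)
Lemma Bplus_opV g : @Bplus R W G g -> @Bminus R W (op G) g.
Proof. exact: (@Bplus_op R W (op G)). Qed.
End OppositeBorel.

Section WeylLiftPlus.
Local Open Scope classical_set_scope.
Variables (R : realType) (W : simply_laced_weyl) (G : pinned_group R W).
Local Notation I := (slw_index W).
Local Notation s := (@slw_refl W).
Local Notation len := (@wlength W).
Local Notation wp := (word_prod s).
Local Notation M := 'M[R]_((pg_dim G).+1).
Local Notation e := (pg_e G).
Local Notation f := (pg_f G).
Local Notation x := (xroot G).
Local Notation y := (yroot G).
Local Notation nn := (nroot G).
Local Notation weyl_lift := (@weyl_lift R W G).
Local Notation torus := (@torus R W G).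
Local Notation Uminus := (@Uminus R W G).
Local Notation Uplus := (@Uplus R W G).
Local Notation Bminus := (@Bminus R W G).
Local Notation Bplus := (@Bplus R W G).
Local Notation wact := (@wact R W).
Local Notation alpha := (@alpha R W).
Implicit Types (i j : I) (t : R).

Lemma weyl_lift_x_asc (w : W) j : (len w < len (w * s j)%g)%N ->
  forall c, wp c = w -> forall t, Uplus (Ad (weyl_lift c) (x j t)).
Proof.
move=> asc c cw t; have := @weyl_lift_y_asc _ _ (op G) _ _ asc c cw t.
have [g hg ->] := weyl_lift_op G c; have ug := torus_unit hg; have uc := weyl_lift_unit G c.
change (Uplus (Ad (g * weyl_lift c) (x j t)) -> Uplus (Ad (weyl_lift c) (x j t))).
by rewrite Ad_comp // => /(torus_Uplus (GenInv hg)); rewrite AdVK.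
Qed.

Lemma alpha_inj i j : alpha i = alpha j -> i = j.
Proof.
move=> /ffunP/(_ j); rewrite !ffunE eqxx; case: eqP => // _ /esym/eqP.
by rewrite oner_eq0.
Qed.

Lemma nonneg_multiple (u v : {ffun I -> R^o}) i : nonneg u -> nonneg v ->
  u + v = alpha i -> u = u i *: alpha i.
Proof.
move=> hu hv e; apply/ffunP=> k; rewrite !vE; case: (eqVneq i k) => [->|ne].
  by rewrite mulr1.
have := congr1 (fun g : {ffun I -> R^o} => g k) e; rewrite !ffunE (negPf ne) mulr0.
move: (hu k) (hv k); move: (u k : R) (v k : R) => a b ha hb; rewrite /= => ab.
by apply/eqP; rewrite eq_le ha andbT; have <- : a + b = 0 by []; rewrite lerDl.
Qed.

Definition simple_image (c : seq I) j := forall i, wact c (alpha j) = alpha i ->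
  exists k, [/\ k != 0, Ad (weyl_lift c) (e j) = k *: e i & Ad (weyl_lift c) (f j) = k^-1 *: f i].

(** The case where [w s_k alpha_j] is the sum of [w alpha_j] and [w alpha_k] cannot give a simple
    root: both summands would be multiples of it, against the independence of alpha_j and alpha_k.
    Nonnegativity is proved along with the claim because this argument uses it. *)
Lemma weyl_lift_simple (w : W) j : (len w < len (w * s j)%g)%N ->
  forall c, wp c = w -> nonneg (wact c (alpha j)) /\ simple_image c j.
Proof.
have r1 := oner_neq0 R.
have red c c' j' : wp c = wp c' -> simple_image c' j' -> simple_image c j'.
  move=> ecc' h i; rewrite (wact_wp ecc') => /h [k [k0 he hf]].
  have [g hg eg] := weyl_lift_wp G ecc'; have [chi wg] := torus_weight hg.
  have [c0 ce cf _] := wg i; have ug := torus_unit hg.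
  exists (k * chi i); rewrite mulf_neq0 //; split=> //.
    by rewrite eg Ad_comp ?weyl_lift_unit // he AdZ ce scalerA.
  by rewrite eg Ad_comp ?weyl_lift_unit // hf AdZ cf scalerA invfM.
move=> asc c cw; split; first exact: asc_nonneg asc _ cw.
move: w j asc c cw.
suff h (w : W) j : (len w < len (w * s j)%g)%N -> forall c, wp c = w ->
    nonneg (wact c (alpha j)) /\ simple_image c j.
  by move=> w j asc c cw; have [] := h w j asc c cw.
move: w j; apply: rank2_ind.
- move=> j c c1; have e1 : wp c = wp [::] by rewrite c1 word_prod_nil.
  split; first by rewrite (wact_wp e1) /= => k; rewrite ffunE; case: eqP.
  apply: (red _ [::]) => // i /= /alpha_inj <-; exists 1.
  by rewrite weyl_lift_nil !Ad_id invr1 !scale1r.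
- move=> w j k d IH c cw; have [c0 c0w] := slw_gen w.
  have e1 : wp c = wp (rcons c0 k) by rewrite cw word_prod_rcons c0w.
  have [nn0 si] := IH c0 c0w; split.
    by rewrite (wact_wp e1) wact_rcons refl_alpha0.
  apply: (red _ _ _ e1) => i; rewrite wact_rcons refl_alpha0 // => /si [l [l0 he hf]].
  by exists l; rewrite !Ad_weyl_lift_rcons Adn_e0 // Adn_f0.
- move=> w j k d IH1 IH2 c cw; have [c0 c0w] := slw_gen w.
  have e1 : wp c = wp (rcons c0 k) by rewrite cw word_prod_rcons c0w.
  have [n1 _] := IH1 c0 c0w; have [n2 _] := IH2 c0 c0w; split.
    rewrite (wact_wp e1) wact_rcons refl_alphaN1 // wactD => l.
    by rewrite ffunE addr_ge0.
  apply: (red _ _ _ e1) => i; rewrite wact_rcons refl_alphaN1 // wactD => ei.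
  exfalso; set u := wact c0 (alpha j) in n1 ei; set v := wact c0 (alpha k) in n2 ei.
  have eu := nonneg_multiple n1 n2 ei.
  have ev := nonneg_multiple n2 n1 (etrans (addrC _ _) ei).
  (* As [u] and [v] are multiples of alpha_i, this combination is sent to 0 by [c0], and [wactK]
     undoes the action. *)
  have : v i *: alpha j - u i *: alpha k = 0.
    rewrite -[LHS](wactK c0) wactD wactN !wactZ -/u -/v eu ev !vE eqxx !mulr1.
    by rewrite !scalerA mulrC subrr wact0.
  move=> /ffunP/(_ k); rewrite !vE eqxx.
  case: eqP => [jk|_]; first by case: (dotN1_neq d); rewrite jk.
  rewrite mulr0 mulr1 sub0r => /eqP; rewrite oppr_eq0 => /eqP u0.
  by case: (@wact_alpha_neq0 R W c0 j); rewrite -/u eu u0 scale0r.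
- move=> w j k d IH c cw; have [c0 c0w] := slw_gen w.
  have e1 : wp c = wp (rcons (rcons c0 j) k) by rewrite cw !word_prod_rcons c0w.
  have [n1 si] := IH c0 c0w; have d' : dot j k = -1 by rewrite dotC.
  split; first by rewrite (wact_wp e1) !wact_rcons refl_alphaN1N1.
  apply: (red _ _ _ e1) => i; rewrite !wact_rcons refl_alphaN1N1 // => /si [l [l0 he hf]].
  exists l; rewrite !Ad_weyl_lift_rcons Adn_eN1 // Adn_fN1 // invr1 !scale1r.
  rewrite lieC [lie (f k) (f j)]lieC opprK AdN Adn_eij // Adn_fij // opprK invr1 !scale1r.
  by [].
Qed.

Lemma w0_word_split j c : wp c = w0 W ->
  exists c0 g, [/\ torus g, weyl_lift c = g * weyl_lift c0 * nn j 1, wp c0 = (w0 W * s j)%g &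
    (len (wp c0) < len (wp c0 * s j)%g)%N].
Proof.
move=> cw; have [c0 c0w] := slw_gen (w0 W * s j)%g.
have [|g hg eg] := @weyl_lift_wp _ _ G c (rcons c0 j); first by rewrite word_prod_rcons c0w mul_slw_reflK.
exists c0, g; rewrite eg weyl_lift_rcons mulrA; split=> //.
by rewrite c0w mul_slw_reflK [X in (_ < X)%N](w0_desc j).
Qed.

(** For [c0] a word of [w0 s_j], the root u = c0 alpha_j satisfies [s_i u = - u] because
    [s_i w0 = w0 s_j], so it is a multiple of alpha_i. The invariant form makes the factor 1 or -1,
    and positivity selects 1; then [weyl_lift_simple] applies. *)
Lemma w0_simple i c : wp c = w0 W ->
  exists2 k, k != 0 & Ad (weyl_lift c) (f (bang i)) = k *: e i.
Proof.
move=> cw; set j := bang i; have r1 := oner_neq0 R.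
have [c0 [g [hg eg c0w asc]]] := w0_word_split j cw.
have e1 : wp (i :: c0) = wp (rcons c0 j).
  by rewrite word_prod_cons word_prod_rcons c0w mulgA bangE -/j !mul_slw_reflK -[RHS]mulg1 -(slw_reflK j) mulgA mul_slw_reflK.
have [n1 si] := weyl_lift_simple asc erefl.
have ei : wact c0 (alpha j) = alpha i.
  set u := wact c0 (alpha j) in n1 *.
  have := wact_wp e1 (alpha j); rewrite wact_rcons refl_alphaii wactN /= -/u.
  rewrite reflE; set p := pairing u i => eu.
  have {}eu : u = (p / 2) *: alpha i.
    have e2 : u + u = p *: alpha i.
      by rewrite -[p]opprK scaleNr -(addrK u (- p *: _)) eu opprD opprK.
    apply/ffunP=> k; have := congr1 (fun v : {ffun I -> R^o} => v k) e2.
    by rewrite !vE; move: (u k : R) => z /= ez; lra.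
  have fu : bform u u = 2%:R by rewrite bform_wact bform_alpha pairing_alpha dotii.
  move: fu; rewrite eu -[_ *: _]addr0 bform_lin bform_linr bform_alpha pairing_alpha dotii.
  have f0 v : bform v (0 : {ffun I -> R^o}) = 0.
    by rewrite /bform big1 // => k _; rewrite ffunE mulr0.
  rewrite f0 [bform 0 _]bformC f0 !addr0.
  have : 0 <= p / 2 by have := n1 i; rewrite eu !vE eqxx mulr1.
  rewrite (_ : 2%:~R = 2%:R) //; move: (p / 2) => q q0 qq.
  have -> : q = 1 by nra.
  by rewrite scale1r.
have [k [k0 he _]] := si i ei; have [chi wg] := torus_weight hg.
have [ch0 ce _ _] := wg i.
exists (- (k * chi i)); first by rewrite oppr_eq0 mulf_neq0.
have ug := torus_unit hg; have uc := weyl_lift_unit G c0; have un := n_unit G j 1.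
rewrite eg Ad_comp3 //.
by rewrite Adn_f // expr1n scale1r !AdN he AdZ ce scalerA scaleNr.
Qed.

(** Ending the word with [j], the last factor turns [y_j] into [x_j], and the rest, which ascends at
    [j], keeps it in [Uplus]. *)
Lemma w0_Uminus c u : wp c = w0 W -> Uminus u -> Uplus (Ad (weyl_lift c) u).
Proof.
move=> cw; apply: gen_Ad => [|_ [i [t ->]]|_ [j [t ->]]]; first exact: weyl_lift_unit.
  exact: y_unit.
have [c0 [g [hg -> c0w asc]]] := w0_word_split j cw.
have ug := torus_unit hg; have uc := weyl_lift_unit G c0; have un := n_unit G j 1.
rewrite Ad_comp3 // n_y ?oner_neq0 //.
by apply: torus_Uplus => //; apply: weyl_lift_x_asc asc _ erefl _.
Qed.

Lemma w0_Bminus c b : wp c = w0 W -> Bminus b -> Bplus (Ad (weyl_lift c) b).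
Proof.
move=> cw; apply: gen_Ad; first exact: weyl_lift_unit.
  by move=> z hz; apply: Bminus_unit; apply: GenIn.
move=> z [hz|[i [t ->]]].
  by apply: (@torus_Bplus R W G); apply: torus_weyl_lift; apply: GenIn.
by apply: (@Uplus_Bplus R W G); apply: w0_Uminus => //; apply: Uminus_y.
Qed.

Lemma weyl_lift_rev c : exists2 g, torus g & (weyl_lift c)^-1 = weyl_lift (rev c) * g.
Proof.
have [|g hg eg] := @weyl_lift_wp _ _ G (c ++ rev c) [::].
  by rewrite word_prod_cat word_prod_rev mulgV word_prod_nil.
exists g^-1; first exact: GenInv.
have ug := torus_unit hg; apply: (mulrI (weyl_lift_unit G c)).
by rewrite mulrV ?weyl_lift_unit // mulrA -weyl_lift_cat eg weyl_lift_nil mulr1 mulrV.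
Qed.

Lemma w0_BminusV c b : wp c = w0 W -> Bminus b -> Bplus (Ad (weyl_lift c)^-1 b).
Proof.
move=> cw hb; have [g hg ->] := weyl_lift_rev c; rewrite Ad_comp ?weyl_lift_unit ?(torus_unit hg) //.
apply: w0_Bminus; first by rewrite word_prod_rev cw w0V.
have hg' := torus_Bminus hg; apply: GenMul; last exact: GenInv.
exact: GenMul.
Qed.

Definition cell (c : seq I) : set M :=
  [set g | exists b b', [/\ Bminus b, Bminus b' & g = b * weyl_lift c * b']].

(** Of the three factors of [b] in [Bminus_decomp], the torus part and [y_j(t)] pass to the left of
    the lift of [c], by [weyl_lift_y_asc], and the part in [Unip j] passes to the right of [n_j]. *)
Lemma BwB_s c j b : (len (wp c) < len (wp c * s j)%g)%N -> Bminus b ->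
  exists b1 b2, [/\ Bminus b1, Bminus b2 & weyl_lift c * b * nn j 1 = b1 * weyl_lift (rcons c j) * b2].
Proof.
move=> asc /(@Bminus_decomp _ _ G j) [g [t [z [hg [hz1 hz] ->]]]].
exists (Ad (weyl_lift c) g * Ad (weyl_lift c) (y j t)), (Ad (nn j 1)^-1 z); split.
- apply: GenMul; first by apply: (@torus_Bminus R W G); apply: torus_weyl_lift.
  by apply: (@Uminus_Bminus R W G); apply: weyl_lift_y_asc asc _ erefl _.
- apply: (@Uminus_Bminus R W G); apply: hz; apply: (GenInv (SL2_n G j 1)).
- rewrite weyl_lift_rcons /Ad invrK.
  move: (weyl_lift c) (weyl_lift_unit G c) (nn j 1) (n_unit G j 1) => N uN N' uN'.
  by rewrite !mulrA mulrVK // mulrK // mulrVK // mulrVK.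
Qed.

Definition xword (u : seq (I * R)) : M := \prod_(p <- u) x p.1 p.2.

(** For nonzero [a], [x_j(a)] lies in the double coset of [n_j(1)], and along a reduced word the
    double cosets multiply by [BwB_s]. *)
Lemma cell_reduced u : reduced (map fst u) -> all (fun p => p.2 != 0) u ->
  cell (map fst u) (xword u).
Proof.
elim/last_ind: u => [|u [j a] IH].
  by move=> _ _; exists 1, 1; rewrite /xword big_nil weyl_lift_nil !mulr1; split=> //; exact: GenOne.
rewrite map_rcons all_rcons /= => ru /andP [a0 au].
have ru' : reduced (map fst u) by move: ru; rewrite -cats1 => /reduced_cat [].
have asc : (len (wp (map fst u)) < len (wp (map fst u) * s j)%g)%N.
  by rewrite -word_prod_rcons ru ru' size_rcons.
have [b [b' [hb hb' eb]]] := IH ru' au.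
have r1 := oner_neq0 R.
have ea : x j a = y j a^-1 * (nn j a * nn j (-1)) * nn j 1 * y j a^-1.
  rewrite -(mulrA (y j a^-1)) -[nn j (-1)]nrootV mulrVK ?n_unit // n_alt //.
  by rewrite !mulrA yrootKN mul1r -mulrA yrootNK mulr1.
have hg : torus (nn j a * nn j (-1)) by apply: nroot_mul_torus; rewrite ?oppr_eq0.
set g := nn j a * nn j (-1) in ea hg.
have [|b1 [b2 [hb1 hb2 e12]]] := @BwB_s (map fst u) j (b' * y j a^-1 * g) asc.
  apply: GenMul; last exact: torus_Bminus.
  by apply: GenMul => //; apply: (@Uminus_Bminus R W G); apply: Uminus_y.
exists (b * b1), (b2 * y j a^-1); split.
- exact: GenMul.
- by apply: GenMul => //; apply: (@Uminus_Bminus R W G); apply: Uminus_y.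
rewrite /xword -cats1 big_cat big_seq1 /= -/(xword u) eb ea.
move: (nn j 1) (weyl_lift _) (weyl_lift _) e12 => N N1 N2 e12.
by rewrite !mulrA in e12 *; rewrite -!(mulrA b) e12 !mulrA.
Qed.

End WeylLiftPlus.

(** * The principal grading *)

Section Grading.
Local Open Scope classical_set_scope.
Variables (R : realType) (n : nat).
Local Notation M := 'M[R]_n.+1.
Variables (D : M -> M) (lam : int -> R).
Hypothesis D_lin : forall a X Y, D (a *: X + Y) = a *: D X + D Y.
Hypothesis lam_inj : injective lam.

(** The grading is by eigenspaces of an abstract operator because it is used twice: for ad of
    rho^vee with eigenvalue m in degree m, and for Ad of a torus element with eigenvalue exp m. *)
Definition homog (m : int) (X : M) := D X = lam m *: X.

Inductive gspan (P : int -> Prop) : M -> Prop :=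
| Gspan0 : gspan P 0
| GspanD X Y : gspan P X -> gspan P Y -> gspan P (X + Y)
| GspanH m X : P m -> homog m X -> gspan P X.

Definition shiftD m X := - lam m *: X + D X.
Definition annih (s : seq int) X := foldl (fun Y m => shiftD m Y) X s.

Lemma shiftD_lin m a X Y : shiftD m (a *: X + Y) = a *: shiftD m X + shiftD m Y.
Proof.
rewrite /shiftD D_lin; move: (D X) (D Y) => X' Y'.
by apply/matrixP => i j; rewrite !mxE; ring.
Qed.

Lemma D0 : D 0 = 0.
Proof.
by have := D_lin (-1) 0 0; rewrite scaler0 addr0 scaleN1r addNr.
Qed.

Lemma shiftD0 m : shiftD m 0 = 0. Proof. by rewrite /shiftD D0 scaler0 addr0. Qed.

Lemma DZ a X : D (a *: X) = a *: D X.
Proof. by rewrite -[_ *: X in LHS]addr0 D_lin D0 addr0. Qed.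

Lemma shiftDC m k X : shiftD m (shiftD k X) = shiftD k (shiftD m X).
Proof.
rewrite /shiftD !D_lin; move: (D (D X)) (D X) => X' Y'.
by apply/matrixP => i j; rewrite !mxE; ring.
Qed.

Lemma annih0 s : annih s 0 = 0.
Proof. by elim: s => //= m s; rewrite shiftD0. Qed.
Lemma annih_lin s a X Y : annih s (a *: X + Y) = a *: annih s X + annih s Y.
Proof. by elim: s X Y => //= m s IH X Y; rewrite shiftD_lin IH. Qed.
Lemma annih_shift s m X : annih s (shiftD m X) = shiftD m (annih s X).
Proof. by elim: s X => //= k s IH X; rewrite shiftDC IH. Qed.
Lemma annih_cat s s' X : annih (s ++ s') X = annih s' (annih s X).
Proof. by rewrite /annih foldl_cat. Qed.
Lemma annihC s s' X : annih s' (annih s X) = annih s (annih s' X).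
Proof. by elim: s X => //= m s IH X; rewrite IH annih_shift. Qed.

Lemma gspan_annih P X : gspan P X -> exists2 s, (forall m, m \in s -> P m) & annih s X = 0.
Proof.
elim=> {X} [|X Y _ [s hs aX] _ [s' hs' aY]|m X Pm hX].
- by exists [::].
- exists (s ++ s').
    by move=> m; rewrite mem_cat => /orP [/hs|/hs'].
  rewrite -[X]scale1r annih_lin !annih_cat aX annih0 annihC aY annih0.
  by rewrite scaler0 addr0.
- exists [:: m]; first by move=> k; rewrite inE => /eqP ->.
  by rewrite /annih /= /shiftD hX scaleNr addNr.
Qed.

Lemma annih_homog s m X : homog m X -> exists2 c, (m \notin s -> c != 0) & annih s X = c *: X.
Proof.
move=> hX; elim: s => [|k s [c c0 e]]; first by exists 1; rewrite ?scale1r ?oner_neq0.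
exists (c * (lam m - lam k)).
  rewrite inE negb_or => /andP [mk /c0 h]; rewrite mulf_neq0 // subr_eq0.
  by apply: contraNneq mk => /lam_inj ->.
rewrite /= annih_shift e /shiftD DZ hX !scalerA -scalerDl; congr (_ *: _).
by rewrite mulrBr mulNr addrC mulrC [lam k * _]mulrC [lam m * _]mulrC.
Qed.

(** Independence of eigenspaces. [X] is killed by two products of factors D - lam m with disjoint
    sets of degrees. Induction shows that one factor of the first product already kills [X], so that
    [X] is homogeneous, and on it the second product is a nonzero scalar. *)
Lemma gspan_sep P Q X : (forall m, P m -> Q m -> False) ->
  gspan P X -> gspan Q X -> X = 0.
Proof.
move=> PQ /gspan_annih [s hs aX] /gspan_annih [s' hs' aX'].
have {hs hs' PQ} : forall m, m \in s -> m \notin s'.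
  by move=> m /hs Pm; apply/negP => /hs' /(PQ _ Pm).
elim: s X aX aX' => //= m s IH X aX aX' dis.
have /IH : annih s' (shiftD m X) = 0 by rewrite annih_shift aX' shiftD0.
move=> /(_ aX) h; have {h} e : shiftD m X = 0.
  by apply: IH => //; rewrite ?annih_shift ?aX' ?shiftD0 // => k ks; apply: dis; rewrite inE ks orbT.
have hX : homog m X.
  by move/eqP: e; rewrite /shiftD scaleNr addrC subr_eq0 => /eqP.
have [c c0 ec] := annih_homog s' hX; move: aX'; rewrite ec => /eqP.
by rewrite scaler_eq0 (negPf (c0 _)) ?dis ?inE ?eqxx //= => /eqP.
Qed.

Lemma gspan_sub (P Q : int -> Prop) X : (forall m, P m -> Q m) -> gspan P X -> gspan Q X.
Proof.
by move=> h; elim=> {X} *; [exact: Gspan0|apply: GspanD|apply: GspanH; eauto].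
Qed.

Lemma homogZ m a X : homog m X -> homog m (a *: X).
Proof. by rewrite /homog DZ => ->; rewrite !scalerA mulrC. Qed.

Hypothesis homogM : forall m k X Y, homog m X -> homog k Y -> homog (m + k) (X * Y).

Lemma gspanM (P Q S : int -> Prop) X Y : (forall m k, P m -> Q k -> S (m + k)) ->
  gspan P X -> gspan Q Y -> gspan S (X * Y).
Proof.
move=> h hX hY; elim: hX => {X} [|X X' _ h1 _ h2|m X Pm hm].
- by rewrite mul0r; exact: Gspan0.
- by rewrite mulrDl; apply: GspanD.
elim: hY => {Y} [|Y Y' _ h1 _ h2|k Y Qk hk].
- by rewrite mulr0; exact: Gspan0.
- by rewrite mulrDr; apply: GspanD.
- by apply: GspanH (h _ _ Pm Qk) _; apply: homogM.
Qed.

Hypothesis homog1 : homog 0 1.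

Lemma homogX m X k : homog m X -> homog (m * k%:Z) (X ^+ k).
Proof.
move=> hX; elim: k => [|k IH]; first by rewrite mulr0 expr0.
by rewrite exprS (_ : m * k.+1%:Z = m + m * k%:Z) ?intS ?mulrDr ?mulr1 //; apply: homogM.
Qed.

Lemma gspan_exp1 (P : int -> Prop) m X : homog m X -> (forall k : nat, P (m * k.+1%:Z)) ->
  gspan P (mxexp_nilp X - 1).
Proof.
move=> hX hP; rewrite /mxexp_nilp big_ord_recl /= fact0 invr1 expr0 scale1r addrC addrA addNr add0r.
apply: (big_ind (gspan P)) => [|Y Z hY hZ|k _]; first exact: Gspan0.
  exact: GspanD.
by apply: GspanH (hP k) _; apply: homogZ; apply: homogX.
Qed.

End Grading.

(** * The grading by rho^vee and the position of the two Borel subgroups *)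

Section SimpleGrading.
Local Open Scope classical_set_scope.
Variables (R : realType) (W : simply_laced_weyl) (G : pinned_group R W).
Local Notation I := (slw_index W).
Local Notation M := 'M[R]_((pg_dim G).+1).
Local Notation e := (pg_e G).
Local Notation f := (pg_f G).
Local Notation h := (pg_h G).
Local Notation x := (xroot G).
Local Notation y := (yroot G).
Local Notation nn := (nroot G).
Local Notation torus := (@torus R W G).
Local Notation Uminus := (@Uminus R W G).
Local Notation Bminus := (@Bminus R W G).
Local Notation Bplus := (@Bplus R W G).
Implicit Types (i j : I) (t : R).

Lemma Uminus_gspan (D : M -> M) (lam : int -> R) :
  (forall a X Y, D (a *: X + Y) = a *: D X + D Y) ->
  (forall m k X Y, homog D lam m X -> homog D lam k Y -> homog D lam (m + k) (X * Y)) ->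
  homog D lam 0 1 -> (forall i t, homog D lam (-1) (t *: f i)) ->
  forall d, Uminus d -> gspan D lam (fun m => m <= -1) (d - 1).
Proof.
move=> Dl DM D1 Df d hd.
have yP i t : gspan D lam (fun m => m <= -1) (y i t - 1).
  by apply: (gspan_exp1 Dl DM D1 (Df i t)) => k; lia.
suff [] : gspan D lam (fun m => m <= -1) (d - 1) /\ gspan D lam (fun m => m <= -1) (d^-1 - 1) by [].
elim: hd => {d} [_ [i [t ->]]||b b' hb [h1 h2] hb' [h1' h2']|b hb [h1 h2]].
- by rewrite yrootV; split; apply: yP.
- by rewrite invr1 subrr; split; exact: Gspan0.
- have prod X Y : gspan D lam (fun m => m <= -1) (X - 1) ->
      gspan D lam (fun m => m <= -1) (Y - 1) -> gspan D lam (fun m => m <= -1) (X * Y - 1).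
    move=> hX hY; have -> : X * Y - 1 = (X - 1) * (Y - 1) + ((X - 1) + (Y - 1)).
      rewrite mulrBl mul1r mulrBr mulr1; move: (X * Y) => Z.
      by apply/matrixP=> k l; rewrite !mxE; ring.
    apply: GspanD; last exact: GspanD.
    by apply: gspanM hX hY => // m k; lia.
  by rewrite invrM ?(Uminus_unit hb) ?(Uminus_unit hb') //; split; apply: prod.
- by rewrite invrK.
Qed.

(** The coefficients of rho^vee on the simple coroots: every simple root takes the value 1 on it, so
    ad [hrho] measures height. *)
Definition rho_coef : {ffun I -> R^o} := sval (cid (pairing_surj (R := R) (W := W) (fun _ => 1))).
Lemma rho_coefE i : pairing rho_coef i = 1.
Proof. exact: (svalP (cid (pairing_surj (fun _ => 1)))). Qed.

Definition hrho : M := \sum_j (rho_coef j : R) *: h j.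

Lemma lie_hrho (X : M) (c : I -> R) : (forall j, lie (h j) X = c j *: X) ->
  lie hrho X = (\sum_j rho_coef j * c j) *: X.
Proof.
move=> hX; rewrite /lie /hrho mulr_suml mulr_sumr -sumrB scaler_suml.
by apply: eq_bigr => j _; rewrite -scalerAl -scalerAr -scalerBr -/(lie _ _) hX scalerA.
Qed.

Lemma lie_hrho_e i : lie hrho (e i) = e i.
Proof.
rewrite (@lie_hrho _ (fun j => (dot j i)%:~R)) => [|j]; last by rewrite pg_he scaler_int.
by rewrite -/(pairing _ i) rho_coefE scale1r.
Qed.
Lemma lie_hrho_f i : lie hrho (f i) = - f i.
Proof.
rewrite (@lie_hrho _ (fun j => - (dot j i)%:~R)) => [|j]; last by rewrite pg_hf scaleNr scaler_int.
under eq_bigr do rewrite mulrN; rewrite sumrN -/(pairing _ i) rho_coefE scaleN1r //.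
Qed.

Definition degh := lie hrho.
Definition lamh (m : int) : R := m%:~R.

Lemma degh_lin a X Y : degh (a *: X + Y) = a *: degh X + degh Y.
Proof. by rewrite /degh lieDr lieZr. Qed.
Lemma lamh_inj : injective lamh. Proof. exact: intr_inj. Qed.
Lemma deghM m k (X Y : M) : homog degh lamh m X -> homog degh lamh k Y ->
  homog degh lamh (m + k) (X * Y).
Proof.
rewrite /homog /degh /lamh => hX hY.
have -> : lie hrho (X * Y) = lie hrho X * Y + X * lie hrho Y.
  by rewrite /lie mulrBl mulrBr !mulrA subrKA.
by rewrite hX hY -scalerAl -scalerAr -scalerDl intrD.
Qed.
Lemma degh1 : homog degh lamh 0 1.
Proof. by rewrite /homog /degh /lie mulr1 mul1r subrr scale0r. Qed.
Lemma degh_e i t : homog degh lamh 1 (t *: e i).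
Proof. by rewrite /homog /degh /lamh lieZr lie_hrho_e scale1r. Qed.
Lemma degh_f i t : homog degh lamh (-1) (t *: f i).
Proof. by rewrite /homog /degh /lamh lieZr lie_hrho_f scalerN scaleN1r. Qed.

Local Notation hspan := (gspan degh lamh).

Lemma hspan_sep (P Q : int -> Prop) (X : M) : (forall m, P m -> Q m -> False) ->
  hspan P X -> hspan Q X -> X = 0.
Proof. exact: (gspan_sep degh_lin lamh_inj). Qed.

Lemma degh_torus g : torus g -> homog degh lamh 0 g.
Proof.
move=> hg; have [chi wg] := torus_weight hg; have ug := torus_unit hg.
have e0 : Ad g hrho = hrho.
  rewrite /hrho Ad_sum; apply: eq_bigr => j _; rewrite AdZ.
  by have [_ _ _ ->] := wg j.
rewrite /homog /lamh scale0r /degh /lie; apply/eqP; rewrite subr_eq0; apply/eqP.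
by rewrite (Ad_mul _ ug) e0.
Qed.

Let ge0 (m : int) : Prop := 0 <= m.
Let le0 (m : int) : Prop := m <= 0.
Let leN1 (m : int) : Prop := m <= -1.

Lemma x_ge0 i t : hspan ge0 (x i t).
Proof.
rewrite -[x i t](subrK 1); apply: GspanD; last exact: GspanH degh1.
by apply: (gspan_exp1 degh_lin deghM degh1 (degh_e i t)) => k; rewrite /ge0 mul1r.
Qed.
Lemma y_leN1 i t : hspan leN1 (y i t - 1).
Proof.
by apply: (gspan_exp1 degh_lin deghM degh1 (degh_f i t)) => k; rewrite /leN1; lia.
Qed.
Lemma y_le0 i t : hspan le0 (y i t).
Proof.
rewrite -[y i t](subrK 1); apply: GspanD; last exact: GspanH degh1.
by apply: gspan_sub (y_leN1 i t) => m; rewrite /leN1 /le0; lia.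
Qed.

Lemma coroot_deg0 i t : t != 0 ->
  homog degh lamh 0 (coroot G i t) /\ homog degh lamh 0 (coroot G i t)^-1.
Proof.
by move=> t0; have hg := torus_coroot G i t0; split; apply: degh_torus => //; apply: GenInv.
Qed.

Lemma gen_span (P : int -> Prop) (S : set M) : (forall z, S z -> z \is a GRing.unit) ->
  P 0 -> (forall m k, P m -> P k -> P (m + k)) ->
  (forall z, S z -> hspan P z /\ hspan P z^-1) ->
  forall b, generated_group S b -> hspan P b.
Proof.
move=> uS P0 PD hS b hb; suff [] : hspan P b /\ hspan P b^-1 by [].
elim: hb => {b} [b /hS //||b b' hb [h1 h2] hb' [h1' h2']|b hb [h1 h2]].
- by rewrite invr1; split; apply: GspanH P0 degh1.
- have u := gen_unit uS hb; have u' := gen_unit uS hb'; rewrite invrM //.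
  by split; apply: gspanM PD _ _ => //; exact: deghM.
- by rewrite invrK.
Qed.

Lemma Bplus_ge0 b : Bplus b -> hspan ge0 b.
Proof.
apply: gen_span => //; first by move=> z hz; apply: Bplus_unit; apply: GenIn.
  by move=> m k; rewrite /ge0; lia.
move=> z [[i [t [t0 ->]]]|[i [t ->]]].
  by have [h1 h2] := coroot_deg0 i t0; split; apply: GspanH; eauto.
by rewrite xrootV; split; apply: x_ge0.
Qed.

Lemma Bminus_le0 b : Bminus b -> hspan le0 b.
Proof.
apply: gen_span => //; first by move=> z hz; apply: Bminus_unit; apply: GenIn.
  by move=> m k; rewrite /le0; lia.
move=> z [[i [t [t0 ->]]]|[i [t ->]]].
  by have [h1 h2] := coroot_deg0 i t0; split; apply: GspanH; eauto.
by rewrite yrootV; split; apply: y_le0.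
Qed.

(** Otherwise [h_i = [e_i, f_i]] would vanish, all weights would be 0 on the i-th coroot, and they
    could not generate the i-th fundamental weight. *)
Lemma e_neq0 i : e i != 0.
Proof.
apply/eqP => e0; have h0 : h i = 0.
  by have := pg_ef G i i; rewrite eqxx e0 /lie mul0r mulr0 subrr.
have [m [l [z [wl e1]]]] := pg_simply_connected G [ffun j => (i == j)%:Z].
have li k : l k i = 0.
  have [v v0 hv] := wl k; have := hv i; rewrite h0 mul0mx => /esym/eqP.
  by rewrite scaler_eq0 (negPf v0) orbF intr_eq0 => /eqP.
have := congr1 (fun g : {ffun I -> int} => g i) e1; rewrite ffunE eqxx sum_ffunE big1 //.
by move=> k _; rewrite ffunMzE li mul0rz.
Qed.

(* If [b * b' = n_i] then [Ad b' e_i = Ad b^-1 (Ad n_i e_i)], and the two sides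
   are concentrated in degrees [>= 1] and [<= -1] respectively. *)
Lemma n_notin i b b' t : t != 0 -> Bminus b -> Bplus b' -> b * b' <> nn i t.
Proof.
move=> t0 hb hb' eb; have ub := Bminus_unit hb; have ub' := Bplus_unit hb'.
pose X := Ad b' (e i).
have h1 : hspan (fun m => 1 <= m) X.
  apply: (@gspanM _ _ _ _ deghM (fun m => 1 <= m) ge0).
  - by move=> m k; rewrite /ge0; lia.
  - apply: (@gspanM _ _ _ _ deghM ge0 (fun m => 1 <= m)).
    + by move=> m k; rewrite /ge0; lia.
    + exact: Bplus_ge0.
    + by apply: (@GspanH _ _ _ _ _ 1) => //; rewrite -[e i]scale1r; exact: degh_e.
  - by apply: Bplus_ge0; exact: GenInv.
have h2 : hspan leN1 X.
  have -> : X = Ad b^-1 (- t ^- 2 *: f i).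
    rewrite scaleNr -Adn_e // -eb Ad_comp // AdVK //.
  apply: (@gspanM _ _ _ _ deghM leN1 le0).
  - by move=> m k; rewrite /leN1 /le0; lia.
  - apply: (@gspanM _ _ _ _ deghM le0 leN1).
    + by move=> m k; rewrite /leN1 /le0; lia.
    + by apply: Bminus_le0; exact: GenInv.
    + by apply: (@GspanH _ _ _ _ _ (-1)) => //; exact: degh_f.
  - by rewrite invrK; exact: Bminus_le0.
have X0 : X = 0 by apply: hspan_sep h1 h2 => m; rewrite /leN1; lia.
by have := AdVK (e i) ub'; rewrite -/X X0 Ad0 => /esym/eqP; rewrite (negPf (e_neq0 i)).
Qed.

Lemma Bplus_Uminus d : Bplus d -> Uminus d -> d = 1.
Proof.
move=> hb hd; apply/eqP; rewrite -subr_eq0; apply/eqP.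
apply: (@hspan_sep ge0 leN1); first by move=> m; rewrite /ge0 /leN1; lia.
  apply: GspanD; first exact: Bplus_ge0.
  by rewrite -scaleN1r; apply: (@GspanH _ _ _ _ _ 0) => //; apply: homogZ degh1; exact: degh_lin.
by apply: Uminus_gspan hd; [exact: degh_lin|exact: deghM|exact: degh1|exact: degh_f].
Qed.

(** The element is exp(rho^vee), built as the product over [j] of the j-th coroots at exp of the
    coefficients of rho^vee. *)
Lemma torus_rho : exists2 g, torus g & weight_of g (fun=> expR 1).
Proof.
have ex (l : seq I) : exists2 g, torus g &
    weight_of g (fun i => expR (\sum_(j <- l) (rho_coef j : R) * (dot j i)%:~R)).
  elim: l => [|j l [g hg wg]].
    exists 1; first exact: GenOne.
    move=> i; rewrite big_nil expR0 !Ad_id invr1 !scale1r; split=> //; exact: oner_neq0.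
  have c0 : expR (rho_coef j : R) != 0 by rewrite gt_eqF // expR_gt0.
  exists (coroot G j (expR (rho_coef j)) * g).
    by apply: GenMul => //; apply: torus_coroot.
  move=> i; have [n0 he hf hh] := wg i; have [n1 ce cf ch] := coroot_weight G j c0 i.
  have ug := torus_unit hg; have uc := coroot_unit G j (expR (rho_coef j : R)).
  have E : expR (rho_coef j : R) ^ dot j i = expR ((rho_coef j : R) * (dot j i)%:~R).
    case: (dot_cases j i) => [[_ d]|[_ d]|[_ d]]; rewrite d.
    - by rewrite -exprnP -expRM_natr.
    - by rewrite expr0z mulr0 expR0.
    - by rewrite exprN1 mulrN mulr1 expRN.
  rewrite E in n1 ce cf; rewrite big_cons expRD !(@Ad_comp _ _ (coroot G j _)) // he hf hh !AdZ ce cf ch.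
  rewrite !scalerA invfM mulf_neq0 //; split=> //; by rewrite mulrC.
have [g hg wg] := ex (index_enum I); exists g => // i.
by have := wg i; rewrite -/(pairing rho_coef i) rho_coefE.
Qed.

(* If [g] in the torus acts on degree [m] as [exp m], then the commutator of [g]
   and [d] lies in [Bplus] and in [Uminus]; so [d] commutes with [g] and has
   degree 0. *)
Lemma Uminus_norm_Bplus d : Uminus d -> (forall b, Bplus b -> Bplus (Ad d^-1 b)) -> d = 1.
Proof.
move=> hd nd; have [g hg wg] := torus_rho; have ug := torus_unit hg.
have ud := Uminus_unit hd.
pose c := Ad g^-1 d^-1 * d.
have c1 : c = 1.
  apply: Bplus_Uminus; last first.
    by apply: GenMul => //; apply: torus_Uminus; apply: GenInv.
  have -> : c = g^-1 * Ad d^-1 g by rewrite /c /Ad !invrK !mulrA.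
  by apply: GenMul; [apply/GenInv/torus_Bplus|apply/nd/torus_Bplus].
have gd : Ad g d = d.
  have ua : Ad g^-1 d \is a GRing.unit by rewrite Ad_unit ?unitrV.
  have {1}-> : d = Ad g^-1 d.
    have := c1; rewrite /c AdV ?unitrV // => /(congr1 (fun z => Ad g^-1 d * z)).
    by rewrite mulrA mulrV // mul1r mulr1.
  by rewrite AdK.
pose D X := Ad g X; pose lam (m : int) : R := expR m%:~R.
have Dl a X Y : D (a *: X + Y) = a *: D X + D Y by rewrite /D AdD AdZ.
have DM m k X Y : homog D lam m X -> homog D lam k Y -> homog D lam (m + k) (X * Y).
  rewrite /homog /D /lam => hX hY; rewrite AdM // hX hY -scalerAl -scalerAr scalerA.
  by rewrite -expRD intrD.
have D1 : homog D lam 0 1 by rewrite /homog /D /lam expR0 scale1r Ad1.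
have lamI : injective lam by move=> m k /expR_inj/eqP; rewrite eqr_int => /eqP.
apply/eqP; rewrite -subr_eq0; apply/eqP.
apply: (gspan_sep Dl lamI (P := fun m => m <= -1) (Q := fun m => m = 0)) => [m h1 h2||].
- by rewrite h2 in h1.
- apply: Uminus_gspan => // i t; rewrite /homog /D /lam AdZ.
  have [_ _ -> _] := wg i.
  by rewrite -expRN (_ : (-1)%:~R = -1) // !scalerA mulrC.
- apply: GspanH (erefl _) _; rewrite /homog /D /lam expR0 scale1r AdB gd Ad1 //.
Qed.

End SimpleGrading.

(** * The involution on totally positive elements *)

Section BigCell.
Local Open Scope classical_set_scope.
Variables (R : realType) (W : simply_laced_weyl) (G : pinned_group R W).
Local Notation I := (slw_index W).
Local Notation s := (@slw_refl W).
Local Notation wp := (word_prod s).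
Local Notation M := 'M[R]_((pg_dim G).+1).
Local Notation x := (xroot G).
Local Notation nn := (nroot G).
Local Notation weyl_lift := (@weyl_lift R W G).
Local Notation Uminus := (@Uminus R W G).
Local Notation Uplus := (@Uplus R W G).
Local Notation Bminus := (@Bminus R W G).
Local Notation Bplus := (@Bplus R W G).
Local Notation cell := (@cell R W G).
Local Notation xword := (@xword R W G).
Implicit Types (i j : I).

Definition pos_word (u : seq (I * R)) := all (fun p => 0 < p.2) u.

Lemma pos_word_neq0 u : pos_word u -> all (fun p => p.2 != 0) u.
Proof. by apply: sub_all => p h; rewrite gt_eqF. Qed.

Lemma w0_Bplus c b : wp c = w0 W -> Bplus b -> Bminus (Ad (weyl_lift c) b).
Proof.
move=> cw hb; have := @w0_Bminus _ _ (op G) c b cw (Bplus_opV hb).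
have [g hg ->] := weyl_lift_op G c; have ug := torus_unit hg; have uc := weyl_lift_unit G c.
move=> /Bplus_op h; change (Bminus (Ad (g * weyl_lift c) b)) in h.
rewrite Ad_comp // in h; rewrite -(AdVK (Ad (weyl_lift c) b) ug).
have hg' := torus_Bminus hg; rewrite {1}/Ad invrK.
by apply: GenMul => //; apply: GenMul => //; exact: GenInv.
Qed.

(** Conjugation by a lift of [w0] takes [Bminus] into [Bplus], so a common element would express
    [n_i(-1)] as a product of an element of [Bminus] and one of [Bplus], against [n_notin]. *)
Lemma cell_disjoint i c g : wp (i :: c) = w0 W -> cell c g -> cell (i :: c) g -> False.
Proof.
move=> cw [b [b' [hb hb' ->]]] [b1 [b1' [hb1 hb1']]]; rewrite weyl_lift_cons => eb.
have ub := Bminus_unit hb; have ub' := Bminus_unit hb'.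
have r1 := oner_neq0 R.
pose N := nn i 1 * weyl_lift c.
have uN : N \is a GRing.unit by rewrite unitrMr ?n_unit ?weyl_lift_unit.
apply: (@n_notin _ _ G i (b^-1 * b1) (Ad N (b1' * b'^-1)) (-1)).
- by rewrite oppr_eq0.
- by apply: GenMul => //; exact: GenInv.
- rewrite /N -weyl_lift_cons; apply: w0_Bminus => //.
  by apply: GenMul => //; exact: GenInv.
rewrite -nrootV.
have eN : weyl_lift c = (nn i 1)^-1 * N by rewrite /N mulKr // n_unit.
apply: (mulrI ub); apply: (mulIr uN); apply: (mulIr ub').
move: eb; rewrite -/N eN; move: (nn i 1) @N uN {eN} => n N uN; clearbody N => eb.
rewrite /Ad -!(mulrA b^-1) mulVKr // !mulrA mulrVK // mulrVK //.
by rewrite !mulrA in eb; rewrite eb.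
Qed.

Lemma pos_ones d : pos_word [seq (j, 1) | j <- d].
Proof. by apply/allP => p /mapP [j _ ->] /=; rewrite ltr01. Qed.

Lemma fst_ones (d : seq I) : map fst [seq (j, 1 : R) | j <- d] = d.
Proof. by rewrite -map_comp map_id. Qed.

Lemma xword_cat u v : xword (u ++ v) = xword u * xword v.
Proof. by rewrite /xword big_cat. Qed.
Lemma xword_cons p u : xword (p :: u) = x p.1 p.2 * xword u.
Proof. by rewrite /xword big_cons. Qed.

Lemma xword_Uplus u : Uplus (xword u).
Proof.
elim: u => [|p u IH]; first by rewrite /xword big_nil; exact: GenOne.
by rewrite xword_cons; apply: GenMul => //; apply: Uplus_x.
Qed.

(** If the first parameters satisfy a < b, cancelling [x_i(a)] leaves a word without the initial [i]
    equal to one beginning with [x_i(b - a)]. After both are completed to the open cell by letters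
    with parameter 1, this contradicts [cell_disjoint]. *)
Lemma xword_inj u v : map fst u = map fst v -> reduced (map fst u) ->
  pos_word u -> pos_word v -> xword u = xword v -> u = v.
Proof.
elim: u v => [|[i a] u IH] [|[j b] v] //= [<- e] ru /andP [a0 pu] /andP [b0 pv].
rewrite !xword_cons /= => exy.
have no (a' b' : R) u' v' : map fst u' = map fst u -> map fst v' = map fst u ->
    pos_word u' -> pos_word v' -> x i a' * xword u' = x i b' * xword v' -> ~ a' < b'.
  move=> eu ev pu' pv' ex ab.
  have [d dw ld] := w0_complete (wp (i :: map fst u)).
  have rd : reduced (i :: map fst u ++ d).
    by rewrite /reduced -cat_cons word_prod_cat dw len_w0 -ld size_cat ru.
  pose D := [seq (j, 1 : R) | j <- d].
  have ex' : xword (u' ++ D) = xword ((i, b' - a') :: v' ++ D).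
    rewrite xword_cons !xword_cat mulrA /= addrC xrootD -(mulrA (x i (- a'))) -ex mulrA xrootNK mul1r //.
  apply: (@cell_disjoint i (map fst u ++ d) (xword (u' ++ D))).
  - by rewrite -cat_cons word_prod_cat.
  - rewrite -eu -{1}(fst_ones d) -map_cat; apply: cell_reduced.
      by rewrite map_cat fst_ones eu; exact: reduced_cons rd.
    by apply: pos_word_neq0; rewrite /pos_word all_cat; apply/andP; split=> //; exact: pos_ones.
  - rewrite ex' -ev -{1}(fst_ones d) -map_cat -[i]/((i, b' - a').1) -map_cons.
    apply: cell_reduced; first by rewrite /= map_cat fst_ones ev.
    apply: pos_word_neq0; rewrite /pos_word /= all_cat subr_gt0 ab /=.
    by apply/andP; split=> //; exact: pos_ones.
have eab : a = b.
  case: (ltgtP a b) => // h; exfalso.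
    by apply: no exy h.
  by apply: no (esym exy) h.
rewrite eab; congr (_ :: _); apply: IH => //; first exact: reduced_cons ru.
by move: exy; rewrite eab => /(mulrI (x_unit G i b)).
Qed.

Definition borel_match (u v : M) := conj_set u Bminus = conj_set v Bplus.

(** The quotient [v v'^-1] lies in [Uminus] and normalises [Bplus]. *)
Lemma borel_match_uniq u v v' : Uminus v -> Uminus v' -> borel_match u v -> borel_match u v' -> v = v'.
Proof.
move=> hv hv' h h'; have uv := Uminus_unit hv; have uv' := Uminus_unit hv'.
have d1 : v * v'^-1 = 1.
  apply: Uminus_norm_Bplus; first by apply: GenMul => //; exact: GenInv.
  move=> b hb; have : conj_set v' Bplus (v^-1 * b * v).
    by rewrite -h' h; exists b.
  case=> b2 hb2 e2; suff -> : Ad (v * v'^-1)^-1 b = b2 by [].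
  move: (v') uv' e2 => w uw e2.
  rewrite /Ad invrK invrM ?unitrV // invrK; apply: (mulrI (etrans (unitrV w) uw)).
  apply: (mulIr uw); rewrite e2 !mulrA mulVr // mul1r -!mulrA mulVr // mulr1 !mulrA //.
by rewrite -[v](mulrVK uv') d1 mul1r.
Qed.

Lemma borel_match_big b c v : wp c = w0 W -> Bminus b -> v \is a GRing.unit -> borel_match (b * weyl_lift c * v) v.
Proof.
move=> cw hb uv; have ub := Bminus_unit hb; have uc := weyl_lift_unit G c.
have inv : (b * weyl_lift c * v)^-1 = v^-1 * (weyl_lift c)^-1 * b^-1.
  by rewrite !invrM ?unitrMr // mulrA.
apply/seteqP; split=> [_ [g hg <-]|_ [g hg <-]].
  exists (Ad (weyl_lift c)^-1 (b^-1 * g * b)).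
    apply: w0_BminusV => //; apply: GenMul => //; apply: GenMul => //; exact: GenInv.
  by rewrite inv /Ad invrK !mulrA.
exists (Ad b (Ad (weyl_lift c) g)).
  by apply: GenMul; [apply: GenMul => //; exact: w0_Bplus|exact: GenInv].
rewrite inv /Ad; move: (weyl_lift c) uc => N uN.
by rewrite !mulrA !mulrVK // mulrVK.
Qed.

(** The torus part of the right factor in the cell passes to the left of the lift; what remains on
    the right is in [Uminus] and matches [u], so it is [v] by uniqueness. *)
Lemma cell_factor (i : I) c u v : wp c = w0 W -> cell c u -> borel_match u v -> Uminus v ->
  exists2 b, Bminus b & u = b * weyl_lift c * v.
Proof.
move=> cw [b [b' [hb hb' eu]]] hu hv.
have [g [v' [hg hv' eb']]] := Bminus_TU i hb'.
have {}eu : u = b * Ad (weyl_lift c) g * weyl_lift c * v'.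
  rewrite eu eb' /Ad; move: (weyl_lift c) (weyl_lift_unit G c) => N uN.
  by rewrite !mulrA mulrVK.
have hb2 : Bminus (b * Ad (weyl_lift c) g).
  by apply: GenMul => //; apply: (@torus_Bminus R W G); exact: torus_weyl_lift.
exists (b * Ad (weyl_lift c) g) => //; rewrite eu; congr (_ * _).
have uv' := Uminus_unit hv'.
by apply: (borel_match_uniq hv' hv _ hu); rewrite eu; apply: borel_match_big.
Qed.

End BigCell.

(** * Compatibility of the involution with the maps T_i *)

Section Compatibility.
Local Open Scope classical_set_scope.
Variables (R : realType) (W : simply_laced_weyl) (G : pinned_group R W).
Local Notation I := (slw_index W).
Local Notation s := (@slw_refl W).
Local Notation wp := (word_prod s).
Local Notation x := (xroot G).
Local Notation y := (yroot G).
Local Notation opweyl_lift := (@weyl_lift R W (op G)).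
Local Notation weyl_lift := (@weyl_lift R W G).
Local Notation Uminus := (@Uminus R W G).
Local Notation Bminus := (@Bminus R W G).
Local Notation Bplus := (@Bplus R W G).
Local Notation opcell := (@cell R W (op G)).
Local Notation cell := (@cell R W G).
Local Notation yword := (@xword R W (op G)).
Local Notation xword := (@xword R W G).
Local Notation borel_match := (@borel_match R W G).
Implicit Types (i j : I).

Lemma yword_Uminus u : Uminus (yword u).
Proof. exact: (@xword_Uplus _ _ (op G)). Qed.

(** The inverse of a lift of [w0] is, up to the torus, a lift of [w0], and so is the lift formed in
    the opposite group. This recognises the open cell of the opposite group inside [G]. *)
Lemma opposite_cell c d b b' : wp c = w0 W -> wp d = w0 W -> Bplus b -> Bplus b' ->
  opcell d (b * (weyl_lift c)^-1 * b').
Proof.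
move=> cw dw hb hb'; have [g hg eg] := weyl_lift_rev G c.
have [g1 hg1 eg1] : exists2 g, torus (G := G) g & weyl_lift (rev c) = g * opweyl_lift d.
  have [g2 hg2 ->] := weyl_lift_op G d.
  have [|g3 hg3 eg3] := @weyl_lift_wp _ _ G (rev c) d; first by rewrite word_prod_rev cw w0V.
  exists (g3 * g2^-1); first by apply: GenMul => //; exact: GenInv.
  by rewrite eg3 mulrA mulrVK // (torus_unit hg2).
exists (b * g1), (g * b'); rewrite eg eg1.
split; last by rewrite !mulrA.
  by apply: Bplus_opV; apply: GenMul => //; exact: torus_Bplus.
by apply: Bplus_opV; apply: GenMul => //; exact: torus_Bplus.
Qed.

(* Let [u1 = b n v1] with [b] in [Bminus], and let [sg] be the i-th coordinate of
   [b].  Left multiplication of [u1] by [x_i(r)] multiplies [v1] by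
   [y_j(k^-1 r' / (1 + r' sg))], where [r'] is a multiple of [r].  The constants
   are determined because deleting the first letter of [u1] or of [v1] leads to
   a smaller Bruhat cell ([claim1] and [claim2]). *)
Lemma phi_compat i (a b t : R) (u v : seq (I * R)) :
  let u1 := (i, a) :: u in let v1 := (bang i, b) :: v in
  wp (map fst u1) = w0 W -> reduced (map fst u1) ->
  wp (map fst v1) = w0 W -> reduced (map fst v1) ->
  pos_word u1 -> pos_word v1 -> 0 < t -> borel_match (xword u1) (yword v1) ->
  borel_match (xword ((i, a * t) :: u)) (yword ((bang i, b / t) :: v)).
Proof.
move=> u1 v1 cw cr dw dr pu pv t0 huv; set j := bang i in v1 dw dr pv huv *.
set c := map fst u1 in cw cr; set N := weyl_lift c.
have uN : N \is a GRing.unit := weyl_lift_unit G c.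
have a0 : 0 < a by case/andP: pu.
have b0 : 0 < b by case/andP: pv.
have cu : cell c (xword u1) by apply: cell_reduced => //; apply: pos_word_neq0.
have [B hB eB] := cell_factor i cw cu huv (yword_Uminus v1).
have [g [sg [z [hg [hz1 hz2] eB2]]]] := Bminus_decomp i hB.
have [chi wg] := torus_weight hg; have [chi0 _ _ _] := wg i.
set ch := chi i in chi0.
have ug := torus_unit hg.
have [k k0 hk] := w0_simple G i cw; rewrite -/j -/N in hk.
have uv1 := Uminus_unit (yword_Uminus v1).
(* [x_i(r)] is pushed to the right: the torus part of [B] rescales it, [xy_torus] exchanges it with
   [y_i(sg)], the part in [Unip i] is normalised by it, and [N] turns it into an element y_j. *)
have step r : 1 + r / ch * sg != 0 -> exists2 B', Bminus B' &
    x i r * xword u1 = B' * N * (y j (k^-1 * (r / ch / (1 + r / ch * sg))) * yword v1).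
  move=> d0; set r' := r / ch in d0 *; set dl := 1 + r' * sg in d0 *.
  have [g' hg' exy] := xy_torus G i d0; rewrite -/dl in exy.
  have exg : x i r * g = g * x i r'.
    have <- : Ad g (x i r') = x i r.
      by rewrite (torus_x i r' hg wg) -/ch; congr (x i _); rewrite /r'; field.
    by rewrite /Ad mulrVK.
  have ey : x i (r' / dl) * N = N * y j (k^-1 * (r' / dl)).
    rewrite [RHS](Ad_mul _ uN) Ad_yroot // hk scalerA [k^-1 * _ * k]mulrAC mulVf // mul1r //.
  exists (g * y i (sg / dl) * g' * Ad (x i (r' / dl)) z).
    apply: GenMul; last by apply: Uminus_Bminus; apply: hz2; apply: SL2_x.
    apply: GenMul; last exact: torus_Bminus.
    apply: GenMul; first exact: torus_Bminus.
    by apply: Uminus_Bminus; apply: Uminus_y.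
  rewrite eB eB2 -/N; move: (yword v1) (y j _) (N) ey => V Y0 N0 ey.
  move: (x_unit G i (r' / dl)) ey exy exg.
  move: (x i r) (x i r') (x i (r' / dl)) (y i sg) (y i (sg / dl)) => X X' X2 Y Y' uX ey exy exg.
  rewrite /Ad [RHS]mulrA -[_ * N0 * Y0]mulrA -ey !mulrA mulrVK //.
  by rewrite exg -(mulrA g X') exy !mulrA.
(* The value r = - a deletes the first letter of [u1]; the result leaves the open cell, so the
   factorisation must break down at this [r]. *)
have claim1 : 1 - a / ch * sg = 0.
  apply/eqP/negPn/negP => h; have [|B' hB' e1] := step (- a).
    by rewrite !mulNr.
  apply: (@cell_disjoint _ _ G i (map fst u) (xword u)) => //.
    by apply: cell_reduced; [exact: reduced_cons cr|case/andP: pu => _; exact: pos_word_neq0].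
  exists B', (y j (k^-1 * (- a / ch / (1 + - a / ch * sg))) * yword v1); split=> //.
    apply: GenMul; first by apply: Uminus_Bminus; apply: Uminus_y.
    by apply: Uminus_Bminus; apply: yword_Uminus.
  by rewrite -e1 xword_cons mulrA /= xrootNK mul1r.
have sg0 : sg != 0.
  by apply/eqP => h; move: claim1; rewrite h mulr0 subr0 => /eqP; rewrite oner_eq0.
have claim2 : k^-1 + sg * b = 0.
  apply/eqP/negPn/negP => h.
  (* This solves k^-1 r' / (1 + r' sg) = - b for r' = r / ch, so that the first letter of [v1] is
     deleted. *)
  pose r := - b / (k^-1 + sg * b) * ch.
  have er : r / ch = - b / (k^-1 + sg * b) by rewrite /r mulfK.
  have ed : 1 + r / ch * sg = k^-1 / (k^-1 + sg * b).
    rewrite er; move: h; move: (k^-1) => q h; field; exact: h.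
  have [|B' hB' e1] := step r.
    by rewrite ed mulf_neq0 // ?invr_eq0.
  have e2 : k^-1 * (r / ch / (1 + r / ch * sg)) = - b.
    have q0 : k^-1 != 0 by rewrite invr_eq0.
    rewrite ed er; move: h q0; move: (k^-1) => q h q0; field; by rewrite h q0.
  rewrite {}e2 in e1.
  have e3 : y j (- b) * yword v1 = yword v by rewrite xword_cons mulrA /= yrootNK mul1r.
  rewrite {}e3 in e1.
  apply: (@cell_disjoint _ _ (op G) j (map fst v) (yword v)) => //.
    by apply: cell_reduced; [exact: reduced_cons dr|case/andP: pv => _; exact: pos_word_neq0].
  have -> : yword v = Ad N^-1 B'^-1 * N^-1 * (x i r * xword u1).
    rewrite e1 /Ad invrK; move: (Bminus_unit hB') (N) uN (yword v) => uB' N0 uN0 V.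
    by rewrite -!mulrA mulVKr // !mulKr.
  apply: opposite_cell => //.
    by apply: w0_BminusV => //; exact: GenInv.
  apply: GenMul; first by apply: Uplus_Bplus; apply: Uplus_x.
  by apply: Uplus_Bplus; apply: xword_Uplus.
(* This changes [a] into [a * t]; by the two claims the denominator 1 + r' sg becomes [t] and the
   argument of y_j becomes b / t - b. *)
pose r := (t - 1) * a.
have er : r / ch = (t - 1) / sg.
  have : a / ch * sg = 1 by move/eqP: claim1; rewrite subr_eq0 => /eqP.
  by move=> h; rewrite /r -mulrA; congr (_ * _); apply: (mulIf sg0); rewrite h mulVf.
have ed : 1 + r / ch * sg = t by rewrite er mulrVK ?unitfE // addrC subrK.
have [|B' hB' e1] := step r; first by rewrite ed gt_eqF.
have ek : k^-1 = - (sg * b) by apply/eqP; rewrite -subr_eq0 opprK claim2.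
have e2 : k^-1 * (r / ch / (1 + r / ch * sg)) = b / t - b.
  by rewrite ed er ek; field; rewrite sg0 gt_eqF.
have -> : xword ((i, a * t) :: u) = x i r * xword u1.
  by rewrite !xword_cons mulrA -xrootD /= /r; congr (x i _ * _); ring.
have -> : yword ((j, b / t) :: v) = y j (b / t - b) * yword v1.
  by rewrite !xword_cons mulrA -[xroot (op G)]/y /= -yrootD subrK.
rewrite e1 e2; apply: borel_match_big => //.
by rewrite unitrMr ?y_unit.
Qed.

End Compatibility.

(** * Tropicalisation *)

Section Tropical.
Variables (R : realType) (K : zmodClosed R).
Local Notation Rpos := (pos_semifield R).
Local Notation Kmp := (minplus K).

(* The tropical value of a family of positive reals of size [exp (- N v)] up to a
   bounded factor. *)
Definition trop (A : R -> Rpos) (v : Kmp) :=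
  exists C, forall N, 0 <= N -> `|ln (sval (A N)) + N * sval v| <= C.

Lemma trop_lift (v : Kmp) : exists A : R -> Rpos, trop A v.
Proof.
exists (fun N => exist _ (expR (- (N * sval v))) (expR_gt0 _)), 0 => N N0 /=.
by rewrite expRK addNr normr0.
Qed.

Lemma trop_uniq A v v' : trop A v -> trop A v' -> v = v'.
Proof.
move=> [C hC] [C' hC']; apply: val_inj; apply/eqP; rewrite eq_sym -subr_eq0; apply/eqP.
set d := _ - _; apply/eqP; rewrite -normr_eq0; apply/eqP.
have bd N : 0 <= N -> N * `|d| <= C + C'.
  move=> N0; have := hC N N0; have := hC' N N0.
  have -> : N * `|d| = `|N * d| by rewrite normrM (ger0_norm N0).
  rewrite /d /=; move: (ln _) (sval v) (sval v') => l a b h1 h2.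
  have -> : N * (b - a) = (l + N * b) - (l + N * a) by ring.
  by apply: le_trans (ler_normB _ _) _; rewrite addrC lerD.
apply/eqP; rewrite eq_le normr_ge0 andbT leNgt; apply/negP => d0.
have C0 : 0 <= C + C' by have := bd 0 (lexx 0); rewrite mul0r.
have := bd ((C + C' + 1) / `|d|); rewrite mulfVK ?gt_eqF // => h.
by have := h (divr_ge0 (addr_ge0 C0 ler01) (ltW d0)); lra.
Qed.

Lemma trop_one : trop (fun=> sf_one Rpos) (sf_one Kmp).
Proof. by exists 0 => N _ /=; rewrite ln1 mulr0 addr0 normr0. Qed.

Lemma trop_inv A v : trop A v -> trop (fun N => sf_inv (A N)) (sf_inv v).
Proof.
move=> [C hC]; exists C => N N0 /=; rewrite lnV ?posrE ?(svalP (A N)) //.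
by rewrite mulrN -opprD normrN; apply: hC.
Qed.

Lemma trop_mul A B v w : trop A v -> trop B w ->
  trop (fun N => sf_mul (A N) (B N)) (sf_mul v w).
Proof.
move=> [C hC] [C' hC']; exists (C + C') => N N0 /=.
rewrite lnM ?posrE ?(svalP (A N)) ?(svalP (B N)) // mulrDr addrACA.
by apply: le_trans (ler_normD _ _) _; rewrite lerD ?hC ?hC'.
Qed.

(** The logarithm of a sum exceeds the larger logarithm by at most ln 2, and the larger of - N v and
    - N w is - N min(v, w). *)
Lemma trop_add A B v w : trop A v -> trop B w ->
  trop (fun N => sf_add (A N) (B N)) (sf_add v w).
Proof.
move=> [C hC] [C' hC']; exists (C + C' + ln 2) => N N0 /=.
have hA : 0 < sval (A N) := svalP (A N); have hB : 0 < sval (B N) := svalP (B N).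
have := hC N N0; have := hC' N N0; move: hA hB.
move: (sval (A N)) (sval (B N)) (sval v) (sval w) => a b x y a0 b0.
have ab : 0 < a + b by rewrite addr_gt0.
have la : ln a <= ln (a + b) by rewrite ler_ln ?posrE // lerDl ltW.
have lb : ln b <= ln (a + b) by rewrite ler_ln ?posrE // lerDr ltW.
have lmax : ln (a + b) <= Num.max (ln a) (ln b) + ln 2.
  case: (leP (ln a) (ln b)) => h.
    rewrite -lnM ?posrE // ler_ln ?posrE ?mulr_gt0 //.
    by move: h; rewrite ler_ln ?posrE // => h; lra.
  rewrite -lnM ?posrE // ler_ln ?posrE ?mulr_gt0 //.
  by move: h; rewrite ltr_ln ?posrE // => h; lra.
have l2 : 0 <= ln 2 :> R by rewrite ln_ge0 //; lra.
move: lmax; rewrite !ler_norml => + /andP [h1 h2] /andP [h3 h4].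
have xy : x <= y -> N * x <= N * y by move=> h; rewrite ler_wpM2l.
have yx : y <= x -> N * y <= N * x by move=> h; rewrite ler_wpM2l.
case: (leP x y) => hxy.
  have {}xy := xy hxy.
  by case: (leP (ln a) (ln b)) => h lmax; apply/andP; split; lra.
have {}yx := yx (ltW hxy).
by case: (leP (ln a) (ln b)) => h lmax; apply/andP; split; lra.
Qed.

Lemma trop_eval n (a : R -> 'I_n -> Rpos) (v : 'I_n -> Kmp) e :
  (forall k, trop (fun N => a N k) (v k)) ->
  trop (fun N => sf_eval (a N) e) (sf_eval v e).
Proof.
move=> h; elim: e => [k||e1 h1 e2 h2|e1 h1 e2 h2|e1 h1] /=.
- exact: h.
- exact: trop_one.
- exact: trop_add.
- exact: trop_mul.
- exact: trop_inv.
Qed.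

Lemma minplus_lower (s : seq Kmp) : exists k : Kmp, forall v, v \in s -> sval k <= sval v.
Proof.
elim: s => [|v s [k hk]]; first by exists (sf_one Kmp).
exists (sf_add v k) => w; rewrite inE /= => /orP [/eqP ->|/hk h]; rewrite ge_min ?lexx //.
by rewrite h orbT.
Qed.

End Tropical.

(** * Charts of the set U(K) and the distance *)

(* Unlike [big_enum], no commutativity is required of [op]. *)
Lemma big_enum_ord (T : Type) (idx : T) (op : T -> T -> T) n (F : 'I_n -> T) :
  \big[op/idx]_(k <- enum 'I_n) F k = \big[op/idx]_(k < n) F k.
Proof. by rewrite enumT [index_enum _]unlock. Qed.

Section CoordinateWords.
Variables (W : simply_laced_weyl) (K : semifield).
Local Notation I := (slw_index W).
Local Notation nu := (nu W).

Definition coord_word n (c : n.-tuple I) (a : 'I_n -> K) : seq (I * K) :=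
  [seq (tnth c k, a k) | k <- enum 'I_n].

Definition scale_first n (a : 'I_n -> K) (t : K) : 'I_n -> K :=
  fun k => if val k == 0%N then sf_mul (a k) t else a k.

Definition frakU_word (u : seq (I * K)) : frakU W K := pres_word (@frakU_rel W K) u.

Lemma frakU_word_nil : frakU_word [::] = 1%g. Proof. by []. Qed.
Lemma frakU_word_cat u v : frakU_word (u ++ v) = (frakU_word u * frakU_word v)%g.
Proof. by rewrite /frakU_word -pres_mulE. Qed.

Lemma prod_upow (T : Type) (s : seq T) (F : T -> I * K) :
  (\prod_(k <- s) upow (F k).1 (F k).2)%g = frakU_word [seq F k | k <- s].
Proof.
elim: s => [|k s IH]; first by rewrite big_nil.
by rewrite big_cons IH /= -cat1s frakU_word_cat; case: (F k).
Qed.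

Lemma fcoordE (c : nu.-tuple I) (a : 'I_nu -> K) : fcoord c a = frakU_word (coord_word c a).
Proof.
rewrite /coord_word -(@prod_upow _ _ (fun k => (tnth c k, a k))) /fcoord.
by rewrite big_enum_ord.
Qed.

Lemma map_fst_coord_word n (c : n.-tuple I) (a : 'I_n -> K) : map fst (coord_word c a) = c.
Proof. by rewrite /coord_word -map_comp -[RHS](map_tnth_enum c). Qed.

Lemma size_coord_word n (c : n.-tuple I) (a : 'I_n -> K) : size (coord_word c a) = n.
Proof. by rewrite /coord_word size_map size_enum_ord. Qed.

Lemma nth_coord_word n (c : n.-tuple I) (a : 'I_n -> K) p (k : 'I_n) :
  nth p (coord_word c a) k = (tnth c k, a k).
Proof.
have sz : (k < size (enum 'I_n))%N by rewrite size_enum_ord.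
by rewrite /coord_word (nth_map k p _ sz) nth_ord_enum.
Qed.

Lemma coord_word_inj n (c : n.-tuple I) (a b : 'I_n -> K) : coord_word c a = coord_word c b -> a = b.
Proof.
move=> e; apply/funext => k.
by have := congr1 (fun s => nth (tnth c k, a k) s k) e; rewrite !nth_coord_word => -[].
Qed.

Lemma coord_word_scale_first n (c : n.-tuple I) (a : 'I_n -> K) i t : ohead c = Some i ->
  exists p u, coord_word c a = (i, p) :: u /\ coord_word c (scale_first a t) = (i, sf_mul p t) :: u.
Proof.
case: n c a => [|n] c a; first by rewrite (tuple0 c).
case/tupleP: c => j c' /= [<-]; rewrite /coord_word enum_ordSl /=.
eexists; eexists; split; first by rewrite tnth0; reflexivity.
rewrite tnth0; congr (_ :: _).
by apply/eq_in_map => k /mapP [k' _ ->]; rewrite /scale_first /= /bump.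
Qed.

End CoordinateWords.

Section Transition.
Variable W : simply_laced_weyl.
Local Notation I := (slw_index W).
Local Notation nu := (nu W).

Lemma w0_word_reduced (c : nu.-tuple I) : w0_word c -> reduced c.
Proof. by rewrite /reduced => ->; rewrite len_w0 size_tuple. Qed.

Lemma w0_starting i : exists c : nu.-tuple I, w0_word c /\ ohead c = Some i.
Proof.
have [d dw ds] := w0_word_starting i.
have sz : size (i :: d) == nu by rewrite ds.
by exists (Tuple sz).
Qed.

Lemma w0_ending i : exists (c : nu.-tuple I), w0_word c /\ exists c', c = rcons c' i :> seq I.
Proof.
have [d dw ds] := w0_word_starting i.
have sz : size (rev (i :: d)) == nu by rewrite size_rev ds.
exists (Tuple sz); split; first by rewrite /w0_word /= word_prod_rev dw w0V.
by exists (rev d); rewrite /= rev_cons.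
Qed.

(** [matsumoto] is applied to the word with generic coordinates, so one family of expressions serves
    all semifields at once. *)
Lemma trans_ex (c d : nu.-tuple I) : w0_word c -> w0_word d ->
  exists T : 'I_nu -> sfexpr nu, forall (K : semifield) (a : 'I_nu -> K),
    fcoord c a = fcoord d (fun k => sf_eval a (T k)) /\
    forall k0 : K, sf_add k0 k0 = k0 -> (forall k, a k = k0) ->
      forall k, sf_eval a (T k) = k0.
Proof.
move=> hc hd; pose u : seq (I * sfexpr nu) := [seq (tnth c k, SFVar k) | k <- enum 'I_nu].
have uc : map fst u = c by rewrite -map_comp -[RHS](map_tnth_enum c).
have [|||v vd ok] := @matsumoto W nu u d.
- by rewrite uc; exact: w0_word_reduced.
- exact: w0_word_reduced.
- by rewrite uc hc hd.
have sv : size v = nu by rewrite -(size_map fst) vd size_tuple.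
pose T (k : 'I_nu) := (nth (tnth d k, SFOne nu) v k).2.
exists T => K a; have [wc cst] := ok K a.
have eu : eval_word a u = coord_word c a by rewrite /eval_word /coord_word -map_comp.
have evE : eval_word a v = coord_word d (fun k => sf_eval a (T k)).
  (* The comparison of entries needs a default letter, which exists only when nu > 0; otherwise both
     words are empty. *)
  case: (posnP nu) => [n0|n0].
    have -> : v = [::] by apply: size0nil; rewrite sv.
    by apply/esym/size0nil; rewrite size_coord_word.
  pose k0 := Ordinal n0; apply: (@eq_from_nth _ (tnth d k0, sf_one K)).
    by rewrite size_coord_word size_map.
  move=> k; rewrite size_map sv => kn; pose k' := Ordinal kn.
  rewrite /eval_word (nth_map (tnth d k', SFOne nu)) ?sv // -[k in RHS]/(val k') nth_coord_word.
  congr pair; rewrite [RHS](tnth_nth (tnth d k')) -vd.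
  by rewrite (nth_map (tnth d k', SFOne nu)) ?sv.
rewrite eu evE in wc; split; first by rewrite !fcoordE; apply/pres_wordP.
move=> k0 kk ak k; have := cst k0 kk; rewrite eu evE => /(_ _)/allP h.
have /h : all (fun p => p.2 == k0) (coord_word c a).
  by apply/allP => _ /mapP [l _ ->] /=; rewrite ak.
move=> /(_ (tnth d k, sf_eval a (T k))) /= /(_ _)/eqP; apply.
by apply/mapP; exists k => //; rewrite mem_enum.
Qed.

End Transition.

(** * Coordinates and the involution over the positive reals *)

Section PositiveHom.
Variables (R : realType) (W : simply_laced_weyl) (G : pinned_group R W).
Local Notation I := (slw_index W).
Local Notation nu := (nu W).
Local Notation Rpos := (pos_semifield R).

Definition real_word (u : seq (I * Rpos)) : seq (I * R) := [seq (p.1, sval p.2) | p <- u].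

Lemma pos_real_word u : pos_word (real_word u).
Proof. by apply/allP => _ /mapP [p _ ->] /=; exact: (svalP p.2). Qed.

Lemma real_word_inj : injective real_word.
Proof.
apply: inj_map => -[i a] [j b] /= [-> ab]; congr pair; exact: val_inj.
Qed.

(** The relations of the monoid hold for the elements x_i(a), so the matrix of a word depends only
    on its class. *)
Lemma xword_cong u v : word_cong (@frakU_rel W Rpos) u v ->
  xword G (real_word u) = xword G (real_word v).
Proof.
elim=> {u v} [u0 v0 []|//|u v _ -> //|u v w _ -> _ -> //|u u' v v' _ h1 _ h2].
- move=> i j a b d; rewrite /xword /real_word /= !big_cons !big_nil !mulr1.
  exact: x_comm.
- move=> i j a b c a' b' c' d e1 e2 e3; rewrite /xword /real_word /= !big_cons !big_nil !mulr1 !mulrA.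
  have b0 : 0 < sval b' := svalP b'.
  apply: x_braid => //; first by rewrite gt_eqF.
  + exact: (congr1 sval e1).
  + exact: (congr1 sval e2).
  + exact: (congr1 sval e3).
- by move=> i a b; rewrite /xword /real_word /= !big_cons !big_nil !mulr1 xrootD.
- by rewrite /real_word !map_cat !xword_cat h1 h2.
Qed.

Lemma xprodE c (a : 'I_nu -> Rpos) : xprod G c a = xword G (real_word (coord_word c a)).
Proof. by rewrite /xprod /xword /real_word /coord_word -map_comp big_map big_enum_ord. Qed.
Lemma yprodE c (a : 'I_nu -> Rpos) : yprod G c a = xword (op G) (real_word (coord_word c a)).
Proof. by rewrite /yprod /xword /real_word /coord_word -map_comp big_map big_enum_ord. Qed.

End PositiveHom.

Section PositivePhi.
Variables (R : realType) (W : simply_laced_weyl) (G : pinned_group R W).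
Local Notation I := (slw_index W).
Local Notation nu := (nu W).
Local Notation Rpos := (pos_semifield R).
Implicit Types (c d : nu.-tuple I) (a b : 'I_nu -> Rpos).

Lemma fcoord_xprod c d a b : fcoord c a = fcoord d b -> xprod G c a = xprod G d b.
Proof. by rewrite !fcoordE !xprodE => /pres_wordP/xword_cong ->. Qed.
Lemma fcoord_yprod c d a b : fcoord c a = fcoord d b -> yprod G c a = yprod G d b.
Proof. by rewrite !fcoordE !yprodE => /pres_wordP/(xword_cong (op G)) ->. Qed.

Lemma map_fst_real_word (u : seq (I * Rpos)) : map fst (real_word u) = map fst u.
Proof. by rewrite /real_word -map_comp. Qed.

Lemma xprod_inj c a b : w0_word c -> xprod G c a = xprod G c b -> a = b.
Proof.
move=> /w0_word_reduced hc; rewrite !xprodE => h; apply: (@coord_word_inj _ _ _ c); apply: real_word_inj.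
by apply: (@xword_inj _ _ _ _ _ _ _ _ _ h); rewrite ?map_fst_real_word ?map_fst_coord_word //; apply: pos_real_word.
Qed.
Lemma yprod_inj c a b : w0_word c -> yprod G c a = yprod G c b -> a = b.
Proof.
move=> /w0_word_reduced hc; rewrite !yprodE => h; apply: (@coord_word_inj _ _ _ c); apply: real_word_inj.
by apply: (@xword_inj _ _ (op G) _ _ _ _ _ _ h); rewrite ?map_fst_real_word ?map_fst_coord_word //; apply: pos_real_word.
Qed.

(** The relation defining [phi_pos], read in two charts that may differ: T_i wants a chart starting
    with [i] on the left and one starting with [bang i] on the right. *)
Definition chart_match c a d b := borel_match (G := G) (xprod G c a) (yprod G d b).

Lemma phi_pos_chart_match c a b : phi_pos G (fcoord c a) (fcoord c b) -> chart_match c a c b.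
Proof.
move=> [c1 [c2 [a1 [a2 [_ _ /fcoord_xprod e1 /fcoord_yprod e2 h]]]]].
by rewrite /chart_match /borel_match e1 e2.
Qed.

Lemma chart_match_uniq c a d b b' : w0_word d -> chart_match c a d b -> chart_match c a d b' -> b = b'.
Proof.
move=> hd h h'; apply: (yprod_inj hd); apply: borel_match_uniq h h'; rewrite yprodE; exact: yword_Uminus.
Qed.

Lemma chart_match_cong c a d b c' a' d' b' : fcoord c a = fcoord c' a' -> fcoord d b = fcoord d' b' ->
  chart_match c a d b -> chart_match c' a' d' b'.
Proof. by rewrite /chart_match => /fcoord_xprod -> /fcoord_yprod ->. Qed.

Lemma chart_match_compat i c a d b t : w0_word c -> w0_word d -> ohead c = Some i ->
  ohead d = Some (bang i) -> chart_match c a d b -> chart_match c (scale_first a t) d (scale_first b (sf_inv t)).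
Proof.
move=> hc hd ic id; rewrite /chart_match !xprodE !yprodE.
have := w0_word_reduced hc; have := w0_word_reduced hd.
have ec := map_fst_coord_word c a; have ed := map_fst_coord_word d b; move: hc hd.
rewrite /w0_word -ec -ed.
have [p [u [-> ->]]] := coord_word_scale_first a t ic; have [q [v [-> ->]]] := coord_word_scale_first b (sf_inv t) id.
move=> hc hd rd rc huv /=.
apply: (@phi_compat _ _ G i (sval p) (sval q) (sval t) (real_word u) (real_word v)) => //=.
- by rewrite map_fst_real_word.
- by rewrite map_fst_real_word.
- by rewrite map_fst_real_word.
- by rewrite map_fst_real_word.
- by apply/andP; split; [exact: (svalP p)|exact: pos_real_word].
- by apply/andP; split; [exact: (svalP q)|exact: pos_real_word].
- exact: (svalP t).
Qed.

End PositivePhi.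

(** * Left and right multiplication in a fixed chart *)

Section Charts.
Variable W : simply_laced_weyl.
Local Notation I := (slw_index W).
Local Notation nu := (nu W).
Implicit Types (c d : nu.-tuple I) (K : semifield).

Definition eval_chart K (a : 'I_nu -> K) (T : 'I_nu -> sfexpr nu) : 'I_nu -> K :=
  fun k => sf_eval a (T k).

Definition transition c d (T : 'I_nu -> sfexpr nu) := forall K (a : 'I_nu -> K),
  fcoord c a = fcoord d (eval_chart a T) /\
  forall k0 : K, sf_add k0 k0 = k0 -> (forall k, a k = k0) -> forall k, eval_chart a T k = k0.

Definition add_first n K (a : 'I_n -> K) (t : K) : 'I_n -> K :=
  fun k => if val k == 0%N then sf_add t (a k) else a k.
Definition add_last n K (a : 'I_n -> K) (t : K) : 'I_n -> K :=
  fun k => if val k == n.-1 then sf_add (a k) t else a k.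

Lemma coord_word_add_first n K (c : n.-tuple I) (a : 'I_n -> K) i t : ohead c = Some i ->
  exists p u, coord_word c a = (i, p) :: u /\ coord_word c (add_first a t) = (i, sf_add t p) :: u.
Proof.
case: n c a => [|n] c a; first by rewrite (tuple0 c).
case/tupleP: c => j c' /= [<-]; rewrite /coord_word enum_ordSl /=.
eexists; eexists; split; first by rewrite tnth0; reflexivity.
rewrite tnth0; congr (_ :: _).
by apply/eq_in_map => k /mapP [k' _ ->]; rewrite /add_first /= /bump.
Qed.

Lemma coord_word_add_last n K (c : n.-tuple I) (a : 'I_n -> K) i (c' : seq I) t : c = rcons c' i :> seq I ->
  exists u p, coord_word c a = rcons u (i, p) /\ coord_word c (add_last a t) = rcons u (i, sf_add p t).
Proof.
case: n c a => [|n] c a ec; first by have := size_tuple c; rewrite ec size_rcons.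
have sc : size c' = n by have := size_tuple c; rewrite ec size_rcons => -[].
have ei : tnth c ord_max = i.
  by rewrite (tnth_nth i) ec nth_rcons sc /= ltnn eqxx.
rewrite /coord_word enum_ordSr !map_rcons ei.
eexists; eexists; split; first by reflexivity.
congr (rcons _ (i, _)); last by rewrite /add_last /= eqxx.
apply/eq_in_map => k /mapP [k' _ ->]; rewrite /add_last /=.
by rewrite ltn_eqF.
Qed.

Variable c : nu.-tuple I.
Variables (dl dr : I -> nu.-tuple I) (Tl Sl Tr Sr : I -> 'I_nu -> sfexpr nu).
Hypothesis dl_head : forall i, ohead (dl i) = Some i.
Hypothesis dr_last : forall i, exists c' : seq I, dr i = rcons c' i :> seq I.
Hypothesis hTl : forall i, transition c (dl i) (Tl i).
Hypothesis hSl : forall i, transition (dl i) c (Sl i).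
Hypothesis hTr : forall i, transition c (dr i) (Tr i).
Hypothesis hSr : forall i, transition (dr i) c (Sr i).

Section OverSemifield.
Variable K : semifield.
Implicit Types (x z : 'I_nu -> K) (t : K).

(** Left multiplication by i^t in the chart [c], carried out in a chart starting with [i]. It uses
    semifield operations only, so that it commutes with tropicalisation. *)
Definition lmul (i : I) t x := eval_chart (add_first (eval_chart x (Tl i)) t) (Sl i).
Definition rmul (i : I) t z := eval_chart (add_last (eval_chart z (Tr i)) t) (Sr i).

Lemma fcoord_lmul i t x : fcoord c (lmul i t x) = (upow i t * fcoord c x)%g.
Proof.
rewrite -(proj1 (hSl i _)) (proj1 (hTl i x)) !fcoordE; set b := eval_chart x _.
have [p [u [-> ->]]] := coord_word_add_first b t (dl_head i).
rewrite -[upow i t]/(frakU_word [:: (i, t)]) -frakU_word_cat; apply/pres_wordP.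
apply: (@WordCat _ _ [:: _] [:: _; _]); last exact: WordRefl.
by apply/WordSym/WordRel/FrakUAdd.
Qed.

Lemma fcoord_rmul i t x : fcoord c (rmul i t x) = (fcoord c x * upow i t)%g.
Proof.
rewrite -(proj1 (hSr i _)) (proj1 (hTr i x)) !fcoordE; set b := eval_chart x _.
have [c' ec'] := dr_last i; have [u [p [-> ->]]] := coord_word_add_last b t ec'.
rewrite -[upow i t]/(frakU_word [:: (i, t)]) -frakU_word_cat -!cats1 -catA; apply/pres_wordP.
apply: WordCat; first exact: WordRefl.
by apply/WordSym/WordRel/FrakUAdd.
Qed.

Definition lmuls x (l : seq (I * K)) := foldr (fun p y => lmul p.1 p.2 y) x l.
Definition rmuls z (l : seq (I * K)) := foldl (fun y p => rmul p.1 p.2 y) z l.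

Lemma fcoord_lmuls x l : fcoord c (lmuls x l) = (frakU_word l * fcoord c x)%g.
Proof.
elim: l => [|[i t] l IH] /=; first by rewrite frakU_word_nil mul1g.
by rewrite fcoord_lmul IH mulgA -frakU_word_cat.
Qed.

Lemma fcoord_rmuls z l : fcoord c (rmuls z l) = (fcoord c z * frakU_word l)%g.
Proof.
elim: l z => [|[i t] l IH] z /=; first by rewrite frakU_word_nil mulg1.
by rewrite IH fcoord_rmul -mulgA -frakU_word_cat.
Qed.

End OverSemifield.

Section TropicalTransfer.
Variables (R : realType) (G : pinned_group R W) (K : zmodClosed R).
Local Notation Rpos := (pos_semifield R).
Local Notation Kmp := (minplus K).

Definition tropv (a : R -> 'I_nu -> Rpos) (v : 'I_nu -> Kmp) :=
  forall k, trop (fun N => a N k) (v k).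

Lemma tropv_lift (v : 'I_nu -> Kmp) : exists a, tropv a v.
Proof.
have [A hA] := choice (fun k => trop_lift (v k)).
by exists (fun N k => A k N) => k; exact: hA.
Qed.

Lemma tropv_uniq a v v' : tropv a v -> tropv a v' -> v = v'.
Proof. by move=> h h'; apply/funext => k; exact: trop_uniq (h k) (h' k). Qed.

Lemma tropv_eval_chart a v T : tropv a v -> tropv (fun N => eval_chart (a N) T) (eval_chart v T).
Proof. by move=> h k; exact: trop_eval. Qed.

Lemma tropv_scale_first a v A t : tropv a v -> trop A t ->
  tropv (fun N => scale_first (a N) (A N)) (scale_first v t).
Proof. by move=> h hA k; rewrite /scale_first; case: eqP => _ //; apply: trop_mul. Qed.

Lemma tropv_lmul i A t a v : trop A t -> tropv a v ->
  tropv (fun N => lmul i (A N) (a N)) (lmul i t v).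
Proof.
move=> hA h; apply: tropv_eval_chart => k; have hk := tropv_eval_chart (Tl i) h k.
by rewrite /add_first; case: eqP => _ //; apply: trop_add.
Qed.

Lemma tropv_rmul i A t a v : trop A t -> tropv a v ->
  tropv (fun N => rmul i (A N) (a N)) (rmul i t v).
Proof.
move=> hA h; apply: tropv_eval_chart => k; have hk := tropv_eval_chart (Tr i) h k.
by rewrite /add_last; case: eqP => _ //; apply: trop_add.
Qed.

Lemma tropv_lmuls (s : seq 'I_nu) b w a v : tropv b w -> tropv a v ->
  tropv (fun N => lmuls (a N) [seq (tnth c k, b N k) | k <- s])
    (lmuls v [seq (tnth c k, w k) | k <- s]).
Proof.
by move=> hb ha; elim: s => //= k s IH; apply: tropv_lmul.
Qed.

Lemma tropv_rmuls (s : seq 'I_nu) b w a v : tropv b w -> tropv a v ->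
  tropv (fun N => rmuls (a N) [seq (tnth c k, b N k) | k <- s])
    (rmuls v [seq (tnth c k, w k) | k <- s]).
Proof.
move=> hb; elim: s a v => //= k s IH a v ha.
exact: (IH (fun N => rmul (tnth c k) (b N k) (a N))) (tropv_rmul _ (hb k) ha).
Qed.

Hypothesis hc : w0_word c.

Lemma fcoord_inj_pos (a b : 'I_nu -> Rpos) : fcoord c a = fcoord c b -> a = b.
Proof. by move=> /(fcoord_xprod G); apply: xprod_inj. Qed.

(** Both sides are coordinates of the product of the elements with coordinates [w] and [v]. For
    positive lifts they coincide by injectivity, and tropical values are unique. *)
Lemma lmuls_rmuls (w v : 'I_nu -> Kmp) : lmuls v (coord_word c w) = rmuls w (coord_word c v).
Proof.
have [a ha] := tropv_lift v; have [b hb] := tropv_lift w.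
apply: tropv_uniq (tropv_lmuls (enum 'I_nu) hb ha) _.
have := tropv_rmuls (enum 'I_nu) ha hb.
congr (tropv _ _); apply/funext => N; apply: fcoord_inj_pos.
by rewrite fcoord_lmuls fcoord_rmuls !fcoordE.
Qed.

Lemma lmuls_const (k0 : Kmp) (v : 'I_nu -> Kmp) : (forall k, sval k0 <= sval (v k)) ->
  lmuls v (coord_word c (fun=> k0)) = fun=> k0.
Proof.
move=> hk; rewrite lmuls_rmuls /coord_word; have kk : sf_add k0 k0 = k0.
  by apply: val_inj; rewrite /= minxx.
elim: (enum _) => //= k s IH; suff -> : rmul (tnth c k) (v k) (fun=> k0) = (fun=> k0) by [].
have e1 : eval_chart (fun=> k0) (Tr (tnth c k)) = fun=> k0.
  by apply/funext => l; apply: (proj2 (hTr _ _)).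
rewrite /rmul e1; apply/funext => l; apply: (proj2 (hSr _ _)) => // l'.
rewrite /add_last; case: eqP => _ //; apply: val_inj => /=.
by apply/eqP; rewrite eq_minl hk.
Qed.

End TropicalTransfer.

End Charts.

(** * Points of the flag manifold and half circles in a chart *)

Section Flags.
Variables (R : realType) (W : simply_laced_weyl) (G : pinned_group R W) (K : zmodClosed R).
Local Notation I := (slw_index W).
Local Notation nu := (nu W).
Local Notation Rpos := (pos_semifield R).
Local Notation Kmp := (minplus K).
Implicit Types (c d : nu.-tuple I).

(** The two changes of chart are inverse on positive coordinates by injectivity, hence on their
    tropical values. *)
Lemma transition_id c d T S (v : 'I_nu -> Kmp) : w0_word c ->
  transition c d T -> transition d c S -> eval_chart (eval_chart v T) S = v.
Proof.
move=> hc hT hS; have [a ha] := tropv_lift v.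
apply: tropv_uniq (tropv_eval_chart S (tropv_eval_chart T ha)) _.
suff e N : eval_chart (eval_chart (a N) T) S = a N.
  by move=> k; have := ha k; congr trop; apply/funext => N; rewrite e.
apply: (fcoord_inj_pos G hc).
by rewrite -(proj1 (hS _ _)) -(proj1 (hT _ _)).
Qed.

Variables (c : nu.-tuple I) (e : 'I_nu -> sfexpr nu).
Hypothesis hc : w0_word c.
Hypothesis he : forall a : 'I_nu -> Rpos, phi_pos G (fcoord c a) (fcoord c (eval_chart a e)).

Lemma chart_match_phi (a : 'I_nu -> Rpos) : chart_match G c a c (eval_chart a e).
Proof. exact/phi_pos_chart_match/he. Qed.

(** Independence of [phi] from the chart and from the expressions: for positive lifts both sides
    match the same element, and the match is unique. *)
Lemma e_change c' e' T (v : 'I_nu -> Kmp) : w0_word c' ->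
  (forall a : 'I_nu -> Rpos, phi_pos G (fcoord c' a) (fcoord c' (eval_chart a e'))) ->
  transition c' c T -> eval_chart (eval_chart v e') T = eval_chart (eval_chart v T) e.
Proof.
move=> hc' he' hT; have [a ha] := tropv_lift v.
apply: tropv_uniq (tropv_eval_chart T (tropv_eval_chart e' ha)) _.
have := tropv_eval_chart e (tropv_eval_chart T ha); congr (tropv _ _); apply/funext => N.
apply: (chart_match_uniq hc (chart_match_phi (eval_chart (a N) T))).
apply: chart_match_cong (phi_pos_chart_match (he' (a N))); first exact: (proj1 (hT _ _)).
exact: (proj1 (hT _ _)).
Qed.

Variables (dl : I -> nu.-tuple I) (Tl Sl : I -> 'I_nu -> sfexpr nu).
Hypothesis hdl : forall i, w0_word (dl i).
Hypothesis dl_head : forall i, ohead (dl i) = Some i.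
Hypothesis hTl : forall i, transition c (dl i) (Tl i).
Hypothesis hSl : forall i, transition (dl i) c (Sl i).

(** The map T_i(t) in the coordinates of [c]. *)
Definition rotate (K' : semifield) i (t : K') (x : 'I_nu -> K') := eval_chart (scale_first (eval_chart x (Tl i)) t) (Sl i).

(** The relation between [phi] and T_i over K, read in the chart starting with [bang i]. For
    positive lifts it follows from [chart_match_compat] and uniqueness of the match. *)
Lemma e_rotate i t (v : 'I_nu -> Kmp) :
  eval_chart (eval_chart (rotate i t v) e) (Tl (bang i)) = scale_first (eval_chart (eval_chart v e) (Tl (bang i))) (sf_inv t).
Proof.
have [a ha] := tropv_lift v; have [A hA] := trop_lift t.
apply: tropv_uniq.
  apply: tropv_eval_chart; apply: tropv_eval_chart; apply: tropv_eval_chart; apply: tropv_scale_first hA.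
  exact: tropv_eval_chart ha.
have := tropv_scale_first (tropv_eval_chart (Tl (bang i)) (tropv_eval_chart e ha)) (trop_inv hA).
congr (tropv _ _); apply/funext => N; rewrite -/(rotate i (A N) (a N)).
apply: (chart_match_uniq (hdl (bang i)) (c := dl i) (a := scale_first (eval_chart (a N) (Tl i)) (A N))).
  apply: (chart_match_compat _ (hdl i) (hdl (bang i)) (dl_head i) (dl_head (bang i))).
  by apply: chart_match_cong (chart_match_phi (a N)); [exact: (proj1 (hTl _ _))|exact: (proj1 (hTl _ _))].
apply: chart_match_cong (chart_match_phi (rotate i (A N) (a N))); last exact: (proj1 (hTl _ _)).
by rewrite -(proj1 (hSl _ _)).
Qed.

Definition chart_point (v : 'I_nu -> Kmp) := (fcoord c v, fcoord c (eval_chart v e)).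

Lemma chart_point_flag v : flag G Kmp (chart_point v).
Proof. by exists c, e; split=> //; exists v. Qed.

Lemma circle_rotate i t v : circle_orbit i (chart_point v) (chart_point (rotate i t v)).
Proof.
exists t; split.
  exists (dl i), (eval_chart v (Tl i)); split.
  - exact: hdl.
  - exact: dl_head.
  - exact: (proj1 (hTl i v)).
  - by rewrite -[RHS]/(fcoord (dl i) (scale_first (eval_chart v (Tl i)) t)) (proj1 (hSl i _)).
exists (dl (bang i)), (eval_chart (eval_chart v e) (Tl (bang i))); split.
- exact: hdl.
- exact: dl_head.
- exact: (proj1 (hTl (bang i) _)).
- by rewrite [LHS](proj1 (hTl (bang i) _)) e_rotate.
Qed.

Lemma scale_first_one (x : 'I_nu -> Kmp) : scale_first x (sf_one Kmp) = x.
Proof. by apply/funext => k; rewrite /scale_first sf_mulC sf_mul1; case: ifP. Qed.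

Lemma scale_first_mul (x : 'I_nu -> Kmp) t u : scale_first (scale_first x t) u = scale_first x (sf_mul t u).
Proof. by apply/funext => k; rewrite /scale_first; case: (val k == 0%N) => //; rewrite sf_mulA. Qed.

Lemma rotate_one i v : rotate i (sf_one Kmp) v = v.
Proof. by rewrite /rotate scale_first_one (transition_id _ hc (hTl i) (hSl i)). Qed.

Lemma edge_rotate i t v : chart_point v = chart_point (rotate i t v) \/
  edge G (chart_point v) (chart_point (rotate i t v)).
Proof.
case: (pselect (chart_point v = chart_point (rotate i t v))) => [->|ne]; [by left|right].
split=> //; try exact: chart_point_flag.
exists i, (circle_orbit i (chart_point v)); split.
- by exists (chart_point v) => //; exact: chart_point_flag.
- by rewrite -{2}(rotate_one i v); exact: circle_rotate.
- exact: circle_rotate.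
Qed.

Lemma edge_sym (B B' : frakU W Kmp * frakU W Kmp) : edge G B B' -> edge G B' B.
Proof.
move=> [fB fB' ne [i [C [hC CB CB']]]]; split=> //; first by move=> h; exact: ne.
by exists i, C.
Qed.

Lemma lmul_rotate i t (v : 'I_nu -> Kmp) : exists u : Kmp, lmul Tl Sl i t v = rotate i u v.
Proof.
case: (posnP nu) => [n0|n0].
  exists t; rewrite /lmul /rotate; congr eval_chart; apply/funext => k.
  by have := ltn_ord k; rewrite [X in (_ < X)%N]n0.
pose b := eval_chart v (Tl i) (Ordinal n0).
(* The quotient (t + b) / b turns the first coordinate b into t + b. *)
exists (sf_mul (sf_add t b) (sf_inv b)); rewrite /lmul /rotate; congr eval_chart; apply/funext => k.
rewrite /add_first /scale_first; case: eqP => // k0.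
have -> : k = Ordinal n0 by apply: val_inj.
by rewrite -/b sf_mulC -sf_mulA sf_mulV sf_mulC sf_mul1.
Qed.

(* Two points with the same image under [lmul i t] lie on a common half
   i-circle. *)
Lemma edge_lmul_eq i t (v w : 'I_nu -> Kmp) : lmul Tl Sl i t v = lmul Tl Sl i t w ->
  chart_point v = chart_point w \/ edge G (chart_point v) (chart_point w).
Proof.
have [p ->] := lmul_rotate i t v; have [q ->] := lmul_rotate i t w.
move=> /(congr1 (fun x => eval_chart x (Tl i))); rewrite !(transition_id _ (hdl i) (hSl i) (hTl i)).
move=> e1; have -> : w = rotate i (sf_mul p (sf_inv q)) v; last exact: edge_rotate.
rewrite /rotate -scale_first_mul e1 scale_first_mul sf_mulC sf_mulV scale_first_one.
by rewrite (transition_id _ hc (hTl i) (hSl i)).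
Qed.

End Flags.

(** * The path of length 2 nu - 1 *)

Section Distance.
Variables (R : realType) (W : simply_laced_weyl) (G : pinned_group R W) (K : zmodClosed R).
Local Notation I := (slw_index W).
Local Notation nu := (nu W).
Local Notation Kmp := (minplus K).

Lemma left_charts (c : nu.-tuple I) : w0_word c ->
  exists (d : I -> nu.-tuple I) (T S : I -> 'I_nu -> sfexpr nu), forall i,
    [/\ w0_word (d i), ohead (d i) = Some i, transition c (d i) (T i) &
        transition (d i) c (S i)].
Proof.
move=> hc; have [d hd] := choice (@w0_starting W).
have [T hT] := choice (fun i => trans_ex hc (proj1 (hd i))).
have [S hS] := choice (fun i => trans_ex (proj1 (hd i)) hc).
by exists d, T, S => i; have [h1 h2] := hd i; split.
Qed.

Lemma right_charts (c : nu.-tuple I) : w0_word c ->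
  exists (d : I -> nu.-tuple I) (T S : I -> 'I_nu -> sfexpr nu), forall i,
    [/\ exists c', d i = rcons c' i :> seq I, transition c (d i) (T i) &
        transition (d i) c (S i)].
Proof.
move=> hc; have [d hd] := choice (@w0_ending W).
have [T hT] := choice (fun i => trans_ex hc (proj1 (hd i))).
have [S hS] := choice (fun i => trans_ex (proj1 (hd i)) hc).
by exists d, T, S => i; have [h1 h2] := hd i; split.
Qed.

Lemma flags_common_chart (B B' : frakU W Kmp * frakU W Kmp) :
  flag G Kmp B -> flag G Kmp B' ->
  exists (c : nu.-tuple I) (e : 'I_nu -> sfexpr nu) (v w : 'I_nu -> Kmp),
    [/\ w0_word c,
      forall a : 'I_nu -> pos_semifield R, phi_pos G (fcoord c a) (fcoord c (eval_chart a e)),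
      B = chart_point c e v & B' = chart_point c e w].
Proof.
case: B B' => [H1 H2] [H1' H2'] [c [e [hc he [v [/= e1 e2]]]]] [c' [e' [hc' he' [v' [/= e1' e2']]]]].
have [T hT] := trans_ex hc' hc.
exists c, e, v, (eval_chart v' T); split=> //; first by rewrite e1 e2.
rewrite e1' e2' /chart_point -(e_change hc he v' hc' he' hT); congr pair.
  exact: (proj1 (hT Kmp v')).
exact: (proj1 (hT Kmp (eval_chart v' e'))).
Qed.

Lemma distance_flags (i0 : I) (B B' : frakU W Kmp * frakU W Kmp) :
  flag G Kmp B -> flag G Kmp B' -> distance_le G (2 * nu - 1) B B'.
Proof.
move=> fB fB'; have [c [e [v [w [hc he -> ->]]]]] := flags_common_chart fB fB'.
have nu0 : (0 < nu)%N by rewrite -len_w0 (w0_desc i0).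
have [dl [Tl [Sl hl]]] := left_charts hc; have [dr [Tr [Sr hr]]] := right_charts hc.
have hdl i : w0_word (dl i) by have [] := hl i.
have dl_head i : ohead (dl i) = Some i by have [] := hl i.
have hTl i : transition c (dl i) (Tl i) by have [] := hl i.
have hSl i : transition (dl i) c (Sl i) by have [] := hl i.
have dr_last i : exists c', dr i = rcons c' i :> seq I by have [] := hr i.
have hTr i : transition c (dr i) (Tr i) by have [] := hr i.
have hSr i : transition (dr i) c (Sr i) by have [] := hr i.
have [k0 hk0] := minplus_lower (codom v ++ codom w).
have hv k : sval k0 <= sval (v k) by apply: hk0; rewrite mem_cat codom_f.
have hw k : sval k0 <= sval (w k) by apply: hk0; rewrite mem_cat codom_f orbT.
pose l := coord_word c (fun=> k0).
(* [X x j] is the product of the last [j] letters of the constant word with the point [x]; the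
   letters are prefixed starting from the last one. *)
pose X x j := lmuls Tl Sl x (drop (nu - j) l).
have X0 x : X x 0%N = x by rewrite /X subn0 drop_oversize // size_coord_word.
have Xnu x : (forall k, sval k0 <= sval (x k)) -> X x nu = fun=> k0.
  move=> hx; rewrite /X subnn drop0.
  exact: (lmuls_const dl_head dr_last hTl hSl hTr hSr G hc hx).
have Xstep j : (j < nu)%N -> exists i, forall x, X x j.+1 = lmul Tl Sl i k0 (X x j).
  move=> jn; have kn : (nu - j.+1 < nu)%N by lia.
  exists (tnth c (Ordinal kn)) => x; rewrite /X.
  have -> : drop (nu - j.+1) l = (tnth c (Ordinal kn), k0) :: drop (nu - j) l.
    rewrite (drop_nth (tnth c (Ordinal kn), k0)) ?size_coord_word //.
    rewrite -[X in nth _ _ X]/(val (Ordinal kn)) nth_coord_word /=; congr (_ :: drop _ _); lia.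
  by [].
have near_step x j : (j < nu)%N ->
    chart_point c e (X x j) = chart_point c e (X x j.+1) \/ edge G (chart_point c e (X x j)) (chart_point c e (X x j.+1)).
  move=> /Xstep [i ->].
  have [u ->] := lmul_rotate Tl Sl i k0 (X x j).
  exact: (edge_rotate hc he hdl dl_head hTl hSl).
have top : chart_point c e (X v nu.-1) = chart_point c e (X w nu.-1) \/
    edge G (chart_point c e (X v nu.-1)) (chart_point c e (X w nu.-1)).
  have [|i hi] := Xstep nu.-1; first by rewrite prednK.
  apply: (edge_lmul_eq hc he hdl dl_head hTl hSl (i := i) (t := k0)).
  by rewrite -!hi prednK // !Xnu.
(* The path visits [X v 0] to [X v (nu - 1)], jumps by [top] to [X w (nu - 1)] and descends to
   [X w 0]. The common value [X v nu = X w nu] is skipped, which saves one step. *)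
exists (fun j => if (j < nu)%N then chart_point c e (X v j) else chart_point c e (X w (2 * nu - 1 - j)%N)).
split.
- by rewrite nu0 X0.
- by rewrite ltnNge (_ : (nu <= 2 * nu - 1)%N) ?subnn ?X0 //; lia.
- by move=> j _; case: ifP => _; apply: chart_point_flag.
move=> j jn; case: (ltnP j.+1 nu) => h1.
  by rewrite (ltnW h1); apply: near_step; exact: ltnW.
case: (ltnP j nu) => h2.
  have -> : j = nu.-1 by lia.
  by rewrite (_ : 2 * nu - 1 - nu.-1.+1 = nu.-1)%N //; lia.
have -> : (2 * nu - 1 - j = (2 * nu - 1 - j.+1).+1)%N by lia.
case: (near_step w (2 * nu - 1 - j.+1)%N); first lia.
  by move=> ->; left.
by move=> h; right; exact: edge_sym.
Qed.

(** [distance_le] allows repeated points, while connectedness asks for genuine edges; the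
    repetitions are dropped. *)
Lemma edge_path (p : nat -> frakU W Kmp * frakU W Kmp) k :
  (forall j, (j < k)%N -> p j = p j.+1 \/ edge G (p j) (p j.+1)) ->
  exists (m : nat) (q : nat -> frakU W Kmp * frakU W Kmp),
    [/\ q 0%N = p 0%N, q m = p k & forall j, (j < m)%N -> edge G (q j) (q j.+1)].
Proof.
elim: k => [|k IH] hp; first by exists 0%N, p.
have [|m [q [q0 qm hq]]] := IH; first by move=> j jk; apply: hp; exact: ltnW.
case: (hp k (ltnSn k)) => [ek|hk]; first by exists m, q; rewrite -ek.
exists m.+1, (fun j => if (j <= m)%N then q j else p k.+1); split=> //.
  by rewrite ltnn.
move=> j; rewrite ltnS => jm; rewrite jm; case: ltnP => h; first exact: hq.
have -> : j = m by apply/eqP; rewrite eqn_leq jm h.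
by rewrite qm.
Qed.

End Distance.

Theorem theorem2 (R : realType) (W : simply_laced_weyl)
    (hI : (0 < #|slw_index W|)%N) (G : pinned_group R W)
    (K : zmodClosed R) (hK : exists2 a : R, a \in K & a != 0) :
  (forall B B' : frakU W (minplus K) * frakU W (minplus K),
     flag G (minplus K) B -> flag G (minplus K) B' ->
     distance_le G (2 * nu W - 1) B B') /\
  flag_connected G (minplus K).
Proof.
have [i0 _] := card_gt0P hI.
split=> [B B'|B B' fB fB']; first exact: (distance_flags i0).
have [p [<- <- _ hp]] := distance_flags i0 fB fB'.
by have [m [q [q0 qm hq]]] := edge_path hp; exists m, q.
Qed.
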